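(* Let $N\ge1$, $\rho\in[0,1)$, $\alpha\in[0,1]$, $q\in(0,1)$, and let $(r_n)_{n\ge0}$ satisfy $0\le r_n<1$ and $\lim_{n\to\infty}n^\gamma r_n=c>0$ for some $\gamma\in(\tfrac12,1]$. Let $Z_n(i)\in[0,1]$ ($i=1,\dots,N$, $n\ge0$) evolve by $Z_{n+1}(i)=(1-r_n)Z_n(i)+r_n(\rho I_{n+1}(i)+(1-\rho)q)$, where, with $\mathcal F_n=\sigma(Z_k(i):\,1\le i\le N,\ 0\le k\le n)$ and $Z_n=\frac1N\sum_{i=1}^N Z_n(i)$, the $I_{n+1}(1),\dots,I_{n+1}(N)\in\{0,1\}$ are conditionally independent given $\mathcal F_n$ with $P(I_{n+1}(i)=1\mid\mathcal F_n)=(1-\alpha)Z_n(i)+\alpha Z_n$. Assume the law of $(Z_0(1),\dots,Z_0(N))$ is permutation invariant, $E[Z_0(i)]=\tfrac12$ and $E[Z_0(1-Z_0)]>0$. (i) If $\tfrac12<\gamma<1$, then \[\Big(n^{\gamma/2}e^{c(1-\rho)t}\big(Z_{\lfloor n+n^\gamma t\rfloor}-q\big)\Big)_{t\ge0}\xrightarrow{d}(W_{V_t})_{t\ge0},\quad V_t=\frac{cq(1-q)\rho^2}{2N(1-\rho)}e^{2c(1-\rho)t}.\] (ii) If $\gamma=1$ and $2c(1-\rho)>1$, then \[\Big(n^{1/2}(1+t)^{c(1-\rho)}\big(Z_{\lfloor n+nt\rfloor}-q\big)\Big)_{t\ge0}\xrightarrow{d}(W_{V_t})_{t\ge0},\quad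 V_t=\frac{c^2q(1-q)\rho^2}{N(2c(1-\rho)-1)}(1+t)^{2c(1-\rho)-1}.\] Here $W$ is a standard Brownian motion and convergence in distribution is with respect to the Skorohod topology on $D[0,+\infty)$. *)

(* Defs.v *)
From HB Require Import structures.
From mathcomp Require Import all_boot all_order all_algebra.
From mathcomp Require Import all_classical all_reals all_analysis.
Set Implicit Arguments. Unset Strict Implicit. Unset Printing Implicit Defensive.
Import Order.TTheory GRing.Theory Num.Theory.
Import numFieldNormedType.Exports.
Local Open Scope classical_set_scope.
Local Open Scope ring_scope.

Section Defs.
Context {R : realType}.

(** Paths in D[0,+oo): real functions on [0,+oo) (values at t < 0 ignored)
    that are right-continuous with left limits. *)
Definition cadlag (x : R -> R) : Prop :=
  (forall t : R, 0 <= t -> x @ t^'+ --> x t) /\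
  (forall t : R, 0 < t -> cvg (x @ t^'-)).

Definition time_change (lam : R -> R) : Prop :=
  {within [set t : R | 0 <= t], continuous lam} /\
  (forall s t : R, 0 <= s -> s < t -> lam s < lam t) /\
  (forall u : R, 0 <= u -> exists2 t, 0 <= t & lam t = u).

(** Convergence in the Skorohod J1 topology of D[0,+oo)
    (Billingsley, Convergence of Probability Measures, 2nd ed., Thm 16.2). *)
Definition skorohod_cvg (xs : nat -> R -> R) (x : R -> R) : Prop :=
  exists2 lam : nat -> R -> R, (forall n, time_change (lam n)) &
  (forall e : R, 0 < e -> \forall n \near \oo,
      forall t, 0 <= t -> `|lam n t - t| <= e) /\
  (forall (m e : R), 0 <= m -> 0 < e -> \forall n \near \oo,
      forall t, 0 <= t <= m -> `|xs n (lam n t) - x t| <= e).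

(** Continuity of a functional on the (metrizable) Skorohod space D[0,+oo). *)
Definition skorohod_continuous (F : (R -> R) -> R) : Prop :=
  forall (xs : nat -> R -> R) (x : R -> R),
    (forall n, cadlag (xs n)) -> cadlag x -> skorohod_cvg xs x ->
    (fun n => F (xs n)) @ \oo --> F x.

Definition cvg_dist_skorohod d (T : measurableType d) (P : probability T R)
    d' (T' : measurableType d') (P' : probability T' R)
    (X : nat -> T -> R -> R) (Y : T' -> R -> R) : Prop :=
  forall F : (R -> R) -> R,
    (exists M : R, forall x, cadlag x -> `|F x| <= M) ->
    skorohod_continuous F ->
    (fun n => \int[P]_w (F (X n w))%:E)%E @ \oo -->
      (\int[P']_w (F (Y w))%:E)%E.

Definition std_brownian d' (T' : measurableType d') (P' : probability T' R)
    (W : R -> T' -> R) : Prop :=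
  (forall w, W 0 w = 0) /\
  (forall w, {within [set t : R | 0 <= t], continuous (fun t => W t w)}) /\
  (forall t, measurable_fun setT (W t)) /\
  (forall (k : nat) (ts : nat -> R) (Bs : nat -> set R),
    0 <= ts 0%N ->
    (forall j, (j < k)%N -> ts j < ts j.+1) ->
    (forall j, measurable (Bs j)) ->
    P' (\bigcap_(j in [set j : nat | (0 < j <= k)%N])
          [set w | Bs j (W (ts j) w - W (ts j.-1) w)]) =
    (\prod_(1 <= j < k.+1) normal_prob 0 (Num.sqrt (ts j - ts j.-1)) (Bs j))%E).

Definition zbar (N : nat) T (Z : nat -> 'I_N -> T -> R) (n : nat) (w : T) : R :=
  N%:R^-1 * \sum_(i < N) Z n i w.

Definition filtr d (T : measurableType d) (N : nat)
    (Z : nat -> 'I_N -> T -> R) (n : nat) : set (set T) :=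
  <<s [set A | exists k i (B : set R),
        [/\ (k <= n)%N, measurable B & A = Z k i @^-1` B]] >>.

End Defs.

(* Main.v *)
Require Import Defs.
From HB Require Import structures.
From mathcomp Require Import all_boot all_order all_algebra.
From mathcomp Require Import all_classical all_reals all_analysis.
From mathcomp Require Import measurable_realfun.
From mathcomp Require Import perm.
From mathcomp Require Import ring lra zify.
Set Implicit Arguments. Unset Strict Implicit. Unset Printing Implicit Defensive.
Import Order.TTheory GRing.Theory Num.Theory.
Import numFieldNormedType.Exports.
Local Open Scope classical_set_scope.
Local Open Scope ring_scope.

(** With b = 1 - rho and Pi_n = \prod_(k < n) (1 - b r_k), the recursion reads
    zbar_{n+1} - q = (1 - b r_n) (zbar_n - q) + r_n rho D_n, where D_n is the centred
    mean of the I_{n+1}(i); hence L_n = (zbar_n - q) / Pi_n is a martingale with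
    increments c_n D_n, c_n = rho r_n / Pi_{n+1}.  The same recursion contracts
    \sum_i E (Z_n(i) - q)^2 to 0, so the conditional variance of D_n tends to
    q (1 - q) / N in L^1.  The rescaled process is n^(gamma/2) Pi_n L_{kappa_n(t)},
    with kappa_n(t) the rescaled time, up to a deterministic factor tending to 1
    locally uniformly.

    For such martingales, Lindeberg's replacement along the heat semigroup
    u_t(x) = E f(x + W_t) gives convergence of products of smooth functions of the
    increments on a finite grid; cubic B-spline quasi-interpolation extends this to
    bounded Lipschitz functions of the increments.  Fourth moments of stopped
    martingales control the oscillation between grid points.  A functional F that
    is bounded and Skorohod continuous is the increasing limit of functionals that
    are Lipschitz for the uniform norm on [0, m], which yields
    liminf E F(X_n) >= E F(X); the theorem follows by applying this to F and - F. *)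

(** * Expectation of bounded measurable functions *)

Section bounded_measurable.
Context {R : realType} d {T : measurableType d}.
Implicit Types f g : T -> R.

(** The functional in the definition of convergence is only bounded and sequentially continuous:
    neither its measurability along the paths nor any compactness of the path space is given.
    Functionals that see a path on [0, m] in a Lipschitz way settle both, since along a step path
    such a functional is a Lipschitz function of finitely many real variables. Fourth moments are
    used because j blocks, each of quadratic variation of order 1/j, together contribute j (1/j)^2,
    which vanishes, whereas second moments would leave a constant. The coupling [alpha] cancels in
    the averaged recursion and enters only through the conditional variance, hence the control of
    every individual deviation. For rho > 0 the limit does not start at 0: its initial value is the
    noise accumulated before time n, while the initial state is erased by the scaling. Both regimes
    are one argument run with two deterministic clocks, t and ln (1 + t); the condition 2c(1 - rho)
    > 1 is what makes the affine recursion for the accumulated variance contract when gamma = 1. *)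

Definition bmf f := measurable_fun setT f /\ exists M : R, forall x, `|f x| <= M.

Lemma bmf_meas f : bmf f -> measurable_fun setT f. Proof. by case. Qed.

Lemma bmf_cst (c : R) : bmf (fun=> c).
Proof. by split; [exact: measurable_cst | exists `|c|]. Qed.

Lemma bmfD f g : bmf f -> bmf g -> bmf (fun x => f x + g x).
Proof.
move=> [mf [M hM]] [mg [K hK]]; split; first exact: measurable_funD.
by exists (M + K) => x; rewrite (le_trans (ler_normD _ _))// lerD.
Qed.

Lemma bmfN f : bmf f -> bmf (fun x => - f x).
Proof.
move=> [mf [M hM]]; split; first exact: measurableT_comp.
by exists M => x; rewrite normrN.
Qed.

Lemma bmfB f g : bmf f -> bmf g -> bmf (fun x => f x - g x).
Proof. by move=> hf hg; apply: bmfD => //; exact: bmfN. Qed.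

Lemma bmfM f g : bmf f -> bmf g -> bmf (fun x => f x * g x).
Proof.
move=> [mf [M hM]] [mg [K hK]]; split; first exact: measurable_funM.
by exists (M * K) => x; rewrite normrM ler_pM.
Qed.

Lemma bmfZ (c : R) f : bmf f -> bmf (fun x => c * f x).
Proof. by move=> hf; apply: bmfM => //; exact: bmf_cst. Qed.

Lemma bmfX f n : bmf f -> bmf (fun x => f x ^+ n).
Proof.
move=> hf; elim: n => [|n IH]; first exact: bmf_cst.
by under eq_fun do rewrite exprS; exact: bmfM.
Qed.

Lemma bmf_norm f : bmf f -> bmf (fun x => `|f x|).
Proof.
move=> [mf [M hM]]; split; first exact: measurableT_comp.
by exists M => x; rewrite normr_id.
Qed.

Lemma bmf_sum I (s : seq I) (p : pred I) (F : I -> T -> R) :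
  (forall i, p i -> bmf (F i)) -> bmf (fun x => \sum_(i <- s | p i) F i x).
Proof.
move=> h; elim: s => [|i s IH].
  by under eq_fun do rewrite big_nil; exact: bmf_cst.
under eq_fun do rewrite big_cons; case pi: (p i) => //.
by apply: bmfD => //; exact: h.
Qed.

Lemma bmf_prod I (s : seq I) (p : pred I) (F : I -> T -> R) :
  (forall i, p i -> bmf (F i)) -> bmf (fun x => \prod_(i <- s | p i) F i x).
Proof.
move=> h; elim: s => [|i s IH].
  by under eq_fun do rewrite big_nil; exact: bmf_cst.
under eq_fun do rewrite big_cons; case pi: (p i) => //.
by apply: bmfM => //; exact: h.
Qed.

Lemma bmf_comp (g : R -> R) (f : T -> R) : measurable_fun setT f ->
  measurable_fun setT g -> (exists M, forall x, `|g x| <= M) ->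
  bmf (fun x => g (f x)).
Proof.
move=> mf mg [M hM]; split; first exact: measurableT_comp.
by exists M.
Qed.

Lemma bmf_indic (A : set T) : measurable A -> bmf (\1_A : T -> R).
Proof.
move=> mA; split; first exact: measurable_indic.
exists 1 => x; rewrite indicE; case: (_ \in _) => /=; rewrite ?normr1 ?normr0//.
Qed.

End bounded_measurable.

Section expectation.
Context {R : realType} d {T : measurableType d} (P : probability T R).
Implicit Types f g : T -> R.

Definition Ex f : R := fine (\int[P]_x (f x)%:E)%E.

Lemma bmf_int f : bmf f -> P.-integrable setT (EFin \o f).
Proof.
move=> [mf [M hM]]; apply: measurable_bounded_integrable => //.
  by rewrite (le_lt_trans (probability_le1 P _))// ltry.
exists M; split; rewrite ?num_real// => y My x _.
exact: (le_trans (hM x) (ltW My)).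
Qed.

Lemma ExE f : bmf f -> (\int[P]_x (f x)%:E)%E = (Ex f)%:E.
Proof. by move=> hf; rewrite fineK//; apply: integrable_fin_num => //; exact: bmf_int. Qed.

Lemma eq_Ex f g : (forall x, f x = g x) -> Ex f = Ex g.
Proof. by move=> h; congr Ex; exact/funext. Qed.

Lemma ExD_int f g : P.-integrable setT (EFin \o f) ->
  P.-integrable setT (EFin \o g) ->
  Ex (fun x => f x + g x) = Ex f + Ex g.
Proof. by move=> hf hg; rewrite [LHS]RintegralD. Qed.

Lemma ExZ_int (c : R) f : P.-integrable setT (EFin \o f) ->
  Ex (fun x => c * f x) = c * Ex f.
Proof. by move=> hf; rewrite [LHS]RintegralZl. Qed.

Lemma le_Ex_int f g : P.-integrable setT (EFin \o f) ->
  P.-integrable setT (EFin \o g) ->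
  (forall x, f x <= g x) -> Ex f <= Ex g.
Proof. by move=> hf hg h; apply: le_Rintegral. Qed.

Lemma ExD f g : bmf f -> bmf g -> Ex (fun x => f x + g x) = Ex f + Ex g.
Proof. by move=> /bmf_int hf /bmf_int hg; exact: ExD_int. Qed.

Lemma ExZ (c : R) f : bmf f -> Ex (fun x => c * f x) = c * Ex f.
Proof. by move=> /bmf_int; exact: ExZ_int. Qed.

Lemma ExN f : bmf f -> Ex (fun x => - f x) = - Ex f.
Proof. by move=> hf; rewrite -mulN1r -ExZ//; apply: eq_Ex => x; rewrite mulN1r. Qed.

Lemma ExB f g : bmf f -> bmf g -> Ex (fun x => f x - g x) = Ex f - Ex g.
Proof. by move=> hf hg; rewrite ExD ?ExN//; exact: bmfN. Qed.

Lemma Ex_cst (c : R) : Ex (fun=> c) = c.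
Proof.
transitivity (c * fine (P setT)); first exact: Rintegral_cst.
by rewrite probability_setT mulr1.
Qed.

Lemma le_Ex f g : bmf f -> bmf g -> (forall x, f x <= g x) -> Ex f <= Ex g.
Proof. by move=> /bmf_int hf /bmf_int hg; exact: le_Ex_int. Qed.

Lemma Ex_ge0 f : (forall x, 0 <= f x) -> 0 <= Ex f.
Proof. by move=> h; apply: fine_ge0; apply: integral_ge0 => x _; rewrite lee_fin. Qed.

Lemma Ex_norm f : bmf f -> `|Ex f| <= Ex (fun x => `|f x|).
Proof. by move=> hf; apply: le_normr_Rintegral => //; exact: bmf_int. Qed.

Lemma Ex_norm_le f g : bmf f -> bmf g -> (forall x, `|f x| <= g x) -> `|Ex f| <= Ex g.
Proof.
move=> hf hg h; rewrite (le_trans (Ex_norm hf))//.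
by apply: le_Ex => //; exact: bmf_norm.
Qed.

Lemma Ex_bound f (M : R) : bmf f -> (forall x, `|f x| <= M) -> `|Ex f| <= M.
Proof.
move=> hf h; rewrite -[leRHS]Ex_cst; apply: Ex_norm_le => //; exact: bmf_cst.
Qed.

Lemma Ex_sum I (s : seq I) (p : pred I) (F : I -> T -> R) :
  (forall i, p i -> bmf (F i)) ->
  Ex (fun x => \sum_(i <- s | p i) F i x) = \sum_(i <- s | p i) Ex (F i).
Proof.
move=> h; elim: s => [|i s IH].
  by under eq_Ex do rewrite big_nil; rewrite big_nil Ex_cst.
under eq_Ex do rewrite big_cons; rewrite big_cons; case pi: (p i) => //.
by rewrite ExD ?IH//; [exact: h|exact: bmf_sum].
Qed.

Lemma Ex_indic (A : set T) : measurable A -> Ex \1_A = fine (P A).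
Proof. by move=> mA; rewrite /Ex integral_indic// setIT. Qed.

Lemma sum_ltn n k : (\sum_(m < n) (m < k) = minn n k)%N.
Proof. by elim: n => [|n IH]; rewrite ?big_ord0 ?min0n// big_ord_recr/= IH; lia. Qed.

(** The sum counts the integers in 1, ..., n that are at most [y], so it is the truncation of [y]. A
    bounded function is thereby within 1 of a finite sum of indicators of its superlevel sets. *)
Lemma layer_cake (y : R) n : 0 <= y <= n%:R ->
  `|y - \sum_(m < n) (m.+1%:R <= y)%R%:R| <= 1.
Proof.
move=> /andP[y0 yn].
have -> : (\sum_(m < n) ((m.+1%:R <= y)%R%:R : R)) = (Num.truncn y)%:R.
  have tn : (Num.truncn y <= n)%N.
    by rewrite -(ler_nat R) (le_trans _ yn)// truncn_le.
  rewrite -[RHS]mulr1n -natr_sum; congr (_%:R).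
  rewrite (eq_bigr (fun m : 'I_n => (m < Num.truncn y)%N : nat)); last first.
    by move=> m _; rewrite truncn_ge_nat.
  rewrite sum_ltn; exact/minn_idPr.
have := truncn_itv y0; case/andP => h1 h2.
rewrite ger0_norm ?subr_ge0// lerBlDr -natr1 ?[1 + _]addrC in h2 *.
exact: ltW.
Qed.

(** Stands in for approximation by simple functions: [f] is stretched affinely onto [0, n], where
    [layer_cake] replaces it by indicators up to an error 1; undoing the stretch leaves an error of
    order 1/n. *)
Lemma Ex_ext f g : bmf f -> bmf g ->
  (forall B : set R, measurable B -> Ex (fun x => (\1_B (f x) : R) * g x) = 0) ->
  Ex (fun x => f x * g x) = 0.
Proof.
move=> hf hg h0; case: (hf) => mf [M hM]; case: (hg) => mg [K hK].
have M0 : 0 <= M by rewrite (le_trans _ (hM point)).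
have K0 : 0 <= K by rewrite (le_trans _ (hK point)).
(* The case [B = setT]; it cancels the constant that the affine rescaling of [f] adds. *)
have g0 : Ex g = 0.
  rewrite -(h0 setT measurableT); apply: eq_Ex => x.
  by rewrite indicE in_setT mul1r.
suff H n : (0 < n)%N -> `|Ex (fun x => f x * g x)| <= 2 * (M + 1) * K / n%:R.
  apply/eqP; rewrite -normr_eq0 eq_le normr_ge0 andbT.
  apply/ler_addgt0Pl => e e0; rewrite addr0.
  pose n := (Num.truncn (2 * (M + 1) * K / e)).+1.
  apply: (le_trans (H n isT)); rewrite ler_pdivrMr ?ltr0n//.
  rewrite [leRHS]mulrC -ler_pdivrMr//; apply/ltW.
  exact: truncnS_gt.
move=> n0.
have n0' : (0 : R) < n%:R by rewrite ltr0n.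
(* At this scale [c * (f x + (M + 1))] stays in [0, n]; adding 1 to [M] keeps the denominator
   positive when [M = 0]. *)
pose c := n%:R / (2 * (M + 1)) : R.
have M1 : 0 < 2 * (M + 1) by rewrite mulr_gt0// ltr_wpDl.
have c0 : 0 < c by rewrite divr_gt0.
pose y x := c * (f x + (M + 1)).
have hy x : 0 <= y x <= n%:R.
  have := hM x; rewrite ler_norml => /andP[h1 h2].
  rewrite mulr_ge0/= ?(ltW c0)//; last by lra.
  by rewrite /y /c mulrAC ler_pdivrMr// ler_pM2l//; lra.
pose A m := [set z : R | m.+1%:R <= c * (z + (M + 1))].
have mA m : measurable (A m).
  rewrite (_ : A m = `[m.+1%:R / c - (M + 1), +oo[%classic).
    exact: measurable_itv.
  apply/seteqP; split => z; rewrite /A /= in_itv/= andbT lerBlDr ler_pdivrMr// [c * _]mulrC//.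
have hA m : bmf (fun x => \1_(A m) (f x) : R).
  apply: (@bmf_comp _ _ _ (\1_(A m)) f) => //.
  by exists 1 => z; rewrite indicE; case: (_ \in _) => /=; rewrite ?normr1 ?normr0.
have E0 : Ex (fun x => (\sum_(m < n) \1_(A m) (f x)) * g x) = 0.
  under eq_Ex do rewrite big_distrl/=.
  rewrite Ex_sum => [|m _]; last exact: bmfM.
  by rewrite big1// => m _; exact: h0.
have hS : bmf (fun x => \sum_(m < n) \1_(A m) (f x) : R).
  by apply: bmf_sum => m _.
have hB : bmf (fun x => (y x - \sum_(m < n) \1_(A m) (f x)) * g x).
  apply: bmfM => //; apply: bmfB => //; apply: bmfZ; apply: bmfD => //; exact: bmf_cst.
have -> : Ex (fun x => f x * g x) =
   c^-1 * Ex (fun x => (y x - \sum_(m < n) \1_(A m) (f x)) * g x).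
  have -> : Ex (fun x => (y x - \sum_(m < n) \1_(A m) (f x)) * g x) =
      c * Ex (fun x => f x * g x).
    transitivity (Ex (fun x => c * (f x * g x) + (c * (M + 1)) * g x) -
        Ex (fun x => (\sum_(m < n) \1_(A m) (f x)) * g x)).
      rewrite -ExB; [|by apply: bmfD; apply: bmfZ => //; exact: bmfM|exact: bmfM].
      by apply: eq_Ex => x; rewrite /y; ring.
    rewrite E0 subr0 ExD; [|by apply: bmfZ; exact: bmfM|exact: bmfZ].
    by rewrite !ExZ//; [rewrite g0 mulr0 addr0|exact: bmfM].
  by rewrite mulKf// gt_eqF.
rewrite normrM gtr0_norm ?invr_gt0// mulrC ler_pdivrMr//.
apply: (@le_trans _ _ K); last first.
  rewrite (_ : _ * c = K)// /c; field.
  by rewrite !gt_eqF// ltr_wpDl.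
apply: Ex_bound => // x; rewrite normrM -[leRHS]mul1r ler_pM//.
have := layer_cake (hy x); congr (`| _ - _ | <= _); apply: eq_bigr => m _.
by rewrite indicE; congr (nat_of_bool _)%:R; apply/idP/idP => [h|/set_mem//]; apply/mem_set.
Qed.

End expectation.

(** * Smooth test functions and approximate solutions of the heat equation *)

Section lipschitz_functions.
Context {R : realType}.

Lemma lipschitz_continuous (C : R) (f : R -> R) :
  (forall x y, `|f x - f y| <= C * `|x - y|) -> continuous f.
Proof.
move=> h x; apply/cvgrPdist_le => e e0.
have C1 : 0 < `|C| + 1 by rewrite ltr_wpDl.
near=> y.
rewrite (le_trans (h _ _))// (le_trans (ler_wpM2r (normr_ge0 _) (ler_norm C)))//.
apply: (@le_trans _ _ ((`|C| + 1) * `|x - y|)); first by rewrite ler_wpM2r// lerDl.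
rewrite -ler_pdivlMl//.
near: y; apply: cvgr_dist_le; first exact: cvg_id.
by rewrite mulr_gt0// invr_gt0.
Unshelve. all: by end_near. Qed.

Lemma lipschitz_measurable (C : R) (f : R -> R) :
  (forall x y, `|f x - f y| <= C * `|x - y|) -> measurable_fun setT f.
Proof. by move=> h; apply: continuous_measurable_fun; exact: lipschitz_continuous h. Qed.

(* Abstracts C^2 functions with Lipschitz second derivative: [f1], [f2] play the
   role of f', f''. *)
Definition Tay (C : R) (f f1 f2 : R -> R) :=
  [/\ (forall x, [/\ `|f x| <= C, `|f1 x| <= C & `|f2 x| <= C]),
      (forall x y, [/\ `|f x - f y| <= C * `|x - y|,
          `|f1 x - f1 y| <= C * `|x - y| & `|f2 x - f2 y| <= C * `|x - y|]) &
      (forall x y, `|f (x + y) - f x - f1 x * y - f2 x * y ^+ 2 / 2| <= C * `|y| ^+ 3)].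

(* Families solving the heat equation u_t' = u_t'' / 2 up to a defect s^(3/2). *)
Definition heat (C K : R) (u u1 u2 : R -> R -> R) :=
  (forall t, 0 <= t -> Tay C (u t) (u1 t) (u2 t)) /\
  (forall t s x, 0 <= t -> 0 <= s ->
     `|u (t + s) x - u t x - u2 t x * s / 2| <= K * (s * Num.sqrt s)).

Lemma Tay_meas C f f1 f2 : Tay C f f1 f2 ->
  [/\ measurable_fun setT f, measurable_fun setT f1 & measurable_fun setT f2].
Proof.
move=> [_ h _]; split; apply: (@lipschitz_measurable C) => x y; by case: (h x y).
Qed.

End lipschitz_functions.

(** * Martingale differences and Lindeberg replacement *)

Section martingale.
Context {R : realType} d {T : measurableType d} (P : probability T R).
Variable (Fg : nat -> set (set T)).
Hypothesis Fsub : forall k A, Fg k A -> measurable A.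
Hypothesis Fmono : forall k, Fg k `<=` Fg k.+1.
Local Notation E := (Ex P).

Definition adp k (f : T -> R) :=
  @measurable_fun _ _ (g_sigma_algebraType (Fg k)) R setT f.

Lemma adp_pre k f (B : set R) : adp k f -> measurable B -> <<s Fg k >> (f @^-1` B).
Proof. by move=> h mB; have := h measurableT _ mB; rewrite setTI. Qed.

Lemma sigma_meas k A : <<s Fg k >> A -> measurable A.
Proof.
apply; split; last by move=> B; exact: Fsub.
exact: sigma_algebra_measurable.
Qed.

Lemma adp_meas k f : adp k f -> measurable_fun setT f.
Proof. by move=> h _ B mB; rewrite setTI; apply: (@sigma_meas k); exact: adp_pre. Qed.

Lemma adpS k f : adp k f -> adp k.+1 f.
Proof.
move=> h _ B mB; have hk := h measurableT _ mB.
by move=> X [sX gX]; apply: hk; split => // C /Fmono; exact: gX.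
Qed.

Lemma adpS_le k j f : (k <= j)%N -> adp k f -> adp j f.
Proof.
move=> /subnKC <-; elim: (j - k)%N => [|i IH] h; first by rewrite addn0.
by rewrite addnS; apply: adpS; exact: IH.
Qed.

Lemma adp_cst k c : adp k (fun=> c). Proof. exact: measurable_cst. Qed.
Lemma adpD k f g : adp k f -> adp k g -> adp k (fun x => f x + g x).
Proof. exact: measurable_funD. Qed.
Lemma adpB k f g : adp k f -> adp k g -> adp k (fun x => f x - g x).
Proof. exact: measurable_funB. Qed.
Lemma adpM k f g : adp k f -> adp k g -> adp k (fun x => f x * g x).
Proof. exact: measurable_funM. Qed.
Lemma adpX k f n : adp k f -> adp k (fun x => f x ^+ n).
Proof. exact: measurable_funX. Qed.
Lemma adp_comp k (g : R -> R) f : measurable_fun setT g -> adp k f ->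
  adp k (fun x => g (f x)).
Proof. by move=> mg mf; apply: measurableT_comp. Qed.

(* [v k] is the conditional variance of [D k] given the sigma-algebra generated
   by [Fg k]; conditioning is expressed by testing against adapted functions. *)
Definition mdiff (D v : nat -> T -> R) :=
  [/\ (forall k, measurable_fun setT (D k) /\ forall w, `|D k w| <= 1),
      (forall k, measurable_fun setT (v k) /\ forall w, `|v k w| <= 1),
      (forall k f, adp k f -> bmf f -> E (fun w => f w * D k w) = 0) &
      (forall k f, adp k f -> bmf f ->
         E (fun w => f w * D k w ^+ 2) = E (fun w => f w * v k w))].

Variables D v : nat -> T -> R.
Hypothesis hD : mdiff D v.

Lemma bmf_D k : bmf (D k).
Proof. by case: hD => /(_ k)[? ?] _ _ _; split => //; exists 1. Qed.
Lemma bmf_v k : bmf (v k).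
Proof. by case: hD => _ /(_ k)[? ?] _ _; split => //; exists 1. Qed.
Let D1 k w : `|D k w| <= 1. Proof. by case: hD => /(_ k)[]. Qed.

Section moments.
Variables (k0 : nat) (A S : nat -> T -> R) (a : nat -> R).
Hypothesis adA : forall j, adp (k0 + j) (A j).
Hypothesis adS : forall j, adp (k0 + j) (S j).
Hypothesis leA : forall j w, `|A j w| <= a j.
Hypothesis S0 : forall w, S 0%N w = 0.
Hypothesis SS : forall j w, S j.+1 w = S j w + A j w * D (k0 + j)%N w.

Let bA j : bmf (A j). Proof. by split; [exact: (adp_meas (@adA j)) | exists (a j)]. Qed.

Lemma bmf_S j : bmf (S j).
Proof.
elim: j => [|j IH]; first by rewrite (_ : S 0%N = fun=> 0); [exact: bmf_cst|exact/funext].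
rewrite (_ : S j.+1 = fun w => S j w + A j w * D (k0 + j)%N w); last exact/funext.
by apply: bmfD => //; apply: bmfM => //; exact: bmf_D.
Qed.

Let stepD n j : E (fun w => (S j w ^+ n * A j w) * D (k0 + j)%N w) = 0.
Proof.
case: hD => _ _ h _; apply: h; first by apply: adpM => //; exact: adpX.
by apply: bmfM => //; apply: bmfX; exact: bmf_S.
Qed.

Lemma a_ge0 j : 0 <= a j. Proof. exact: le_trans (leA j point). Qed.

Let leAD j w : (A j w * D (k0 + j)%N w) ^+ 2 <= a j ^+ 2.
Proof.
rewrite -[leLHS]real_normK ?num_real// ler_pXn2r ?nnegrE ?a_ge0//.
by rewrite normrM -[leRHS]mulr1 ler_pM.
Qed.

(** Increments of a martingale transform are orthogonal: the cross term tests [D] against the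
    adapted function [S j * A j], and the square of an increment is at most [a j ^+ 2] because [D]
    is bounded by 1. *)
Lemma moment2 j : E (fun w => S j w ^+ 2) <= \sum_(i < j) a i ^+ 2.
Proof.
elim: j => [|j IH].
  rewrite big_ord0 (_ : (fun w => _) = fun=> 0) ?Ex_cst//.
  by apply/funext => w; rewrite S0 expr0n.
rewrite big_ord_recr/=.
apply: (@le_trans _ _ (E (fun w => S j w ^+ 2 + a j ^+ 2 +
    2 * ((S j w ^+ 1 * A j w) * D (k0 + j)%N w)))).
  apply: le_Ex => [||w].
  - by apply: bmfX; exact: bmf_S.
  - apply: bmfD; first by apply: bmfD; [apply: bmfX; exact: bmf_S|exact: bmf_cst].
    apply: bmfZ; apply: bmfM; last exact: bmf_D.
    by apply: bmfM => //; apply: bmfX; exact: bmf_S.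
  - rewrite SS; have := leAD j w; set x := S j w; set y := _ * D _ w => h.
    rewrite expr1 -mulrA -/y; lra.
rewrite ExD; first last.
- apply: bmfZ; apply: bmfM; last exact: bmf_D.
  by apply: bmfM => //; apply: bmfX; exact: bmf_S.
- by apply: bmfD; [apply: bmfX; exact: bmf_S|exact: bmf_cst].
rewrite ExD; [|by apply: bmfX; exact: bmf_S|exact: bmf_cst].
rewrite ExZ; last first.
  apply: bmfM; last exact: bmf_D.
  by apply: bmfM => //; apply: bmfX; exact: bmf_S.
by rewrite stepD mulr0 addr0 Ex_cst lerD2r.
Qed.

(** In the expansion of (x + y)^4 the term 4x^3 y has mean zero and 4x y^3 is at most 2x^2 y^2 +
    2y^4, which leaves 8x^2 y^2 + 3y^4. With s the sum of squares so far and z the new square, the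
    step costs 8sz + 3z^2, well below 11((s + z)^2 - s^2); the constant 11 is not optimised. *)
Lemma moment4 j : E (fun w => S j w ^+ 4) <= 11 * (\sum_(i < j) a i ^+ 2) ^+ 2.
Proof.
elim: j => [|j IH].
  rewrite big_ord0 expr0n/= mulr0 (_ : (fun w => _) = fun=> 0) ?Ex_cst//.
  by apply/funext => w; rewrite S0 expr0n.
rewrite big_ord_recr/=; set s := \sum_(i < j) _ in IH *.
have b4 : bmf (fun w => S j w ^+ 4) by apply: bmfX; exact: bmf_S.
have b2 : bmf (fun w => S j w ^+ 2) by apply: bmfX; exact: bmf_S.
have b3 : bmf (fun w => (S j w ^+ 3 * A j w) * D (k0 + j)%N w).
  apply: bmfM; last exact: bmf_D.
  by apply: bmfM => //; apply: bmfX; exact: bmf_S.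
apply: (@le_trans _ _ (E (fun w => ((S j w ^+ 4 + 4 * ((S j w ^+ 3 * A j w) * D (k0 + j)%N w)) +
    (8 * a j ^+ 2) * S j w ^+ 2) + 3 * a j ^+ 4))).
  apply: le_Ex => [||w].
  - by apply: bmfX; exact: bmf_S.
  - apply: bmfD; last exact: bmf_cst.
    by apply: bmfD; [apply: bmfD => //|]; apply: bmfZ.
  - rewrite SS; have := leAD j w; set x := S j w; set y := _ * D _ w => h.
    rewrite -mulrA -/y.
    have h4 : y ^+ 4 <= a j ^+ 4.
      by rewrite -[4%N]/(2 * 2)%N !exprM ler_pXn2r ?nnegrE ?sqr_ge0.
    have h3 : 4 * x * y ^+ 3 <= 2 * x ^+ 2 * y ^+ 2 + 2 * y ^+ 4.
      have := sqr_ge0 (x * y - y ^+ 2); lra.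
    have h2 : 8 * x ^+ 2 * y ^+ 2 <= 8 * a j ^+ 2 * x ^+ 2.
      have := ler_wpM2l (sqr_ge0 x) h; lra.
    have -> : (x + y) ^+ 4 = x ^+ 4 + 4 * (x ^+ 3 * y) + 6 * x ^+ 2 * y ^+ 2 +
      4 * x * y ^+ 3 + y ^+ 4 by ring.
    lra.
rewrite ExD; [|by apply: bmfD; [apply: bmfD => //|]; apply: bmfZ|exact: bmf_cst].
rewrite ExD; [|by apply: bmfD => //; apply: bmfZ|exact: bmfZ].
rewrite ExD//; last exact: bmfZ.
rewrite (ExZ P 4 b3) (ExZ P _ b2) (stepD 3) mulr0 addr0 Ex_cst.
have := moment2 j; rewrite -/s => h2.
have h2' : 8 * a j ^+ 2 * E (fun w => S j w ^+ 2) <= 8 * a j ^+ 2 * s.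
  by rewrite ler_wpM2l// mulr_ge0// sqr_ge0.
have -> : a j ^+ 4 = (a j ^+ 2) ^+ 2 by rewrite -exprM.
have s0 : 0 <= s by apply: sumr_ge0 => i _; exact: sqr_ge0.
have := mulr_ge0 s0 (sqr_ge0 (a j)).
have := sqr_ge0 (a j ^+ 2).
move: (a j ^+ 2) h2' => z h2' z0 sz0; lra.
Qed.

End moments.

Variables (L : nat -> T -> R) (c : nat -> R).
Hypothesis adL : forall k, adp k (L k).
Hypothesis LS : forall k w, L k.+1 w = L k w + c k * D k w.

(* The increment of [L] from [k0], frozen once it leaves [-e, e]. *)
Fixpoint stopped (e : R) k0 j w : R := if j is i.+1 then
  stopped e k0 i w + \1_(`[- e, e]%classic) (stopped e k0 i w) *
    (L (k0 + i).+1 w - L (k0 + i)%N w) else 0.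

Lemma adp_stopped e k0 j : adp (k0 + j) (stopped e k0 j).
Proof.
elim: j => [|j IH]; first exact: adp_cst.
apply: adpD; first by rewrite addnS; exact: adpS.
apply: adpM; last by rewrite addnS; apply: adpB; [exact: adL|apply: adpS; exact: adL].
apply: (@adp_comp _ (\1_(`[- e, e]%classic))); last by rewrite addnS; exact: adpS.
exact: measurable_indic.
Qed.

Lemma stopped_spec e k0 j w : `|stopped e k0 j w| <= e ->
  stopped e k0 j w = L (k0 + j)%N w - L k0 w /\
  forall k, (k <= j)%N -> `|L (k0 + k)%N w - L k0 w| <= e.
Proof.
elim: j => [|j IH] /=.
  rewrite normr0 => e0; split => [|k]; first by rewrite addn0 subrr.
  by rewrite leqn0 => /eqP->; rewrite addn0 subrr normr0.
set s := stopped _ _ _ _ in IH *; rewrite indicE mem_setE in_itv/= -ler_norml.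
have [se|se] := leP `|s| e; last by rewrite mul0r addr0 => h; move: se; rewrite ltNge h.
have [-> hk] := IH se; rewrite mul1r => h.
have E1 : L (k0 + j)%N w - L k0 w + (L (k0 + j).+1 w - L (k0 + j)%N w) =
   L (k0 + j.+1)%N w - L k0 w by rewrite addnS; ring.
split => // k; rewrite leq_eqVlt => /orP[/eqP->|]; last exact: hk.
by rewrite -E1.
Qed.

Lemma maximal e k0 j : 0 < e -> exists B : set T,
  [/\ measurable B,
      fine (P B) <= 11 * (\sum_(i < j) c (k0 + i)%N ^+ 2) ^+ 2 / e ^+ 4 &
      forall w, ~ B w -> forall k, (k <= j)%N -> `|L (k0 + k)%N w - L k0 w| <= e].
Proof.
move=> e0; exists [set w | e < `|stopped e k0 j w|].
have ms : measurable_fun setT (stopped e k0 j) by exact: adp_meas (@adp_stopped e k0 j).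
have mB : measurable [set w | e < `|stopped e k0 j w|].
  have mn : measurable_fun setT (fun w => `|stopped e k0 j w|) by exact: measurableT_comp.
  have := mn measurableT _ (measurable_itv `]e, +oo[); rewrite setTI.
  by congr measurable; apply/seteqP; split => x /=; rewrite in_itv/= andbT.
split => //; last first.
  move=> w /= /negP; rewrite -leNgt => /stopped_spec[_]; exact.
pose A i (w : T) : R := \1_(`[- e, e]%classic) (stopped e k0 i w) * c (k0 + i)%N.
have hS i w : stopped e k0 i.+1 w = stopped e k0 i w + A i w * D (k0 + i)%N w.
  by rewrite /= LS /A -mulrA; congr (_ + _ * _); ring.
have adA i : adp (k0 + i) (A i).
  apply: adpM; last exact: adp_cst.
  apply: (@adp_comp _ (\1_(`[- e, e]%classic))); last exact: adp_stopped.
  exact: measurable_indic.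
have leA i w : `|A i w| <= `|c (k0 + i)%N|.
  rewrite /A normrM ler_piMl// indicE.
  by case: (_ \in _); rewrite ?normr1 ?normr0.
have bS : bmf (stopped e k0 j).
  exact: (@bmf_S k0 A (stopped e k0) _ adA leA (fun=> erefl) hS).
have := moment4 adA (fun j => @adp_stopped e k0 j) leA (fun=> erefl) hS j.
rewrite (eq_bigr (fun i : 'I_j => c (k0 + i)%N ^+ 2)) => [h|i _]; last by rewrite real_normK// num_real.
rewrite ler_pdivlMr ?exprn_gt0// (le_trans _ h)// -Ex_indic// mulrC -ExZ; last exact: bmf_indic.
apply: le_Ex => [||w].
- by apply: bmfZ; exact: bmf_indic.
- exact: bmfX.
- rewrite indicE; case: (boolP (w \in _)) => [/set_mem/= he|_].
    rewrite mulr1 -[leRHS]ger0_norm ?exprn_even_ge0// normrX ler_pXn2r ?nnegrE ?(ltW e0)//.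
    exact: ltW.
  by rewrite mulr0 exprn_even_ge0.
Qed.

Section lindeberg.
Variables (C K : R) (u u1 u2 : R -> R -> R) (sg : R).
Hypothesis hu : heat C K u u1 u2.
Hypothesis sg01 : 0 <= sg <= 1.

Let S k0 j w := L (k0 + j)%N w - L k0 w.

Let adpS0 k0 j : adp (k0 + j) (S k0 j).
Proof. by apply: adpB; [exact: adL|apply: adpS_le (@adL k0); exact: leq_addr]. Qed.

Let SS k0 j w : S k0 j.+1 w = S k0 j w + c (k0 + j)%N * D (k0 + j)%N w.
Proof. by rewrite /S addnS LS; ring. Qed.

Lemma bmf_incr k0 j : bmf (fun w => L (k0 + j)%N w - L k0 w).
Proof.
apply: (@bmf_S k0 (fun j _ => c (k0 + j)%N) (S k0) (fun j => `|c (k0 + j)%N|)) => //.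
- by move=> i; exact: adp_cst.
- by move=> w; rewrite /S addn0 subrr.
Qed.

(** One noise term is traded for heat time [sg * c ^+ 2]. Both sides are expanded around
    [u t (S k0 j w)]: the first order vanishes, the second orders differ by [v - sg] after
    conditioning, and the remainders are cubic in [c]. *)
Lemma lindeberg_step k0 j (f : T -> R) (M t : R) : adp k0 f -> (forall w, `|f w| <= M) ->
  0 <= t ->
  `|E (fun w => f w * u t (S k0 j.+1 w)) -
    E (fun w => f w * u (t + sg * c (k0 + j)%N ^+ 2) (S k0 j w))| <=
  M * (C * c (k0 + j)%N ^+ 2 * E (fun w => `|v (k0 + j)%N w - sg|) +
    (C + `|K|) * `|c (k0 + j)%N| ^+ 3).
Proof.
move=> adf hM t0; set k := (k0 + j)%N; set s := sg * _.
have s0 : 0 <= s by rewrite mulr_ge0 ?sqr_ge0//; case/andP: sg01.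
have adf' : adp k f by apply: adpS_le adf; exact: leq_addr.
have M0 : 0 <= M by rewrite (le_trans _ (hM point)).
case: hu => /(_ t t0) hT hK.
have [m0 m1 m2] := Tay_meas hT.
case: hT => [hb _ hT].
have C0 : 0 <= C by case: (hb 0) => + _ _; apply: le_trans.
have bf : bmf f by split; [exact: adp_meas adf|exists M].
have mS i : measurable_fun setT (S k0 i) by exact: adp_meas (@adpS0 k0 i).
have b0 i : bmf (fun w => u t (S k0 i w)).
  by apply: (@bmf_comp _ _ _ (u t) (S k0 i)) => //; exists C => x; case: (hb x).
have b1 i : bmf (fun w => u1 t (S k0 i w)).
  by apply: (@bmf_comp _ _ _ (u1 t) (S k0 i)) => //; exists C => x; case: (hb x).
have b2 i : bmf (fun w => u2 t (S k0 i w)).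
  by apply: (@bmf_comp _ _ _ (u2 t) (S k0 i)) => //; exists C => x; case: (hb x).
have bts : bmf (fun w => u (t + s) (S k0 j w)).
  have ts0 : 0 <= t + s by rewrite addr_ge0.
  case: (hu) => /(_ _ ts0) hT' _; have [m0' _ _] := Tay_meas hT'; case: hT' => hb' _ _.
  by apply: (@bmf_comp _ _ _ (u (t + s)) (S k0 j)) => //; exists C => x; case: (hb' x).
have bD := bmf_D k; have bv := bmf_v k.
have e1 : E (fun w => (f w * u1 t (S k0 j w)) * D k w) = 0.
  case: hD => _ _ h _; apply: h; last exact: bmfM.
  by apply: adpM => //; apply: (@adp_comp _ _ (S k0 j)) => //; exact: adpS0.
have e2 : E (fun w => (f w * u2 t (S k0 j w)) * D k w ^+ 2) =
          E (fun w => (f w * u2 t (S k0 j w)) * v k w).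
  case: hD => _ _ _ h; apply: h; last exact: bmfM.
  by apply: adpM => //; apply: (@adp_comp _ _ (S k0 j)) => //; exact: adpS0.
pose r1 w := u t (S k0 j.+1 w) - u t (S k0 j w) - u1 t (S k0 j w) * (c k * D k w)
   - u2 t (S k0 j w) * (c k * D k w) ^+ 2 / 2.
pose r2 w := u (t + s) (S k0 j w) - u t (S k0 j w) - u2 t (S k0 j w) * s / 2.
have bc : bmf (fun w => c k * D k w) by exact: bmfZ.
have br1 : bmf r1.
  apply: bmfB; first by apply: bmfB; [exact: bmfB|exact: bmfM].
  by apply: bmfM; [apply: bmfM => //; exact: bmfX|exact: bmf_cst].
have br2 : bmf r2.
  apply: bmfB; first exact: bmfB.
  by apply: bmfM; [apply: bmfM => //; exact: bmf_cst|exact: bmf_cst].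
have b2D : bmf (fun w => f w * u2 t (S k0 j w) * D k w ^+ 2).
  by apply: bmfM; [exact: bmfM|exact: bmfX].
have b1D : bmf (fun w => f w * u1 t (S k0 j w) * D k w).
  by apply: bmfM; [exact: bmfM|].
have b2s : bmf (fun w => f w * u2 t (S k0 j w) * sg).
  by apply: bmfM; [exact: bmfM|exact: bmf_cst].
have b2v : bmf (fun w => f w * u2 t (S k0 j w) * v k w).
  by apply: bmfM; [exact: bmfM|].
(* The first-order term has mean zero by [e1], and [e2] exchanges [D ^+ 2] for [v], so that [v - sg]
   is all that survives at second order besides the two remainders. *)
have -> : E (fun w => f w * u t (S k0 j.+1 w)) - E (fun w => f w * u (t + s) (S k0 j w)) =
   c k ^+ 2 / 2 * E (fun w => f w * u2 t (S k0 j w) * (v k w - sg)) +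
   E (fun w => f w * (r1 w - r2 w)).
  have -> : E (fun w => f w * u2 t (S k0 j w) * (v k w - sg)) =
     E (fun w => f w * u2 t (S k0 j w) * D k w ^+ 2) - E (fun w => f w * u2 t (S k0 j w) * sg).
    by rewrite e2 -ExB//; apply: eq_Ex => w; rewrite mulrBr.
  rewrite -ExB; [|exact: bmfM|exact: bmfM].
  transitivity (E (fun w => c k * (f w * u1 t (S k0 j w) * D k w) +
     (c k ^+ 2 / 2 * (f w * u2 t (S k0 j w) * D k w ^+ 2 - f w * u2 t (S k0 j w) * sg) +
     f w * (r1 w - r2 w)))).
    by apply: eq_Ex => w; rewrite /r1 /r2 /s; field.
  rewrite ExD; first last.
  - apply: bmfD; first by apply: bmfZ; exact: bmfB.
    by apply: bmfM => //; exact: bmfB.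
  - exact: bmfZ.
  rewrite ExD; first last.
  - by apply: bmfM => //; exact: bmfB.
  - by apply: bmfZ; exact: bmfB.
  by rewrite !ExZ ?e1 ?mulr0 ?add0r ?ExB//; exact: bmfB.
rewrite mulrDr (le_trans (ler_normD _ _))// lerD//.
  rewrite normrM ger0_norm ?divr_ge0 ?sqr_ge0//.
  rewrite (_ : M * _ = c k ^+ 2 * (M * C * E (fun w => `|v k w - sg|))); last by ring.
  rewrite -[X in X <= _]mulrA ler_wpM2l ?sqr_ge0//.
  have bvs : bmf (fun w => v k w - sg) by apply: bmfB => //; exact: bmf_cst.
  rewrite -ExZ; last exact: bmf_norm.
  apply: (@le_trans _ _ (1 * `|E (fun w => f w * u2 t (S k0 j w) * (v k w - sg))|)).
    by rewrite ler_wpM2r//; lra.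
  rewrite mul1r; apply: Ex_norm_le => [||w].
  - by apply: bmfM => //; exact: bmfM.
  - by apply: bmfZ; exact: bmf_norm.
  - rewrite normrM ler_wpM2r// normrM ler_pM//; by case: (hb (S k0 j w)).
apply: Ex_bound => [|w]; first by apply: bmfM => //; exact: bmfB.
rewrite normrM ler_pM// (le_trans (ler_normB _ _))// mulrDl lerD//.
  rewrite /r1 SS (le_trans (hT _ _))// ler_wpM2l// ler_pXn2r ?nnegrE//.
  rewrite normrM -[leRHS]mulr1 ler_wpM2l//; exact: D1.
rewrite /r2 (le_trans (hK _ _ _ t0 s0))//.
apply: (@le_trans _ _ (`|K| * (s * Num.sqrt s))).
  by apply: ler_wpM2r; [rewrite mulr_ge0// sqrtr_ge0|exact: ler_norm].
rewrite ler_wpM2l//.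
(* As [sg <= 1], the heat step [s] is at most [c k ^+ 2], so [s * Num.sqrt s] has the order of the
   cubic Taylor remainder. *)
case/andP: sg01 => sg0 sg1.
rewrite exprSr ler_pM ?sqrtr_ge0//.
  by rewrite real_normK ?num_real// /s ler_piMl ?sqr_ge0.
by rewrite -sqrtr_sqr ler_wsqrtr// /s ler_piMl ?sqr_ge0.
Qed.

(** The replacements telescope from the last increment backwards. Each one advances the heat time,
    which is why the induction quantifies over [t]; at the end [u] is evaluated at the constant 0
    and [f] factors out. *)
Lemma lindeberg k0 j (f : T -> R) (M t : R) : adp k0 f -> (forall w, `|f w| <= M) ->
  0 <= t ->
  `|E (fun w => f w * u t (L (k0 + j)%N w - L k0 w)) -
    E f * u (t + sg * \sum_(i < j) c (k0 + i)%N ^+ 2) 0| <=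
  M * (C * (\sum_(i < j) c (k0 + i)%N ^+ 2 * E (fun w => `|v (k0 + i)%N w - sg|)) +
    (C + `|K|) * \sum_(i < j) `|c (k0 + i)%N| ^+ 3).
Proof.
move=> adf hM; elim: j t => [|j IH] t t0.
  have bf : bmf f by split; [exact: adp_meas adf|exists M].
  rewrite !big_ord0 !mulr0 !addr0 mulr0 (_ : E _ = E f * u t 0) ?subrr ?normr0//.
  rewrite mulrC -ExZ//; apply: eq_Ex => w.
  by rewrite addn0 subrr mulrC.
have /andP[sg0 sg1] := sg01.
have h1 := lindeberg_step j adf hM t0.
have h2 : 0 <= t + sg * c (k0 + j)%N ^+ 2 by apply: addr_ge0 => //; apply: mulr_ge0 => //; exact: sqr_ge0.
have {IH} := IH _ h2; rewrite !big_ord_recr/=.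
rewrite (_ : t + sg * c (k0 + j)%N ^+ 2 + sg * _ =
   t + sg * (\sum_(i < j) c (k0 + i)%N ^+ 2 + c (k0 + j)%N ^+ 2)); last by ring.
move: h1; rewrite /S.
set a := E _; set b := E _; set g := _ * u _ 0 => h1 h3.
rewrite (_ : a - g = (a - b) + (b - g)); last by ring.
rewrite (le_trans (ler_normD _ _))// (le_trans (lerD h1 h3))//.
rewrite le_eqVlt; apply/orP; left; apply/eqP; ring.
Qed.

End lindeberg.
End martingale.

(** * Cubic splines and quasi-interpolation *)

Section spline.
Context {R : realType}.
Implicit Types x y : R.

Definition ppart (a x : R) : R := Num.max (x - a) 0.

(** The cardinal cubic B-spline with knots 0, ..., 4: the fourth difference of truncated cubes. Its
    second derivative is Lipschitz, which is the regularity required by [Tay]; the next two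
    definitions are its first two derivatives. *)
Definition bspline x : R := (ppart 0 x ^+ 3 - 4 * ppart 1 x ^+ 3 + 6 * ppart 2 x ^+ 3
  - 4 * ppart 3 x ^+ 3 + ppart 4 x ^+ 3) / 6.
Definition bspline1 x : R := (ppart 0 x ^+ 2 - 4 * ppart 1 x ^+ 2 + 6 * ppart 2 x ^+ 2
  - 4 * ppart 3 x ^+ 2 + ppart 4 x ^+ 2) / 2.
Definition bspline2 x : R := ppart 0 x - 4 * ppart 1 x + 6 * ppart 2 x
  - 4 * ppart 3 x + ppart 4 x.
(** The primitive of the quadratic B-spline, a smooth step rising from 0 to 1 on [0, 3]. Its
    backward difference is [bspline], so sums of translated splines telescope to a partition of
    unity. *)
Definition sstep x : R := (ppart 0 x ^+ 3 - 3 * ppart 1 x ^+ 3 + 3 * ppart 2 x ^+ 3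
  - ppart 3 x ^+ 3) / 6.

Lemma ppartP a x : (x <= a /\ ppart a x = 0) \/ (a <= x /\ ppart a x = x - a).
Proof.
rewrite /ppart; have [h|h] := leP (x - a) 0; [left|right]; split => //; lra.
Qed.

Lemma ppart_ge0 a x : 0 <= ppart a x.
Proof. by rewrite /ppart le_max lexx orbT. Qed.

Lemma bsplineE x : bspline x = sstep x - sstep (x - 1).
Proof.
rewrite /bspline /sstep.
have e a b : ppart a (x - b) = ppart (a + b) x by rewrite /ppart; congr (Num.max _ _); ring.
rewrite !e (_ : 0 + 1 = 1 :> R) 1?(_ : 1 + 1 = 2 :> R) 1?(_ : 2 + 1 = 3 :> R) 1?(_ : 3 + 1 = 4 :> R); try ring.
Qed.

Lemma sstep_le0 x : x <= 0 -> sstep x = 0.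
Proof.
move=> x0; rewrite /sstep /ppart !max_r; lra.
Qed.

Lemma sstep_ge3 x : 3 <= x -> sstep x = 1.
Proof. by move=> x0; rewrite /sstep /ppart !max_l; try lra; field. Qed.

Lemma bspline_out x : x <= 0 \/ 4 <= x -> bspline x = 0.
Proof.
by rewrite bsplineE => -[h|h]; [rewrite !sstep_le0|rewrite !sstep_ge3]; lra.
Qed.

Lemma bspline_ge0 x : 0 <= bspline x.
Proof.
rewrite /bspline.
case: (ppartP 0 x) => -[h0 ->]; case: (ppartP 1 x) => -[h1 ->];
case: (ppartP 2 x) => -[h2 ->]; case: (ppartP 3 x) => -[h3 ->];
case: (ppartP 4 x) => -[h4 ->]; try lra; rewrite ?expr0n/= ?subr0.
- have : 0 <= x ^+ 3 by rewrite exprn_ge0. lra.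
- pose s := x - 1; have s0 : 0 <= s by rewrite /s; lra.
  have s1 : s <= 1 by rewrite /s; lra.
  have : s ^+ 3 <= s by rewrite exprSr; have := mulr_ge0 s0 s0; nra.
  rewrite (_ : x = s + 1); last by rewrite /s; ring.
  have := sqr_ge0 s; nra.
- pose s := 3 - x; have s0 : 0 <= s by rewrite /s; lra.
  have s1 : s <= 1 by rewrite /s; lra.
  have : s ^+ 3 <= s by rewrite exprSr; have := mulr_ge0 s0 s0; nra.
  rewrite (_ : x = 3 - s); last by rewrite /s; ring.
  have := sqr_ge0 s; nra.
- pose s := 4 - x; have s0 : 0 <= s by rewrite /s; lra.
  have : 0 <= s ^+ 3 by rewrite exprn_ge0.
  rewrite (_ : x = 4 - s); last by rewrite /s; ring.
  nra.
Qed.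

Lemma sum_bspline x n : \sum_(j < n) bspline (x - j%:R) = sstep x - sstep (x - n%:R).
Proof.
elim: n => [|n IH]; first by rewrite big_ord0 subr0 subrr.
rewrite big_ord_recr/= IH bsplineE -natr1 (_ : x - n%:R - 1 = x - (n%:R + 1)); ring.
Qed.

(** Far to the left the step vanishes, so telescoping writes [sstep x] as a finite sum of translates
    of the non-negative spline; the upper bound below uses the right end in the same way. *)
Lemma sstep_ge0 x : 0 <= sstep x.
Proof.
pose n := (Num.truncn `|x|).+1.
have h : x - n%:R <= 0.
  by rewrite subr_le0 (le_trans (ler_norm _))// ltW// truncnS_gt.
have := sum_bspline x n; rewrite (sstep_le0 h) subr0 => <-.
by apply: sumr_ge0 => i _; exact: bspline_ge0.
Qed.

Lemma sstep_le1 x : sstep x <= 1.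
Proof.
pose n := (Num.truncn (3 + `|x|)).+1.
have h : 3 <= x + n%:R.
  have : 3 + `|x| <= n%:R by rewrite ltW// truncnS_gt.
  have := ler_norm (- x); rewrite normrN; lra.
have := sum_bspline (x + n%:R) n; rewrite (sstep_ge3 h) addrK => e.
rewrite -subr_ge0 -e.
by apply: sumr_ge0 => i _; exact: bspline_ge0.
Qed.

(** When [x] and [x + y] lie on the same side of the knot, the remainder is 0 or exactly [y ^+ 3];
    across the knot it is a cube, or a difference of two cubes of equal sign, no larger than
    that. *)
Lemma cube_taylor (a x y : R) : `|ppart a (x + y) ^+ 3 - ppart a x ^+ 3 -
  3 * ppart a x ^+ 2 * y - 6 * ppart a x * y ^+ 2 / 2| <= `|y| ^+ 3.
Proof.
rewrite -normrX.
case: (ppartP a (x + y)) => -[h0 ->]; case: (ppartP a x) => -[h1 ->].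
- by rewrite !expr0n/= !mulr0 !mul0r !subr0 normr0.
- have -> : 0 ^+ 3 - (x - a) ^+ 3 - 3 * (x - a) ^+ 2 * y - 6 * (x - a) * y ^+ 2 / 2 =
    y ^+ 3 - (x + y - a) ^+ 3 by field.
  have y0 : y <= 0 by lra.
  have : 0 <= (- y) ^+ 3 - (- (x + y - a)) ^+ 3.
    by rewrite subr_ge0 lerXn2r ?nnegrE; lra.
  have : 0 <= (- (x + y - a)) ^+ 3 by apply: exprn_ge0; lra.
  move=> z1 z2; have z3 : y ^+ 3 <= 0 by have : 0 <= (- y) ^+ 3; [apply: exprn_ge0; lra|nra].
  rewrite !ler0_norm//; nra.
- rewrite !expr0n/= !mulr0 !mul0r !subr0.
  have z1 : 0 <= x + y - a by lra.
  have y0 : 0 <= y by lra.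
  by rewrite !ger0_norm ?exprn_ge0// ler_pXn2r ?nnegrE//; lra.
- have -> : (x + y - a) ^+ 3 - (x - a) ^+ 3 - 3 * (x - a) ^+ 2 * y
    - 6 * (x - a) * y ^+ 2 / 2 = y ^+ 3 by field.
  by [].
Qed.

Definition clamp x := Num.max 0 (Num.min x 4).

Lemma clampP x : (x <= 0 /\ clamp x = 0) \/ (0 <= x <= 4 /\ clamp x = x) \/ (4 <= x /\ clamp x = 4).
Proof.
rewrite /clamp; have [h|h] := leP x 4.
  by have [h'|h'] := leP 0 x; [right; left|left]; split; lra.
by right; right; rewrite max_r//; split; lra.
Qed.

Lemma clamp_itv x : 0 <= clamp x <= 4.
Proof. by case: (clampP x) => [[_ ->]|[[? ->]|[_ ->]]]; lra. Qed.

Lemma clamp_lip x y : `|clamp x - clamp y| <= `|x - y|.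
Proof.
rewrite real_ler_normr ?num_real//.
have h (z z' : R) : z <= z' -> clamp z <= clamp z' /\ clamp z' - clamp z <= z' - z.
  by case: (clampP z) => [[? ->]|[[? ->]|[? ->]]];
  case: (clampP z') => [[? ->]|[[? ->]|[? ->]]] ?; split; lra.
case: (leP x y) => xy.
  have [h1 h2] := h _ _ xy; apply/orP; right; rewrite distrC ger0_norm; lra.
have [h1 h2] := h _ _ (ltW xy); apply/orP; left; rewrite ger0_norm; lra.
Qed.

(** Beyond 4 the truncated powers grow and only their combination cancels. Clamping to [0, 4], where
    each of them is at most 4, lets bounds be proved term by term. *)
Lemma bspline_clamp x : [/\ bspline x = bspline (clamp x),
  bspline1 x = bspline1 (clamp x) & bspline2 x = bspline2 (clamp x)].
Proof.
have o (z : R) : z <= 0 -> [/\ bspline z = 0, bspline1 z = 0 & bspline2 z = 0].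
  move=> z0; split; first by apply: bspline_out; left.
    by rewrite /bspline1 /ppart !max_r ?expr0n/=; lra.
  by rewrite /bspline2 /ppart !max_r; lra.
have o' (z : R) : 4 <= z -> [/\ bspline z = 0, bspline1 z = 0 & bspline2 z = 0].
  move=> z0; split; first by apply: bspline_out; right.
    by rewrite /bspline1 /ppart !max_l; try lra; field.
  by rewrite /bspline2 /ppart !max_l; try lra; ring.
case: (clampP x) => [[h ->]|[[h ->]//|[h ->]]].
  have [-> -> ->] := o _ h; by have [-> -> ->] := o _ (lexx 0).
have [-> -> ->] := o' _ h; by have [-> -> ->] := o' _ (lexx 4).
Qed.

Lemma ppart_lip a x y : `|ppart a x - ppart a y| <= `|x - y|.
Proof.
have h (z z' : R) : z <= z' -> ppart a z <= ppart a z' /\ ppart a z' - ppart a z <= z' - z.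
  by case: (ppartP a z) => [[? ->]|[? ->]];
  case: (ppartP a z') => [[? ->]|[? ->]] ?; split; lra.
case: (leP x y) => xy.
  by have [h1 h2] := h _ _ xy; rewrite !ler0_norm; lra.
by have [h1 h2] := h _ _ (ltW xy); rewrite !ger0_norm; lra.
Qed.

Lemma ppart_le4 a x : 0 <= a -> x <= 4 -> ppart a x <= 4.
Proof. by move=> a0 x4; case: (ppartP a x) => [[? ->]|[? ->]]; lra. Qed.

(** The constant is generous: five coefficients of size at most 6 give the factor 30, and the
    largest bound needed is 30 * 4^3 / 6 = 320. *)
Lemma Tay_bspline : Tay 1000 bspline bspline1 bspline2.
Proof.
pose co : 'I_5 -> R := tnth [tuple 1; -4; 6; -4; 1].
have c6 i : `|co i| <= 6.
  case: i => -[|[|[|[|[|//]]]]] Hi; rewrite /co !(tnth_nth 0)/=;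
   by rewrite ?normrN ger0_norm//; lra.
have cE n x : \sum_(i < 5) co i * ppart i%:R x ^+ n =
    ppart 0 x ^+ n - 4 * ppart 1 x ^+ n + 6 * ppart 2 x ^+ n - 4 * ppart 3 x ^+ n + ppart 4 x ^+ n.
  by rewrite !big_ord_recl big_ord0 /co !(tnth_nth 0)/= /bump /=; ring.
have B0 x : bspline x = (\sum_(i < 5) co i * ppart i%:R x ^+ 3) / 6 by rewrite cE.
have B1 x : bspline1 x = (\sum_(i < 5) co i * ppart i%:R x ^+ 2) / 2 by rewrite cE.
have B2 x : bspline2 x = \sum_(i < 5) co i * ppart i%:R x ^+ 1 by rewrite cE !expr1.
have sb (F : 'I_5 -> R) (A : R) : (forall i, `|F i| <= A) -> `|\sum_(i < 5) co i * F i| <= 30 * A.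
  move=> h; rewrite (le_trans (ler_norm_sum _ _ _))//.
  apply: (@le_trans _ _ (\sum_(i < 5) 6 * A)).
    by apply: ler_sum => i _; rewrite normrM ler_pM.
  rewrite sumr_const card_ord -[X in X <= _]mulr_natr; lra.
have pb n i x : x <= 4 -> `|ppart (i : 'I_5)%:R x ^+ n| <= 4 ^+ n.
  move=> h; rewrite normrX lerXn2r ?nnegrE// ger0_norm ?ppart_ge0// ppart_le4//.
split.
- move=> x; have [-> -> ->] := bspline_clamp x; have /andP[_ h] := clamp_itv x.
  split.
  + have := sb _ _ (fun i => pb 3 i _ h).
    rewrite B0 normrM [`|6^-1|]ger0_norm//; lra.
  + have := sb _ _ (fun i => pb 2 i _ h).
    rewrite B1 normrM [`|2^-1|]ger0_norm//; lra.
  + have := sb _ _ (fun i => pb 1 i _ h).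
    rewrite B2; lra.
- move=> x y; have [-> -> ->] := bspline_clamp x; have [-> -> ->] := bspline_clamp y.
  have := clamp_lip x y; have /andP[_] := clamp_itv x; have /andP[_] := clamp_itv y.
  move: (clamp x) (clamp y) => {}x' y' hy hx hxy.
  have sd n : \sum_(i < 5) co i * ppart i%:R x' ^+ n - \sum_(i < 5) co i * ppart i%:R y' ^+ n =
     \sum_(i < 5) co i * (ppart i%:R x' ^+ n - ppart i%:R y' ^+ n).
    by rewrite -sumrB; apply: eq_bigr => i _; rewrite mulrBr.
  have pl n (i : 'I_5) : `|ppart i%:R x' ^+ n.+1 - ppart i%:R y' ^+ n.+1| <= n.+1%:R * 4 ^+ n * `|x - y|.
    rewrite subrXX normrM mulrC ler_pM//; last by rewrite (le_trans (ppart_lip _ _ _)).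
    rewrite (le_trans (ler_norm_sum _ _ _))//.
    apply: (@le_trans _ _ (\sum_(k < n.+1) 4 ^+ n)).
      apply: ler_sum => k _; rewrite normrM.
      rewrite [leRHS](_ : _ = 4 ^+ (n - k) * 4 ^+ k :> R); last by rewrite -exprD subnK// -ltnS.
      by rewrite ler_pM// pb.
    by rewrite sumr_const card_ord mulr_natl.
  have xy0 := normr_ge0 (x - y).
  split.
  + have := sb _ _ (pl 2); rewrite -sd !B0 -mulrBl normrM [`|6^-1|]ger0_norm//.
    move: (`|_|) => z; lra.
  + have := sb _ _ (pl 1%N); rewrite -sd !B1 -mulrBl normrM [`|2^-1|]ger0_norm//.
    move: (`|\sum_(i < 5) _ - _|) => z; lra.
  + have := sb _ _ (pl 0%N); rewrite -sd !B2; move: (`|\sum_(i < 5) _ - _|) => z; lra.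
- move=> x y; have := sb _ _ (fun i => cube_taylor i%:R x y).
  set S := \sum_(i < 5) _.
  have -> : bspline (x + y) - bspline x - bspline1 x * y - bspline2 x * y ^+ 2 / 2 = S / 6.
    rewrite B0 B0 B1 B2 /S.
    by rewrite !big_ord_recl !big_ord0 !expr1; field.
  rewrite normrM [`|6^-1|]ger0_norm//.
  have : 0 <= `|y| ^+ 3 by rewrite exprn_ge0.
  lra.
Qed.

End spline.

Lemma Tay_comp_affine (R : realType) (C a b : R) f f1 f2 : Tay C f f1 f2 ->
  exists C', Tay C' (fun x => f (a * x + b)) (fun x => a * f1 (a * x + b))
   (fun x => a ^+ 2 * f2 (a * x + b)).
Proof.
move=> [hb hl hT].
have C0 : 0 <= C by case: (hb 0) => + _ _; apply: le_trans.
(* With a base at least 1, the powers of [|a|] up to the third are all below [A ^+ 3], so one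
   constant serves every clause of [Tay]. *)
pose A := 1 + `|a|; have A1 : 1 <= A by rewrite lerDl.
have aA : `|a| <= A by rewrite lerDr.
have A0 : 0 <= A by exact: le_trans A1.
have aXA n : `|a| ^+ n <= A ^+ n by rewrite lerXn2r ?nnegrE.
have hX n m (z : R) : (n <= m)%N -> 0 <= z -> `|a| ^+ n * z <= A ^+ m * z.
  move=> nm z0; rewrite ler_wpM2r// (le_trans (aXA n))//.
  by rewrite ler_weXn2l.
have hXC n (z : R) : (n <= 3)%N -> z <= C -> `|a| ^+ n * z <= A ^+ 3 * C.
  move=> nm zC; apply: (@le_trans _ _ (`|a| ^+ n * C)); last exact: hX.
  by rewrite ler_wpM2l ?exprn_ge0.
exists (A ^+ 3 * C); split.
- move=> x; have [h0 h1 h2] := hb (a * x + b); split.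
  + by rewrite -[X in X <= _]mul1r -[1](expr0 `|a|) hXC.
  + by rewrite normrM -[`|a|]expr1 hXC.
  + by rewrite normrM normrX hXC.
- move=> x y; have [h0 h1 h2] := hl (a * x + b) (a * y + b).
  have e : `|a * x + b - (a * y + b)| = `|a| * `|x - y|.
    by rewrite -normrM; congr `|_|; ring.
  have := normr_ge0 (x - y) => n0.
  rewrite e in h0 h1 h2.
  have q n : (n <= 3)%N -> `|a| ^+ n * (C * `|x - y|) <= A ^+ 3 * (C * `|x - y|).
    by move=> n3; rewrite hX// mulr_ge0.
  split.
  + have := q 1%N isT; rewrite expr1; lra.
  + rewrite -mulrBr normrM; have := ler_wpM2l (normr_ge0 a) h1; have := q 2%N isT; lra.
  + rewrite -mulrBr normrM normrX; have := ler_wpM2l (exprn_ge0 2 (normr_ge0 a)) h2.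
    have := q 3%N isT; lra.
- move=> x y; have := hT (a * x + b) (a * y).
  rewrite (_ : a * (x + y) + b = a * x + b + a * y); last by ring.
  rewrite (_ : f (a * x + b + a * y) - _ - _ - a ^+ 2 * _ * _ / 2 =
     f (a * x + b + a * y) - f (a * x + b) - f1 (a * x + b) * (a * y) -
     f2 (a * x + b) * (a * y) ^+ 2 / 2); last by field.
  move=> h; rewrite (le_trans h)// normrM exprMn mulrCA -[leRHS]mulrA hX//.
  by rewrite mulr_ge0// exprn_ge0.
Qed.

Lemma cvg_sumr (R : realType) I (s : seq I) (u : I -> nat -> R) (a : I -> R) :
  (forall i, u i n @[n --> \oo] --> a i) ->
  \sum_(i <- s) u i n @[n --> \oo] --> \sum_(i <- s) a i.
Proof.
move=> h; elim: s => [|i s IH].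
  by under eq_fun do rewrite big_nil; rewrite big_nil; exact: cvg_cst.
by under eq_fun do rewrite big_cons; rewrite big_cons; apply: cvgD.
Qed.

Section quasi_interpolation.
Context {R : realType} (l : nat).
Implicit Types x y : 'I_l -> R.

Definition lip_bdd (M Lam : R) (h : ('I_l -> R) -> R) :=
  (forall x, `|h x| <= M) /\
  (forall x y e, (forall i, `|x i - y i| <= e) -> `|h x - h y| <= Lam * e).

Variables (eta : R) (K : nat).

Definition qnode (j : 'I_(2 * K).+1) : R := eta * (j%:R - K%:R).
(** The shift by 2 centres the spline, supported on [0, 4], at the node [qnode j]. *)
Definition qbase (j : 'I_(2 * K).+1) (z : R) : R := bspline (z / eta + (K%:R + 2) - j%:R).
(** Tensor-product quasi-interpolation: nodal values serve directly as coefficients, so no linear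
    system arises. The result is a finite combination of products of one-variable smooth functions,
    the class for which convergence will be known. *)
Definition qinterp (h : ('I_l -> R) -> R) x : R :=
  \sum_(f : {ffun 'I_l -> 'I_(2 * K).+1})
    h (fun i => qnode (f i)) * \prod_(i < l) qbase (f i) (x i).

Hypothesis eta0 : 0 < eta.

Lemma qbase_ge0 j z : 0 <= qbase j z. Proof. exact: bspline_ge0. Qed.

Lemma sum_qbase z : \sum_j qbase j z =
  sstep (z / eta + (K%:R + 2)) - sstep (z / eta + (K%:R + 2) - (2 * K).+1%:R).
Proof. exact: (sum_bspline (z / eta + (K%:R + 2)) (2 * K).+1). Qed.

Lemma sum_qbase_le1 z : 0 <= \sum_j qbase j z <= 1.
Proof.
rewrite sumr_ge0/= => [|j _]; last exact: qbase_ge0.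
rewrite sum_qbase; have := sstep_ge0 (z / eta + (K%:R + 2) - (2 * K).+1%:R).
have := sstep_le1 (z / eta + (K%:R + 2)); lra.
Qed.

Lemma sum_qbase_eq1 z : `|z| <= eta * (K%:R - 1) -> \sum_j qbase j z = 1.
Proof.
rewrite ler_norml => /andP[h1 h2]; rewrite sum_qbase.
have {h1} : - (K%:R - 1) <= z / eta by rewrite ler_pdivlMr// mulrC mulrN.
have {h2} : z / eta <= K%:R - 1 by rewrite ler_pdivrMr// mulrC.
move=> h1 h2; rewrite sstep_ge3; last by lra.
have e : (2 * K).+1%:R = 2 * K%:R + 1 :> R by rewrite -(natrM R 2 K) natr1.
by rewrite sstep_le0 ?subr0// e; lra.
Qed.

Lemma qbase_supp j z : qbase j z != 0 -> `|z - qnode j| <= 2 * eta.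
Proof.
move=> h; have [//|h2] := leP `|z - qnode j| (2 * eta).
case/negP: h; apply/eqP; apply: bspline_out.
have zE : z = eta * (z / eta) by rewrite mulrCA divff ?mulr1// gt_eqF.
move: h2; rewrite /qnode {1}zE -mulrBr normrM gtr0_norm// mulrC ltr_pM2l//.
rewrite ltr_normr => /orP[h|h]; [right|left]; lra.
Qed.

Lemma sum_prod_qbase x : \sum_(f : {ffun 'I_l -> 'I_(2 * K).+1})
   \prod_(i < l) qbase (f i) (x i) = \prod_(i < l) \sum_j qbase j (x i).
Proof. by rewrite bigA_distr_bigA. Qed.

Lemma qinterp_bound M Lam h x : lip_bdd M Lam h -> `|qinterp h x| <= M.
Proof.
move=> [hM _]; have M0 : 0 <= M by rewrite (le_trans _ (hM (fun=> 0))).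
rewrite (le_trans (ler_norm_sum _ _ _))//.
apply: (@le_trans _ _ (\sum_(f : {ffun 'I_l -> 'I_(2 * K).+1})
    M * \prod_(i < l) qbase (f i) (x i))).
  apply: ler_sum => f _.
  have p0 : 0 <= \prod_(i < l) qbase (f i) (x i) by rewrite prodr_ge0// => i _; exact: qbase_ge0.
  by rewrite normrM [X in _ * X]ger0_norm// ler_wpM2r.
rewrite -mulr_sumr sum_prod_qbase ler_piMr//.
suff /andP[] : 0 <= \prod_(i < l) \sum_j qbase j (x i) <= 1 by [].
apply: (big_ind (fun z : R => 0 <= z <= 1)) => [|a b /andP[a0 a1] /andP[b0 b1]|i _].
- by rewrite ler01 lexx.
- by rewrite mulr_ge0//= mulr_ile1.
- exact: sum_qbase_le1.
Qed.

(** In the box the weights sum to 1, so the error is a weighted mean of differences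
    [h (node) - h x], and a node has non-zero weight only if each of its coordinates is within
    [2 * eta] of that of [x]. *)
Lemma qinterp_err M Lam h x : lip_bdd M Lam h ->
  (forall i, `|x i| <= eta * (K%:R - 1)) -> `|qinterp h x - h x| <= Lam * (2 * eta).
Proof.
move=> [hM hL] hx.
have S1 : \sum_(f : {ffun 'I_l -> 'I_(2 * K).+1}) \prod_(i < l) qbase (f i) (x i) = 1.
  by rewrite sum_prod_qbase big1// => i _; exact: sum_qbase_eq1.
rewrite -[h x]mulr1 -[in X in _ - X]S1 mulr_sumr -sumrB.
rewrite (le_trans (ler_norm_sum _ _ _))//.
apply: (@le_trans _ _ (\sum_(f : {ffun 'I_l -> 'I_(2 * K).+1})
    Lam * (2 * eta) * \prod_(i < l) qbase (f i) (x i))); last first.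
  by rewrite -mulr_sumr S1 mulr1.
apply: ler_sum => f _; rewrite -mulrBl normrM.
have p0 : 0 <= \prod_(i < l) qbase (f i) (x i) by rewrite prodr_ge0// => i _; exact: qbase_ge0.
rewrite [X in _ * X]ger0_norm//.
have [->|/prodf_neq0 np] := eqVneq (\prod_(i < l) qbase (f i) (x i)) 0; first by rewrite !mulr0.
rewrite ler_wpM2r// hL// => i; rewrite distrC; apply: qbase_supp; exact: np.
Qed.

Lemma qbase_Tay j : exists C f1 f2, Tay C (qbase j) f1 f2.
Proof.
have [C h] := Tay_comp_affine (eta^-1) (K%:R + 2 - j%:R) (@Tay_bspline R).
exists C; do 2 eexists; rewrite (_ : qbase j = fun z => bspline (eta^-1 * z + (K%:R + 2 - j%:R))).
  exact: h.
by apply/funext => z; rewrite /qbase; congr bspline; ring.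
Qed.

Lemma qbase_bmf d (T : measurableType d) j (xi : T -> R) : measurable_fun setT xi ->
  bmf (fun w => qbase j (xi w)).
Proof.
move=> mxi; have [C [f1 [f2 h]]] := qbase_Tay j; have [m _ _] := Tay_meas h.
by apply: (@bmf_comp _ _ _ (qbase j) xi) => //; exists C => z; case: h => /(_ z)[].
Qed.

Lemma qinterp_bmf d (T : measurableType d) h (xi : 'I_l -> T -> R) :
  (forall i, measurable_fun setT (xi i)) -> bmf (fun w => qinterp h (xi^~ w)).
Proof.
move=> mxi; apply: bmf_sum => f _; apply: bmfZ; apply: bmf_prod => i _.
exact: qbase_bmf.
Qed.

End quasi_interpolation.

Section lipschitz_functionals.
Context {R : realType} (l : nat) (M Lam : R) (h : ('I_l -> R) -> R).
Hypothesis hh : lip_bdd M Lam h.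

(** The domain of [h] carries no sigma-algebra here; measurability comes from writing [h] along [xi]
    as a pointwise limit of quasi-interpolants, of mesh 1/(n + 1) on the box of half-width n + 1,
    whence the choice (n + 1)^2 + 1 for [K]. *)
Lemma lip_bdd_bmf d (T : measurableType d) (xi : 'I_l -> T -> R) :
  (forall i, measurable_fun setT (xi i)) -> bmf (fun w => h (xi^~ w)).
Proof.
move=> mxi; split; last by exists M => w; case: hh.
pose e n : R := n.+1%:R^-1.
have e0 n : 0 < e n by rewrite invr_gt0.
apply: (@measurable_fun_cvg _ _ _ setT
  (fun n w => qinterp (e n) (n.+1 ^ 2).+1 h (xi^~ w))) => //.
  by move=> n; apply: bmf_meas; exact: qinterp_bmf.
move=> w _; apply/cvgrPdist_le => a a0.
have M1 : exists B, forall i : 'I_l, `|xi i w| <= B.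
  by exists (\sum_(i < l) `|xi i w|) => i; rewrite (bigD1 i)//= lerDl sumr_ge0.
case: M1 => B hB; near=> n.
rewrite distrC; apply: (le_trans (qinterp_err (e0 n) hh _)) => [i|].
  rewrite (le_trans (hB i))// -natr1 addrK /e natrX expr2 mulrA mulVf ?mul1r ?pnatr_eq0//.
  apply: (@le_trans _ _ n%:R); last by rewrite ler_nat.
  by near: n; exact: nbhs_infty_ger.
apply: (@le_trans _ _ (`|Lam| * (2 * e n))).
  by apply: ler_wpM2r; [rewrite mulr_ge0// ltW|exact: ler_norm].
rewrite /e mulrA ler_pdivrMr// [leRHS]mulrC -ler_pdivrMr//.
apply: (@le_trans _ _ n%:R); last by rewrite ler_nat.
by near: n; exact: nbhs_infty_ger.
Unshelve. all: by end_near. Qed.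

Lemma qinterp_Ex d (T : measurableType d) (P : probability T R) (xi : 'I_l -> T -> R) (eta : R) (K : nat) (p : R) :
  0 < eta -> (forall i, measurable_fun setT (xi i)) ->
  (forall i, fine (P [set w | eta * (K%:R - 1) < `|xi i w|]) <= p) ->
  `|Ex P (fun w => h (xi^~ w)) - Ex P (fun w => qinterp eta K h (xi^~ w))| <=
  `|Lam| * (2 * eta) + 2 * M * (l%:R * p).
Proof.
move=> eta0 mxi hp.
have M0 : 0 <= M by case: hh => hM _; rewrite (le_trans _ (hM (fun=> 0))).
pose A i := [set w | eta * (K%:R - 1) < `|xi i w|].
have mA i : measurable (A i).
  have mn : measurable_fun setT (fun w => `|xi i w|) by exact: measurableT_comp.
  have := mn measurableT _ (measurable_itv `]eta * (K%:R - 1), +oo[); rewrite setTI.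
  by congr measurable; apply/seteqP; split => x /=; rewrite in_itv/= andbT.
have bA i : bmf (fun w => \1_(A i) w : R) by exact: bmf_indic.
have bq : bmf (fun w => qinterp eta K h (xi^~ w)) by exact: qinterp_bmf.
have bh := lip_bdd_bmf mxi.
have bs : bmf (fun w => \sum_(i < l) (\1_(A i) w : R)) by apply: bmf_sum.
rewrite -ExB//.
apply: (@le_trans _ _ (Ex P (fun w => `|Lam| * (2 * eta) + 2 * M * \sum_(i < l) (\1_(A i) w : R)))).
  apply: Ex_norm_le => [||w].
  - exact: bmfB.
  - by apply: bmfD; [exact: bmf_cst|exact: bmfZ].
  - have s0 : 0 <= \sum_(i < l) (\1_(A i) w : R) by rewrite sumr_ge0.
    have [/forallP hx|/forallPn[i]] := boolP [forall i, `|xi i w| <= eta * (K%:R - 1)].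
      rewrite distrC (le_trans (qinterp_err eta0 hh hx))//.
      rewrite -[leLHS]addr0 lerD ?mulr_ge0//.
      by apply: ler_wpM2r; [rewrite mulr_ge0// ltW|exact: ler_norm].
    rewrite -ltNge => hi.
    have s1 : 1 <= \sum_(i < l) (\1_(A i) w : R).
      by rewrite (bigD1 i)//= indicE mem_set// lerDl sumr_ge0.
    apply: (@le_trans _ _ (2 * M)).
      rewrite mulr_natl mulr2n (le_trans (ler_normB _ _))// lerD//; first by case: hh.
      exact: qinterp_bound hh.
    rewrite -[leLHS]add0r lerD ?mulr_ge0// ?(ltW eta0)// ler_peMr// mulr_ge0//.
rewrite ExD; [|exact: bmf_cst|exact: bmfZ].
rewrite Ex_cst lerD2l ExZ// ler_wpM2l ?mulr_ge0//.
rewrite Ex_sum//; apply: (@le_trans _ _ (\sum_(i < l) p)).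
  by apply: ler_sum => i _; have := hp i; rewrite -(Ex_indic P (mA i)).
by rewrite sumr_const card_ord mulr_natl.
Qed.

(** Plays the part of a continuity theorem for characteristic functions: products of smooth
    functions determine the limit, because quasi-interpolation approximates [h] on a large box and
    the tail bound controls the complement. *)
Lemma cvg_lip_bdd d (T : measurableType d) (P : probability T R)
    d' (T' : measurableType d') (P' : probability T' R)
    (xi : nat -> 'I_l -> T -> R) (ze : 'I_l -> T' -> R) :
  (forall n i, measurable_fun setT (xi n i)) -> (forall i, measurable_fun setT (ze i)) ->
  (forall e : R, 0 < e -> exists2 A : R, 0 < A & \forall n \near \oo, forall i,
     fine (P [set w | A < `|xi n i w|]) <= e /\ fine (P' [set w | A < `|ze i w|]) <= e) ->
  (forall f : 'I_l -> R -> R, (forall i, exists C f1 f2, Tay C (f i) f1 f2) ->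
     Ex P (fun w => \prod_(i < l) f i (xi n i w)) @[n --> \oo] -->
     Ex P' (fun w => \prod_(i < l) f i (ze i w))) ->
  Ex P (fun w => h ((xi n)^~ w)) @[n --> \oo] --> Ex P' (fun w => h (ze^~ w)).
Proof.
move=> mxi mze htail hprod; apply/cvgrPdist_le => a a0.
have M0 : 0 <= M by case: hh => hM _; rewrite (le_trans _ (hM (fun=> 0))).
(* [p] and [eta] make each of the four errors, mesh and tail on either side, at most a/8; the limit
   of the interpolants costs a fifth a/8. *)
pose p := a / 16 / ((M + 1) * (l%:R + 1)).
have p0 : 0 < p by rewrite !divr_gt0// mulr_gt0// ltr_wpDl.
have [A A0 hA] := htail p p0.
pose eta := a / 16 / (`|Lam| + 1).
have eta0 : 0 < eta by rewrite !divr_gt0// ltr_wpDl.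
pose K := (Num.truncn (A / eta)).+2.
have hK : A <= eta * (K%:R - 1).
  rewrite -ler_pdivrMl// mulrC /K -natr1 addrK ltW//; exact: truncnS_gt.
have e1 : `|Lam| * (2 * eta) <= a / 8.
  rewrite (_ : a / 8 = (`|Lam| + 1) * (2 * eta)); last first.
    by rewrite /eta; field; rewrite gt_eqF// ltr_wpDl.
  by apply: ler_wpM2r; [rewrite mulr_ge0// ltW|rewrite lerDl].
have e2 : 2 * M * (l%:R * p) <= a / 8.
  rewrite (_ : a / 8 = 2 * ((M + 1) * ((l%:R + 1) * p))); last first.
    by rewrite /p; field; rewrite !gt_eqF// ltr_wpDl.
  rewrite -mulrA ler_pM2l//; apply: ler_pM => //; first by rewrite mulr_ge0// ltW.
    by rewrite lerDl.
  by rewrite ler_pM2r// lerDl.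
have tail d0 (T0 : measurableType d0) (P0 : probability T0 R) (f : T0 -> R) : measurable_fun setT f ->
    fine (P0 [set w | A < `|f w|]) <= p -> fine (P0 [set w | eta * (K%:R - 1) < `|f w|]) <= p.
  move=> mf; apply: le_trans.
  have mn : measurable_fun setT (fun w => `|f w|) by exact: measurableT_comp.
  have mm (b : R) : measurable [set w | b < `|f w|].
    have := mn measurableT _ (measurable_itv `]b, +oo[); rewrite setTI.
    by congr measurable; apply/seteqP; split => x /=; rewrite in_itv/= andbT.
  apply: fine_le; rewrite ?fin_num_measure//.
  by apply: le_measure; rewrite ?inE//= => w /=; exact: le_lt_trans.
have hq : Ex P (fun w => qinterp eta K h ((xi n)^~ w)) @[n --> \oo] -->
    Ex P' (fun w => qinterp eta K h (ze^~ w)).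
  rewrite (_ : Ex P' _ = \sum_(f : {ffun 'I_l -> 'I_(2 * K).+1}) h (fun i => qnode eta (f i)) *
     Ex P' (fun w => \prod_(i < l) qbase eta (f i) (ze i w))); last first.
    rewrite Ex_sum => [|f _].
      by apply: eq_bigr => f _; rewrite ExZ//; apply: bmf_prod => i _; exact: qbase_bmf.
    by apply: bmfZ; apply: bmf_prod => i _; exact: qbase_bmf.
  under eq_cvg => n.
    rewrite Ex_sum => [|f _]; last first.
      by apply: bmfZ; apply: bmf_prod => i _; exact: qbase_bmf.
    under eq_bigr => f _.
      rewrite ExZ; last by apply: bmf_prod => i _; exact: qbase_bmf.
      over.
    over.
  apply: cvg_sumr => f; apply: cvgM; first exact: cvg_cst.
  apply: (hprod (fun i => qbase eta (f i))) => i; exact: qbase_Tay.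
near=> n.
have hn : forall i, fine (P [set w | A < `|xi n i w|]) <= p /\ fine (P' [set w | A < `|ze i w|]) <= p.
  by near: n.
have h1 := @qinterp_Ex _ _ P _ eta K p eta0 (mxi n) (fun i => tail _ _ _ _ (mxi n i) (hn i).1).
have h2 := @qinterp_Ex _ _ P' _ eta K p eta0 mze (fun i => tail _ _ _ _ (mze i) (hn i).2).
have h3 : `|Ex P' (fun w => qinterp eta K h (ze^~ w)) - Ex P (fun w => qinterp eta K h ((xi n)^~ w))| <= a / 8.
  by near: n; move/cvgrPdist_le: hq; apply; rewrite divr_gt0.
move: h1 h2 h3; rewrite !ler_norml; lra.
Unshelve. all: by end_near. Qed.

End lipschitz_functionals.

(** * Gaussian moments and Brownian motion *)

Section gaussian.
Context {R : realType}.
Local Notation mu := (@lebesgue_measure R).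

(** Change of variables holds for the Radon-Nikodym derivative, which agrees almost everywhere with
    [normal_pdf] since both integrate to the same value over every measurable set. *)
Lemma ge0_integral_normal_prob (m s : R) (f : R -> \bar R) :
  measurable_fun setT f -> (forall x, (0 <= f x)%E) ->
  (\int[normal_prob m s]_x f x = \int[mu]_x (f x * (normal_pdf m s x)%:E))%E.
Proof.
move=> mf f0.
have dom := normal_prob_dominates m s.
rewrite -(Radon_Nikodym_SigmaFinite.change_of_variables dom f0 measurableT mf).
have mr : measurable_fun setT (Radon_Nikodym_SigmaFinite.f (normal_prob m s) mu).
  exact: measurable_int (Radon_Nikodym_SigmaFinite.f_integrable _).
have mp : measurable_fun setT (fun x => (normal_pdf m s x)%:E).
  by apply/measurable_EFinP; exact: measurable_normal_pdf.
apply: ae_eq_integral => //; [exact: emeasurable_funM..|].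
apply: ae_eqe_mul2l; apply: integral_ae_eq => //.
  exact: Radon_Nikodym_SigmaFinite.f_integrable.
by move=> E _ mE; rewrite -Radon_Nikodym_SigmaFinite.f_integral.
Qed.

(** Completing the square: exp(a x) times the density of N(0, s^2) is exp(a^2 s^2 / 2) times the
    density of N(a s^2, s^2). *)
Lemma normal_mgf (s a : R) : s != 0 ->
  (\int[normal_prob 0 s]_x (expR (a * x))%:E = (expR (a ^+ 2 * s ^+ 2 / 2))%:E)%E.
Proof.
move=> s0; rewrite ge0_integral_normal_prob; last 2 first.
- apply/measurable_EFinP; apply: measurableT_comp => //.
- by move=> x; rewrite lee_fin expR_ge0.
transitivity (\int[mu]_x ((expR (a ^+ 2 * s ^+ 2 / 2))%:E * (normal_pdf (a * s ^+ 2) s x)%:E))%E.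
  apply: eq_integral => x _; rewrite -!EFinM; congr EFin.
  rewrite !normal_pdfE// mulrCA [RHS]mulrCA; congr *%R.
  rewrite /normal_fun -!expRD; congr expR; rewrite -(mulr_natr (s ^+ 2)); field.
  by rewrite s0.
rewrite ge0_integralZl//.
- by rewrite integral_normal_pdf mule1.
- by apply/measurable_EFinP; exact: measurable_normal_pdf.
- by move=> x _; rewrite lee_fin normal_pdf_ge0.
Qed.

Lemma expR_sub1_norm (y : R) : `|expR y - 1| <= `|y| * expR `|y|.
Proof.
have h (z : R) : expR z - 1 <= z * expR z.
  have := expR_ge1Dx (- z); rewrite expRN => h1.
  have := ler_wpM2r (expR_ge0 z) h1; rewrite mulVf ?gt_eqF ?expR_gt0// mulrDl mul1r mulNr; lra.
have [y0|y0] := leP 0 y.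
  by rewrite (ger0_norm y0) ger0_norm ?h// subr_ge0 -expR0 ler_expR.
rewrite (ltr0_norm y0) ler0_norm; last by rewrite subr_le0 -expR0 ler_expR ltW.
have := expR_ge1Dx y => h1.
have : 1 <= expR (- y) by rewrite -expR0 ler_expR; lra.
nra.
Qed.

Lemma expR_taylor1 (y : R) : `|expR y - 1 - y| <= y ^+ 2 * expR `|y|.
Proof.
have h1 : 0 <= expR y - 1 - y by have := expR_ge1Dx y; lra.
rewrite ger0_norm//.
have h2 : expR y - 1 <= y * expR y.
  have := expR_ge1Dx (- y); rewrite expRN => h2.
  have := ler_wpM2r (expR_ge0 y) h2; rewrite mulVf ?gt_eqF ?expR_gt0// mulrDl mul1r mulNr; lra.
apply: (@le_trans _ _ (y * (expR y - 1))); first by lra.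
rewrite (le_trans (ler_norm _))// normrM -[in leRHS]real_normK ?num_real//.
by rewrite expr2 -mulrA ler_wpM2l// expR_sub1_norm.
Qed.

(** The left-hand combination is a square: with e = exp(y/2), exp(y) + exp(-y) - 2 = (e - 1/e)^2,
    and for y >= 0 the difference e - 1/e lies between y/e and y e. *)
Lemma cosh_taylor (y : R) :
  `|expR y + expR (- y) - 2 - y ^+ 2| <= `|y| ^+ 3 * expR `|y|.
Proof.
wlog y0 : y / 0 <= y.
  move=> h; have [|y0] := leP 0 y; first exact: h.
  have := h (- y); rewrite opprK normrN sqrrN [expR (- y) + _]addrC; apply; lra.
rewrite (ger0_norm y0).
pose e := expR (y / 2); have e0 : 0 < e by exact: expR_gt0.
have E1 : expR y = e ^+ 2 by rewrite -expRM_natl; congr expR; field.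
have E2 : expR (- y) = (e^-1) ^+ 2 by rewrite expRN E1 exprVn.
have ee : e * e^-1 = 1 by rewrite divff// gt_eqF.
have -> : expR y + expR (- y) - 2 = (e - e^-1) ^+ 2.
  by rewrite E1 E2 sqrrB ee; ring.
have i0 : 0 < e^-1 by rewrite invr_gt0.
have e1 : 1 <= e by rewrite -expR0 ler_expR; lra.
have y2 : 1 + y <= e ^+ 2 by rewrite -E1; exact: expR_ge1Dx.
have y3 : 1 - y <= e^-1 ^+ 2 by rewrite -E2; exact: expR_ge1Dx.
have yi : y * e^-1 <= e - e^-1.
  have := ler_wpM2r (ltW i0) y2; rewrite expr2 -mulrA ee; lra.
have ys : e - e^-1 <= y * e.
  have := ler_wpM2r (ltW e0) y3; rewrite expr2 -mulrA [e^-1 * e]mulrC ee; lra.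
have yi0 : 0 <= y * e^-1 by rewrite mulr_ge0// ltW.
have S1 : (y * e^-1) ^+ 2 <= (e - e^-1) ^+ 2 by rewrite lerXn2r ?nnegrE//; lra.
have S2 : (e - e^-1) ^+ 2 <= (y * e) ^+ 2 by rewrite lerXn2r ?nnegrE//; lra.
have y20 := sqr_ge0 y.
have T1 : y ^+ 2 * (e ^+ 2 - 1) <= y ^+ 3 * e ^+ 2.
  rewrite [leRHS](_ : _ = y ^+ 2 * (y * e ^+ 2)); last by ring.
  apply: ler_wpM2l => //.
  have := ler_wpM2r (sqr_ge0 e) y3.
  have -> : e^-1 ^+ 2 * e ^+ 2 = 1 by rewrite -exprMn mulrC ee expr1n.
  lra.
have T2 : y ^+ 2 * (1 - e^-1 ^+ 2) <= y ^+ 3 * e ^+ 2.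
  rewrite [leRHS](_ : _ = y ^+ 2 * (y * e ^+ 2)); last by ring.
  rewrite ler_wpM2l//.
  have : y <= y * e ^+ 2 by rewrite ler_peMr// exprn_ege1.
  lra.
rewrite E1 ler_norml; rewrite !exprMn in S1 S2; lra.
Qed.

Context d {T : measurableType d} (P : probability T R).
Local Notation E := (Ex P).

(** The centred Gaussian law of variance [v], encoded by its moment generating function: the
    degenerate case [v = 0] is included, and the moments follow by expanding in [a]. *)
Definition gauss_rv (B : T -> R) (v : R) := measurable_fun setT B /\
  forall a, (\int[P]_w (expR (a * B w))%:E = (expR (a ^+ 2 * v / 2))%:E)%E.

Lemma gauss_rv_law (B : T -> R) (s : R) : 0 < s -> measurable_fun setT B ->
  (forall A, measurable A -> P (B @^-1` A) = normal_prob 0 (Num.sqrt s) A) ->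
  gauss_rv B s.
Proof.
move=> s0 mB law; split => // a.
have s1 : Num.sqrt s != 0 by rewrite gt_eqF// sqrtr_gt0.
rewrite -[in RHS](@sqr_sqrtr _ s) ?ltW// -normal_mgf//.
have mB' : @measurable_fun _ _ T (measurableTypeR R) setT B by exact: mB.
pose X : {mfun T >-> measurableTypeR R} := HB.pack (B : T -> measurableTypeR R)
  (isMeasurableFun.Build _ _ _ _ (B : T -> measurableTypeR R) mB').
have <- := @eq_measure_integral _ _ _ setT (normal_prob 0 (Num.sqrt s)) (distribution P X) (fun x => (expR (a * x))%:E).
  rewrite ge0_integral_distribution//.
  by apply/measurable_EFinP; apply: measurableT_comp.
by move=> A mA _; rewrite /= -law.
Qed.

Section moments.
Variables (B : T -> R) (v : R).
Hypothesis v0 : 0 <= v.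
Hypothesis gB : gauss_rv B v.

Let mB : measurable_fun setT B. Proof. by case: gB. Qed.

Lemma integrable_expB a : P.-integrable setT (fun w => (expR (a * B w))%:E).
Proof.
have me : measurable_fun setT (fun w => (expR (a * B w))%:E).
  by apply/measurable_EFinP; apply: measurableT_comp => //; exact: measurable_funM.
apply/integrableP; split => //.
rewrite (eq_integral (fun w => (expR (a * B w))%:E)) => [|w _].
  by case: gB => _ ->; rewrite ltry.
by rewrite gee0_abs// lee_fin expR_ge0.
Qed.

Lemma Ex_expB a : E (fun w => expR (a * B w)) = expR (a ^+ 2 * v / 2).
Proof. by rewrite /Ex; case: gB => _ ->. Qed.

Let cosh2 a w := expR (a * B w) + expR (- a * B w).

Let int_cosh a : P.-integrable setT (EFin \o cosh2 a).
Proof.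
rewrite (_ : _ \o _ = (fun w => (expR (a * B w))%:E) \+ (fun w => (expR (- a * B w))%:E))//.
by apply: integrableD => //; exact: integrable_expB.
Qed.

Let Ex_cosh a : E (cosh2 a) = 2 * expR (a ^+ 2 * v / 2).
Proof.
by rewrite ExD_int ?Ex_expB ?sqrrN; [ring|exact: integrable_expB|exact: integrable_expB].
Qed.

Lemma expR_norm_le (x : R) : expR `|x| <= expR x + expR (- x).
Proof.
have [x0|x0] := leP 0 x.
  by rewrite ger0_norm// lerDl expR_ge0.
by rewrite ltr0_norm// lerDr expR_ge0.
Qed.

Let dominated (g : R -> R) (a K : R) : measurable_fun setT g ->
  (forall x, `|g x| <= K * (expR (a * x) + expR (- a * x))) ->
  P.-integrable setT (EFin \o (g \o B)).
Proof.
move=> mg h; apply: (@le_integrable _ _ _ P setT measurableT _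
   (fun w => (K * cosh2 a w)%:E)) => //.
- by apply/measurable_EFinP; exact: measurableT_comp.
- by move=> w _; rewrite lee_fin/= (le_trans (h _))// ler_norm.
- under eq_fun do rewrite EFinM.
  by apply: integrableZl => //; exact: int_cosh.
Qed.

Lemma norm3_le (x : R) : `|x| ^+ 3 <= 6 * expR `|x|.
Proof.
have := expR_ge1Dxn 2 (normr_ge0 x); rewrite -[(3`!)%:R]/(6%:R : R).
have := expR_ge0 `|x|; lra.
Qed.

(** The bound |x|^3 <= 6 exp|x| is applied to B divided by the square root of v, which produces the
    scaling v^(3/2); 48 = 6 * 2 * 4, where 2 comes from the two exponentials and 4 bounds
    exp(1/2). *)
Lemma Ex_norm3 : 0 < v -> P.-integrable setT (fun w => (`|B w| ^+ 3)%:E) /\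
  E (fun w => `|B w| ^+ 3) <= 48 * (v * Num.sqrt v).
Proof.
move=> vp; pose s := Num.sqrt v.
have s0 : 0 < s by rewrite sqrtr_gt0.
have s2 : s ^+ 2 = v by rewrite sqr_sqrtr.
have hb (x : R) : `|x| ^+ 3 <= 6 * s ^+ 3 * (expR (s^-1 * x) + expR (- s^-1 * x)).
  have := norm3_le (s^-1 * x).
  rewrite normrM gtr0_norm ?invr_gt0// exprMn => h.
  have -> : `|x| ^+ 3 = s ^+ 3 * (s^-1 ^+ 3 * `|x| ^+ 3).
    by rewrite mulrA -exprMn divff ?gt_eqF// expr1n mul1r.
  rewrite -[leRHS]mulrA [leRHS]mulrCA; apply: ler_wpM2l; first by rewrite exprn_ge0// ltW.
  apply: (le_trans h); apply: ler_wpM2l => //.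
  by have := expR_norm_le (s^-1 * x); rewrite mulNr normrM gtr0_norm ?invr_gt0.
have i3 : P.-integrable setT (fun w => (`|B w| ^+ 3)%:E).
  apply: (@dominated (fun x => `|x| ^+ 3) s^-1 (6 * s ^+ 3)).
    by apply: measurable_funX; exact: normr_measurable.
  by move=> x; rewrite normrX normr_id.
split => //.
apply: (@le_trans _ _ (E (fun w => 6 * s ^+ 3 * cosh2 s^-1 w))).
  suff ic : P.-integrable setT (EFin \o (fun w => 6 * s ^+ 3 * cosh2 s^-1 w)).
    by apply: le_Ex_int => // w; exact: hb.
  rewrite (_ : _ \o _ = fun w => ((6 * s ^+ 3)%:E * (cosh2 s^-1 w)%:E)%E); last first.
    by apply/funext => w; rewrite /= EFinM.
  by apply: integrableZl => //; exact: int_cosh.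
rewrite ExZ_int; last exact: int_cosh.
rewrite Ex_cosh -/s exprVn s2 mulVf ?gt_eqF// -[in leRHS]s2.
have e4 : expR (1 / 2) <= 4 :> R.
  have h : expR (1 / 2) - 1 <= 1 / 2 * expR (1 / 2) :> R.
    have := expR_ge1Dx (- (1 / 2) : R); rewrite expRN => h2.
    have := ler_wpM2r (expR_ge0 (1 / 2)) h2.
    rewrite mulVf ?gt_eqF ?expR_gt0// mulrDl mul1r mulNr; lra.
  lra.
have := ler_wpM2l (ltW (exprn_gt0 3 s0)) e4; lra.
Qed.

(** Serves to identify coefficients of expansions in [a] as [a] tends to 0, instead of
    differentiating under the integral. *)
Lemma cubic_small (m K : R) : (forall a, 0 < a <= 1 -> `|m| <= a * K) -> m = 0.
Proof.
move=> h; apply/eqP; rewrite -normr_eq0 eq_le normr_ge0 andbT.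
apply/ler_addgt0Pl => e e0; rewrite addr0.
pose a := e / (e + `|K| + 1).
have q0 : 0 < e + `|K| + 1 by rewrite ltr_wpDl// addr_ge0// ltW.
have a0 : 0 < a by rewrite divr_gt0.
have a1 : 0 < a <= 1.
  by rewrite a0/= ler_pdivrMr// mul1r -addrA lerDl addr_ge0.
rewrite (le_trans (h a a1))// (le_trans (ler_wpM2l (ltW a0) (ler_norm K)))//.
by rewrite /a mulrAC ler_pdivrMr// ler_pM2l// -addrA addrCA lerDl addr_ge0// ltW.
Qed.

Lemma integrable_B : P.-integrable setT (fun w => (B w)%:E).
Proof.
apply: (@dominated id 1 1); first exact: measurable_id.
move=> x; rewrite !mul1r mulN1r; apply: (le_trans _ (expR_norm_le x)).
by have := expR_ge1Dx `|x|; lra.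
Qed.

Lemma integrable_B2 : P.-integrable setT (fun w => (B w ^+ 2)%:E).
Proof.
apply: (@dominated (fun x => x ^+ 2) 1 2); first exact: measurable_funX.
move=> x; rewrite !mul1r mulN1r normrX.
apply: (@le_trans _ _ (2 * expR `|x|)); last by rewrite ler_pM2l// expR_norm_le.
have := expR_ge1Dxn 1 (normr_ge0 x); rewrite -[(2`!)%:R]/(2%:R : R); lra.
Qed.

Let expRv a : 0 < a <= 1 -> `|expR (a ^+ 2 * v / 2) - 1 - a ^+ 2 * v / 2| <=
  a ^+ 3 * (v ^+ 2 * expR v).
Proof.
move=> /andP[a0 a1]; rewrite (le_trans (expR_taylor1 _))//.
have a2 : 0 <= a ^+ 2 * v / 2 <= v.
  have : a ^+ 2 <= 1 by rewrite expr_le1// ltW.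
  have := sqr_ge0 a; have := v0 => ? ? ?; apply/andP; split; nra.
case/andP: a2 => a2 a3; rewrite ger0_norm//.
rewrite [leRHS]mulrA; apply: ler_pM; rewrite ?sqr_ge0 ?expR_ge0 ?ler_expR//.
rewrite [leLHS](_ : _ = a ^+ 3 * v ^+ 2 * (a / 4)); last by field.
rewrite ler_piMr//; last lra.
by rewrite mulr_ge0 ?sqr_ge0// exprn_ge0// ltW.
Qed.

(** Both E exp(aB) - 1 - a E B and exp(a^2 v / 2) - 1 are of order a^2, so a E B is of order a^2 for
    all small a. *)
Lemma Ex_B : E B = 0.
Proof.
pose K := 4 * (2 * expR (2 ^+ 2 * v / 2)) + (v ^+ 2 * expR v + v).
apply: (@cubic_small _ K) => a a01; have /andP[a0 a1] := a01.
have iB := integrable_B.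
have ie : P.-integrable setT (EFin \o (fun w => expR (a * B w) + (- 1 + - a * B w))).
  rewrite (_ : _ \o _ = (fun w => (expR (a * B w))%:E) \+ ((fun w => (- 1)%:E) \+ (fun w => ((- a)%:E * (B w)%:E))%E)); last first.
    by apply/funext => w; rewrite /= EFinD EFinD EFinM.
  apply: integrableD => //; first exact: integrable_expB.
  apply: integrableD => //; first exact: (bmf_int P (bmf_cst (-1))).
  exact: integrableZl.
have hE : E (fun w => expR (a * B w) + (- 1 + - a * B w)) = expR (a ^+ 2 * v / 2) - 1 - a * E B.
  rewrite ExD_int; [|exact: integrable_expB|].
    rewrite ExD_int; [|exact: (bmf_int P (bmf_cst (-1)))|].
      by rewrite Ex_expB Ex_cst ExZ_int// mulNr; ring.
    by rewrite (_ : _ \o _ = (fun w => ((- a)%:E * (B w)%:E))%E)//; exact: integrableZl.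
  rewrite (_ : _ \o _ = (fun w => (- 1)%:E) \+ (fun w => ((- a)%:E * (B w)%:E))%E); last first.
    by apply/funext => w; rewrite /= EFinD EFinM.
  apply: integrableD => //; first exact: (bmf_int P (bmf_cst (-1))).
  exact: integrableZl.
have hX (x : R) : `|expR (a * x) + (- 1 + - a * x)| <= a ^+ 2 * 4 * (expR (2 * x) + expR (- 2 * x)).
  rewrite (_ : expR (a * x) + _ = expR (a * x) - 1 - a * x); last by ring.
  rewrite (le_trans (expR_taylor1 _))// exprMn -2!mulrA ler_wpM2l ?sqr_ge0//.
  have aX : `|a * x| <= `|x| by rewrite normrM gtr0_norm// ler_piMl.
  apply: (@le_trans _ _ (x ^+ 2 * expR `|x|)); first by rewrite ler_wpM2l ?sqr_ge0// ler_expR.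
  rewrite mulNr; apply: (@le_trans _ _ (4 * expR `|2 * x|)); last by rewrite ler_pM2l// expR_norm_le.
  rewrite normrM ger0_norm// (_ : 2 * `|x| = `|x| + `|x|); last by ring.
  rewrite expRD mulrA ler_wpM2r ?expR_ge0//.
  rewrite -real_normK ?num_real//.
  have := expR_ge1Dxn 1 (normr_ge0 x); rewrite -[(2`!)%:R]/(2%:R : R).
  have := expR_ge0 `|x|; lra.
have h1 : `|expR (a ^+ 2 * v / 2) - 1 - a * E B| <= a ^+ 2 * (4 * (2 * expR (2 ^+ 2 * v / 2))).
  rewrite -hE (le_trans (le_normr_Rintegral _ _))//.
  apply: (@le_trans _ _ (E (fun w => a ^+ 2 * 4 * cosh2 2 w))).
    have ia := @integrable_abse _ _ _ P setT _ ie.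
    suff ic : P.-integrable setT (EFin \o (fun w => a ^+ 2 * 4 * cosh2 2 w)).
      by apply: le_Ex_int => // w; exact: hX.
    rewrite (_ : _ \o _ = fun w => ((a ^+ 2 * 4)%:E * (cosh2 2 w)%:E)%E); last first.
      by apply/funext => w; rewrite /= EFinM.
    by apply: integrableZl => //; exact: int_cosh.
  rewrite ExZ_int; last exact: int_cosh.
  by rewrite Ex_cosh !mulrA.
have h2 := expRv a01.
suff : a * `|E B| <= a * (a * K) by rewrite ler_pM2l.
rewrite -[X in X * `|_| <= _](gtr0_norm a0) -normrM.
have e1 : a ^+ 3 * (v ^+ 2 * expR v) <= a ^+ 2 * (v ^+ 2 * expR v).
  rewrite ler_wpM2r ?mulr_ge0 ?sqr_ge0 ?expR_ge0//.
  by rewrite exprS ler_piMl ?sqr_ge0.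
have e2 : 0 <= a ^+ 2 * v by rewrite mulr_ge0 ?sqr_ge0.
rewrite (_ : a * (a * K) = a ^+ 2 * (4 * (2 * expR (2 ^+ 2 * v / 2))) + a ^+ 2 * (v ^+ 2 * expR v) + a ^+ 2 * v); last by rewrite /K; ring.
move: h1 h2; rewrite !ler_norml; lra.
Qed.

(** Adding the exponentials at [a] and [- a] removes the odd terms, so the second-order coefficients
    can be compared with an error of order a^3. *)
Lemma Ex_B2 : E (fun w => B w ^+ 2) = v.
Proof.
pose K := 48 * (2 * expR (2 ^+ 2 * v / 2)) + 2 * (v ^+ 2 * expR v).
apply/eqP; rewrite -subr_eq0; apply/eqP; apply: (@cubic_small _ K) => a a01; have /andP[a0 a1] := a01.
have iB := integrable_B2.
have i2 : P.-integrable setT (EFin \o (fun w => - 2 + - a ^+ 2 * B w ^+ 2)).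
  rewrite (_ : _ \o _ = (fun w => (- 2)%:E) \+ (fun w => ((- a ^+ 2)%:E * (B w ^+ 2)%:E))%E); last first.
    by apply/funext => w; rewrite /= EFinD EFinM.
  apply: integrableD => //; first exact: (bmf_int P (bmf_cst (-2))).
  exact: integrableZl.
have ie : P.-integrable setT (EFin \o (fun w => cosh2 a w + (- 2 + - a ^+ 2 * B w ^+ 2))).
  rewrite (_ : _ \o _ = (EFin \o cosh2 a) \+ (EFin \o (fun w => - 2 + - a ^+ 2 * B w ^+ 2)))//.
  by apply: integrableD => //; exact: int_cosh.
have hE : E (fun w => cosh2 a w + (- 2 + - a ^+ 2 * B w ^+ 2)) =
    2 * expR (a ^+ 2 * v / 2) - 2 - a ^+ 2 * E (fun w => B w ^+ 2).
  rewrite ExD_int; [|exact: int_cosh|exact: i2].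
  rewrite [X in _ + X]ExD_int; [|exact: (bmf_int P (bmf_cst (-2)))|].
    by rewrite Ex_cosh Ex_cst ExZ_int// mulNr; ring.
  by rewrite (_ : _ \o _ = (fun w => ((- a ^+ 2)%:E * (B w ^+ 2)%:E))%E)//; exact: integrableZl.
have hX (x : R) : `|(expR (a * x) + expR (- a * x)) + (- 2 + - a ^+ 2 * x ^+ 2)| <= a ^+ 3 * 48 * (expR (2 * x) + expR (- 2 * x)).
  rewrite (_ : _ + (- 2 + _) = expR (a * x) + expR (- (a * x)) - 2 - (a * x) ^+ 2); last by rewrite mulNr; ring.
  rewrite (le_trans (cosh_taylor _))// normrM exprMn (gtr0_norm a0) -2!mulrA ler_wpM2l ?exprn_ge0 ?(ltW a0)//.
  have aX : a * `|x| <= `|x| by rewrite ler_piMl.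
  apply: (@le_trans _ _ (`|x| ^+ 3 * expR `|x|)); first by rewrite ler_wpM2l ?exprn_ge0// ler_expR.
  rewrite mulNr; apply: (@le_trans _ _ (48 * expR `|2 * x|)); last by rewrite ler_pM2l// expR_norm_le.
  rewrite normrM ger0_norm// (_ : 2 * `|x| = `|x| + `|x|); last by ring.
  rewrite expRD mulrA ler_wpM2r ?expR_ge0//.
  rewrite (le_trans (norm3_le x))// ler_wpM2r ?expR_ge0//; lra.
have h1 : `|2 * expR (a ^+ 2 * v / 2) - 2 - a ^+ 2 * E (fun w => B w ^+ 2)| <= a ^+ 3 * (48 * (2 * expR (2 ^+ 2 * v / 2))).
  rewrite -hE (le_trans (le_normr_Rintegral _ _))//.
  apply: (@le_trans _ _ (E (fun w => a ^+ 3 * 48 * cosh2 2 w))).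
    have ia := @integrable_abse _ _ _ P setT _ ie.
    suff ic : P.-integrable setT (EFin \o (fun w => a ^+ 3 * 48 * cosh2 2 w)).
      by apply: le_Ex_int => // w; exact: hX.
    rewrite (_ : _ \o _ = fun w => ((a ^+ 3 * 48)%:E * (cosh2 2 w)%:E)%E); last first.
      by apply/funext => w; rewrite /= EFinM.
    by apply: integrableZl => //; exact: int_cosh.
  rewrite ExZ_int; last exact: int_cosh.
  by rewrite Ex_cosh !mulrA.
have h2 := expRv a01.
have p2 : 0 < a ^+ 2 by rewrite exprn_gt0.
suff : a ^+ 2 * `|E (fun w => B w ^+ 2) - v| <= a ^+ 2 * (a * K) by rewrite ler_pM2l.
rewrite -[X in X * `|_| <= _](gtr0_norm p2) -normrM.
rewrite (_ : a ^+ 2 * (a * K) = a ^+ 3 * (48 * (2 * expR (2 ^+ 2 * v / 2))) + 2 * (a ^+ 3 * (v ^+ 2 * expR v))); last by rewrite /K; ring.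
move: h1 h2; rewrite !ler_norml; lra.
Qed.

Lemma gauss_tail (A : R) : 0 < A -> fine (P [set w | A < `|B w|]) <= v / A ^+ 2.
Proof.
move=> A0; rewrite -Ex_B2.
have mA : measurable [set w | A < `|B w|].
  have mn : measurable_fun setT (fun w => `|B w|) by exact: measurableT_comp.
  have := mn measurableT _ (measurable_itv `]A, +oo[); rewrite setTI.
  by congr measurable; apply/seteqP; split => x /=; rewrite in_itv/= andbT.
rewrite ler_pdivlMr ?exprn_gt0// -Ex_indic// mulrC -ExZ; last exact: bmf_indic.
apply: le_Ex_int => [||w].
- by apply: bmf_int; apply: bmfZ; exact: bmf_indic.
- exact: integrable_B2.
- rewrite indicE; case: (boolP (w \in _)) => [/set_mem/= he|_].
    rewrite mulr1 -[leRHS]real_normK ?num_real// lerXn2r ?nnegrE ?(ltW A0)//.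
    exact: ltW.
  by rewrite mulr0 sqr_ge0.
Qed.

End moments.
End gaussian.

(** * Independence: from indicators to bounded functions *)

Section independence.
Context {R : realType} d {T : measurableType d} (P : probability T R).
Local Notation E := (Ex P).

Lemma Ex_eq_law d' (T' : measurableType d') (P' : probability T' R) (X : T -> R) (Y : T' -> R) (g : R -> R) :
  measurable_fun setT X -> measurable_fun setT Y -> measurable_fun setT g ->
  (exists M, forall x, `|g x| <= M) ->
  (forall A : set R, measurable A -> P (X @^-1` A) = P' (Y @^-1` A)) ->
  Ex P (fun w => g (X w)) = Ex P' (fun w => g (Y w)).
Proof.
move=> mX mY mg bg law; congr fine.
have iX : P.-integrable setT (EFin \o (fun w => g (X w))) by apply: bmf_int; exact: bmf_comp.
have iY : P'.-integrable setT (EFin \o (fun w => g (Y w))) by apply: bmf_int; exact: bmf_comp.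
transitivity (\int[pushforward P X]_x (g x)%:E)%E.
  by rewrite integral_pushforward//; exact/measurable_EFinP.
transitivity (\int[pushforward P' Y]_x (g x)%:E)%E.
  by apply: eq_measure_integral => A mA _; exact: law.
by rewrite integral_pushforward//; exact/measurable_EFinP.
Qed.

Variables (D : nat -> T -> R) (k : nat).
Hypothesis mD : forall j, measurable_fun setT (D j).
Hypothesis indep : forall Bs : nat -> set R, (forall j, measurable (Bs j)) ->
  E (fun w => \prod_(j < k) (\1_(Bs j) (D j w) : R)) =
  \prod_(j < k) E (fun w => \1_(Bs j) (D j w)).

Let bm (g : R -> R) := measurable_fun setT g /\ exists M, forall x, `|g x| <= M.

(** Indicators are replaced by general bounded functions one coordinate at a time. For the new
    coordinate, [Ex_ext] reduces the claim to its test against indicators of [g m], which are again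
    indicators of [D m]. *)
Lemma indep_prod (g : nat -> R -> R) : (forall j, bm (g j)) ->
  E (fun w => \prod_(j < k) g j (D j w)) = \prod_(j < k) E (fun w => g j (D j w)).
Proof.
(* The coordinates below [m] are arbitrary, those from [m] on are indicators; beyond [k] the
   functions are padded with [\1_setT] so that this holds for all indices. *)
suff H m : forall g : nat -> R -> R, (forall j, bm (g j)) ->
    (forall j, (m <= j)%N -> exists2 B, measurable B & g j = \1_B) ->
    E (fun w => \prod_(j < k) g j (D j w)) = \prod_(j < k) E (fun w => g j (D j w)).
  move=> hg.
  pose g' j := if (j < k)%N then g j else \1_setT.
  have := H k g'; rewrite (_ : (fun w => _) = (fun w => \prod_(j < k) g j (D j w))); last first.
    by apply/funext => w; apply: eq_bigr => i _; rewrite /g' ltn_ord.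
  rewrite (eq_bigr (fun j : 'I_k => E (fun w => g j (D j w)))); last first.
    by move=> i _; rewrite /g' ltn_ord.
  apply => j.
    rewrite /g'; case: ifP => // _; split; first exact: measurable_indic.
    by exists 1 => x; rewrite indicE in_setT normr1.
  by move=> kj; rewrite /g' ltnNge kj/=; exists setT.
have bmD (h : nat -> R -> R) j : bm (h j) -> bmf (fun w => h j (D j w)).
  by case=> mh bh; exact: (@bmf_comp _ _ _ (h j) (D j)).
elim: m => [|m IH] {}g hg hB.
  have hB' j : exists B, measurable B /\ g j = \1_B by have [B mB gB] := hB j isT; exists B.
  have [Bs hBs] := choice hB'.
  have -> : (fun w => \prod_(j < k) g j (D j w)) = (fun w => \prod_(j < k) (\1_(Bs j) (D j w) : R)).
    by apply/funext => w; apply: eq_bigr => j _; rewrite (hBs j).2.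
  rewrite indep; last by move=> j; exact: (hBs j).1.
  by apply: eq_bigr => j _; rewrite (hBs j).2.
have [mk|km] := ltnP m k; last first.
  pose g' j := if (j < k)%N then g j else \1_setT.
  have := IH g'; rewrite (_ : (fun w => _) = (fun w => \prod_(j < k) g j (D j w))); last first.
    by apply/funext => w; apply: eq_bigr => i _; rewrite /g' ltn_ord.
  rewrite (eq_bigr (fun j : 'I_k => E (fun w => g j (D j w)))); last first.
    by move=> i _; rewrite /g' ltn_ord.
  apply => j.
    rewrite /g'; case: ifP => // _; split; first exact: measurable_indic.
    by exists 1 => x; rewrite indicE in_setT normr1.
  by move=> kj; rewrite /g' ltnNge (leq_trans km kj)/=; exists setT.
pose m' := Ordinal mk.
pose psi w := \prod_(j < k | j != m') g j (D j w).
pose c := \prod_(j < k | j != m') E (fun w => g j (D j w)).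
have bpsi : bmf psi by apply: bmf_prod => i _; exact: bmD.
have bgm : bmf (fun w => g m (D m w)) by exact: bmD.
have key (B : set R) : measurable B ->
    E (fun w => (\1_B (g m (D m w)) : R) * (psi w - c)) = 0.
  move=> mB; pose C := g m @^-1` B.
  have mC : measurable C by rewrite -[C]setTI; apply: (hg m).1.
  pose g' j := if j == m then \1_C else g j.
  have g'm (j : 'I_k) : j != m' -> g' j = g j by move=> jm; rewrite /g' ifN.
  have hg' j : bm (g' j).
    rewrite /g'; case: ifP => // _; split; first exact: measurable_indic.
    exists 1 => x; rewrite indicE; case: (_ \in _) => /=; rewrite ?normr1 ?normr0//.
  have := IH g' hg'.
  have -> : (fun w => \prod_(j < k) g' j (D j w)) = fun w => (\1_C (D m w) : R) * psi w.
    apply/funext => w; rewrite (bigD1 m')//= {1}/g' eqxx; congr *%R.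
    by apply: eq_bigr => j jm; rewrite g'm.
  rewrite (bigD1 m')//= (_ : \prod_(j < k | j != m') _ = c); last first.
    by apply: eq_bigr => j jm; rewrite g'm.
  have -> : (fun w => g' m (D m w)) = (fun w => \1_C (D m w) : R) by rewrite /g' eqxx.
  have bC : bmf (fun w => \1_C (D m w) : R).
    have [? ?] := hg' m; move: (bmD g' m (hg' m)); by rewrite {1}/g' eqxx.
  move=> h.
  have -> : E (fun w => (\1_B (g m (D m w)) : R) * (psi w - c)) =
      E (fun w => (\1_C (D m w) : R) * psi w) - E (fun w => c * (\1_C (D m w) : R)).
    rewrite -ExB; [|exact: bmfM|exact: bmfZ].
    apply: eq_Ex => w; rewrite mulrBr [c * _]mulrC; congr (_ - _).
  rewrite h ?ExZ// 1?mulrC ?subrr// => j mj.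
  rewrite /g'; case: eqP => [_|/eqP jm]; first by exists C.
  by apply: hB; rewrite ltn_neqAle eq_sym jm.
have bpc : bmf (fun w => psi w - c) by apply: bmfB => //; exact: bmf_cst.
have := Ex_ext bgm bpc key.
have -> : E (fun w => g m (D m w) * (psi w - c)) =
   E (fun w => \prod_(j < k) g j (D j w)) - E (fun w => c * g m (D m w)).
  rewrite -ExB; [|by apply: bmf_prod => i _; exact: bmD|exact: bmfZ].
  by apply: eq_Ex => w; rewrite mulrBr (bigD1 m')//= [c * _]mulrC.
move/eqP; rewrite subr_eq0 => /eqP ->.
by rewrite ExZ// (bigD1 m')//= mulrC.
Qed.

End independence.

(** * Brownian increments and the heat semigroup *)

Section brownian.
Context {R : realType} d {T : measurableType d} (P : probability T R).
Variable W : R -> T -> R.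
Hypothesis hW : std_brownian P W.
Local Notation E := (Ex P).

Let mW t : measurable_fun setT (W t). Proof. by case: hW => _ [_ [h _]]; exact: h. Qed.
Let W0 w : W 0 w = 0. Proof. by case: hW. Qed.

Let mincr s t : measurable_fun setT (fun w => W t w - W s w).
Proof. exact: measurable_funB. Qed.

Lemma brownian_indep (ts : nat -> R) k : 0 <= ts 0%N -> (forall j, (j < k)%N -> ts j < ts j.+1) ->
  forall Bs : nat -> set R, (forall j, measurable (Bs j)) ->
  E (fun w => \prod_(j < k) (\1_(Bs j) (W (ts j.+1) w - W (ts j) w) : R)) =
  \prod_(j < k) fine (normal_prob 0 (Num.sqrt (ts j.+1 - ts j)) (Bs j)).
Proof.
(* [std_brownian] numbers increments from 1, the [j]-th one ending at [ts j]; the predecessor in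
   [Bs j.-1] realigns them with products over ['I_k]. *)
move=> t0 tS Bs mBs; case: hW => _ [_ [_ /(_ k ts (fun j => Bs j.-1) t0 tS (fun j => mBs j.-1))]].
set A := \bigcap_(j in _) _ => h.
have mpre j : measurable [set w | Bs j (W (ts j.+1) w - W (ts j) w)].
  by have := mincr (ts j) (ts j.+1) measurableT (mBs j); rewrite setTI.
have mA : measurable A.
  apply: bigcap_measurableType => j /= /andP[j0 _].
  by have := mpre j.-1; rewrite prednK.
have -> : (fun w => \prod_(j < k) (\1_(Bs j) (W (ts j.+1) w - W (ts j) w) : R)) = \1_A.
  apply/funext => w; rewrite [RHS]indicE; case: (boolP (w \in A)) => [/set_mem wA|wA].
    by rewrite big1// => j _; rewrite indicE mem_set//; exact: (wA j.+1 (ltn_ord j)).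
  apply/eqP; rewrite prodf_seq_eq0; apply/hasP; apply: contrapT => hn.
  case/negP: wA; apply/mem_set => j /= /andP[j0 jk].
  apply: contrapT => nB; apply: hn.
  have jk' : (j.-1 < k)%N by rewrite prednK.
  exists (Ordinal jk'); first by rewrite mem_index_enum.
  by rewrite /= indicE memNset// prednK.
rewrite Ex_indic// h big_add1/= big_mkord.
rewrite (eq_bigr (fun j : 'I_k => (fine (normal_prob 0 (Num.sqrt (ts j.+1 - ts j)) (Bs j)))%:E)).
  by rewrite prodEFin.
by move=> j _; rewrite fineK//; apply: fin_num_measure; exact: mBs.
Qed.

Lemma incr_law (s t : R) B : 0 <= s -> s < t -> measurable B ->
  P ((fun w => W t w - W s w) @^-1` B) = normal_prob 0 (Num.sqrt (t - s)) B.
Proof.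
move=> s0 st mB.
have mpre : measurable ((fun w => W t w - W s w) @^-1` B).
  by have := mincr s t measurableT mB; rewrite setTI.
pose ts j := if j is 0%N then s else t.
have := @brownian_indep ts 1 s0 _ (fun=> B) (fun=> mB).
rewrite big_ord1; under eq_Ex do rewrite big_ord1.
rewrite (_ : (fun w => _) = \1_((fun w => W t w - W s w) @^-1` B))//= Ex_indic//.
move=> h.
rewrite -[LHS]fineK ?fin_num_measure// -[RHS]fineK; last exact: fin_num_measure.
by rewrite h// => -[].
Qed.

Lemma brownian_prod (ts : nat -> R) k (g : nat -> R -> R) :
  0 <= ts 0%N -> (forall j, (j < k)%N -> ts j < ts j.+1) ->
  (forall j, measurable_fun setT (g j) /\ exists M, forall x, `|g j x| <= M) ->
  E (fun w => \prod_(j < k) g j (W (ts j.+1) w - W (ts j) w)) =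
  \prod_(j < k) E (fun w => g j (W (ts j.+1) w - W (ts j) w)).
Proof.
move=> t0 tS hg.
have tp j : (j <= k)%N -> 0 <= ts j.
  elim: j => // j IH jk; rewrite (le_trans (IH (ltnW jk)))// ltW// tS//.
apply: (@indep_prod _ _ _ P (fun j w => W (ts j.+1) w - W (ts j) w) k) => //.
move=> Bs mBs; rewrite brownian_indep//; apply: eq_bigr => j _.
rewrite -(incr_law (tp j (ltnW (ltn_ord j))) (tS _ (ltn_ord j)) (mBs j)).
rewrite -Ex_indic//.
by have := mincr (ts j) (ts j.+1) measurableT (mBs j); rewrite setTI.
Qed.

Lemma W_gauss_incr (s t : R) : 0 <= s -> s < t -> gauss_rv P (fun w => W t w - W s w) (t - s).
Proof.
move=> s0 st; apply: gauss_rv_law => //; first by rewrite subr_gt0.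
by move=> A mA; exact: incr_law.
Qed.

Lemma W_gauss (t : R) : 0 <= t -> gauss_rv P (W t) t.
Proof.
rewrite le_eqVlt => /predU1P[<-|t0].
  split => // a; rewrite mulr0 mul0r expR0.
  rewrite (eq_integral (fun=> 1%:E)) => [|w _]; last by rewrite W0 mulr0 expR0.
  by rewrite (ExE P (bmf_cst 1)) Ex_cst.
have := W_gauss_incr (lexx 0) t0; rewrite subr0.
by rewrite (_ : (fun w => W t w - W 0 w) = W t)//; apply/funext => w; rewrite W0 subr0.
Qed.

Definition usem (f : R -> R) (t x : R) := E (fun w => f (x + W t w)).

Lemma bmf_usem C f f1 f2 t x : Tay C f f1 f2 ->
  [/\ bmf (fun w => f (x + W t w)), bmf (fun w => f1 (x + W t w)) & bmf (fun w => f2 (x + W t w))].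
Proof.
move=> hT; have [m0 m1 m2] := Tay_meas hT; case: hT => hb _ _.
have mx : measurable_fun setT (fun w => x + W t w) by exact: measurable_funD.
split.
- by apply: (@bmf_comp _ _ _ f (fun w => x + W t w)) => //; exists C => y; case: (hb y).
- by apply: (@bmf_comp _ _ _ f1 (fun w => x + W t w)) => //; exists C => y; case: (hb y).
- by apply: (@bmf_comp _ _ _ f2 (fun w => x + W t w)) => //; exists C => y; case: (hb y).
Qed.

(** All clauses of [Tay] are pointwise and invariant under translation, so averaging over [W t]
    preserves them with the same [C]; a constant uniform in time is what the telescoping in
    [lindeberg] needs. *)
Lemma Tay_usem C f f1 f2 t : Tay C f f1 f2 ->
  Tay C (usem f t) (usem f1 t) (usem f2 t).
Proof.
move=> hT; have bm x := bmf_usem t x hT; case: hT => hb hl hT.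
split.
- move=> x; have [b0 b1 b2] := bm x.
  by split; apply: Ex_bound => // w; case: (hb (x + W t w)).
- move=> x y; have [b0 b1 b2] := bm x; have [b0' b1' b2'] := bm y.
  have e w : x - y = (x + W t w) - (y + W t w) by ring.
  split; rewrite /usem -ExB//; apply: Ex_bound; rewrite ?(e point); do ?exact: bmfB;
    by move=> w; rewrite -(e point) (e w); case: (hl (x + W t w) (y + W t w)).
- move=> x y; have [b0 b1 b2] := bm x; have [b0' _ _] := bm (x + y).
  have -> : usem f t (x + y) - usem f t x - usem f1 t x * y - usem f2 t x * y ^+ 2 / 2 =
    E (fun w => f (x + y + W t w) - f (x + W t w) - y * f1 (x + W t w) -
       (y ^+ 2 / 2) * f2 (x + W t w)).
    rewrite ExB; last 2 first.
    - by apply: bmfB; [exact: bmfB|exact: bmfZ].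
    - exact: bmfZ.
    rewrite ExB; [|exact: bmfB|exact: bmfZ].
    rewrite ExB// !ExZ// /usem; ring.
  apply: Ex_bound.
    by apply: bmfB; [apply: bmfB; [exact: bmfB|exact: bmfZ]|exact: bmfZ].
  move=> w; have := hT (x + W t w) y.
  rewrite (_ : x + W t w + y = x + y + W t w); last by ring.
  by congr (`|_| <= _); ring.
Qed.

Lemma interp1_err (C eta : R) (K : nat) (g : R -> R) (a : R) : 0 < eta ->
  (forall x, `|g x| <= C) -> (forall x y, `|g x - g y| <= C * `|x - y|) ->
  `|\sum_j g (qnode eta j) * qbase eta (K := K) j a - g a| <=
  C * (2 * eta) + C * \1_[set x | eta * (K%:R - 1) < `|x|] a.
Proof.
move=> eta0 gb gl.
have C0 : 0 <= C by rewrite (le_trans _ (gb 0)).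
set S := \sum_j qbase (K := K) eta j a.
have /andP[S0 S1] : 0 <= S <= 1 by exact: sum_qbase_le1.
have -> : \sum_j g (qnode eta j) * qbase eta (K := K) j a - g a =
   \sum_j (g (qnode eta j) - g a) * qbase eta (K := K) j a + g a * (S - 1).
  under [in RHS]eq_bigr do rewrite mulrBl.
  rewrite sumrB -mulr_sumr -/S; ring.
rewrite (le_trans (ler_normD _ _))// lerD//.
  rewrite (le_trans (ler_norm_sum _ _ _))//.
  apply: (@le_trans _ _ (\sum_j C * (2 * eta) * qbase eta (K := K) j a)).
    apply: ler_sum => j _; rewrite normrM [X in _ * X]ger0_norm ?qbase_ge0//.
    have [->|/(qbase_supp eta0) h] := eqVneq (qbase eta j a) 0; first by rewrite !mulr0.
    rewrite ler_wpM2r ?qbase_ge0// (le_trans (gl _ _))// ler_wpM2l// distrC//.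
  rewrite -mulr_sumr -/S ler_piMr// mulr_ge0// mulr_ge0// ltW//.
rewrite indicE; case: (boolP (a \in _)) => [_|/negP na].
  rewrite mulr1 normrM -[leRHS]mulr1 ler_pM// ler_norml; lra.
rewrite mulr0 /S sum_qbase_eq1 ?subrr ?mulr0 ?normr0// leNgt; apply/negP => h.
by apply: na; apply/mem_set.
Qed.

(** The integral over two independent increments is iterated without product measures:
    quasi-interpolation in the first one turns the integrand into a finite sum of products, each of
    which factors, and the sum is then reassembled. *)
Lemma usem_semigroup C f f1 f2 (t s x : R) : Tay C f f1 f2 -> 0 <= t -> 0 <= s ->
  usem f (t + s) x = E (fun w => usem f t (x + W s w)).
Proof.
move=> hT t0 s0.
have C0 : 0 <= C by case: hT => + _ _ => /(_ 0)[+ _ _]; apply: le_trans.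
have hTu := Tay_usem t hT.
have [mu _ _] := Tay_meas hTu; have [mf _ _] := Tay_meas hT.
have [ub ul _] := hTu; have [fb fl _] := hT.
move: s0; rewrite le_eqVlt => /predU1P[<-|s0].
  rewrite addr0 -[LHS](Ex_cst P); apply: eq_Ex => w; by rewrite W0 addr0.
move: (t0); rewrite le_eqVlt => /predU1P[t0'|tp].
  rewrite -t0' add0r; apply: eq_Ex => w.
  rewrite /usem (_ : (fun _ => _) = fun=> f (x + W s w)) ?Ex_cst//.
  by apply/funext => w'; rewrite W0 addr0.
pose A w := W s w; pose B w := W (t + s) w - W s w.
have mA : measurable_fun setT A by exact: mW.
have mB : measurable_fun setT B by exact: mincr.
have st : s < t + s by rewrite ltrDr.
have lawB (g : R -> R) : measurable_fun setT g -> (exists M, forall x, `|g x| <= M) ->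
    E (fun w => g (B w)) = E (fun w => g (W t w)).
  move=> mg bg; apply: Ex_eq_law => // D mD.
  rewrite (incr_law (ltW s0) st mD) addrK.
  have := incr_law (lexx 0) tp mD; rewrite subr0 => <-.
  by congr (P _); apply/seteqP; split => w /=; rewrite W0 subr0.
have ind (g h : R -> R) : measurable_fun setT g -> (exists M, forall x, `|g x| <= M) ->
    measurable_fun setT h -> (exists M, forall x, `|h x| <= M) ->
    E (fun w => g (A w) * h (B w)) = E (fun w => g (A w)) * E (fun w => h (B w)).
  move=> mg bg mh bh.
  pose ts j := if j is 0%N then 0 else if j is 1%N then s else t + s.
  pose gs j := if j is 0%N then g else h.
  rewrite (_ : (fun w => _) = (fun w => \prod_(j < 2) gs j (W (ts j.+1) w - W (ts j) w))); last first.
    by apply/funext => w; rewrite !big_ord_recl big_ord0 mulr1 /= W0 subr0.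
  rewrite brownian_prod => [|//|[|[|]]//|[|j]//].
  rewrite !big_ord_recl big_ord0 mulr1 /=; congr (_ * _); apply: eq_Ex => w.
  by rewrite W0 subr0.
suff H (e : R) : 0 < e -> `|usem f (t + s) x - E (fun w => usem f t (x + W s w))| <= e.
  apply/eqP; rewrite -subr_eq0 -normr_eq0 eq_le normr_ge0 andbT.
  by apply/ler_addgt0Pl => e e0; rewrite addr0; exact: H.
move=> e0.
pose eta := e / (8 * (C + 1)); have C1 : 0 < C + 1 by rewrite ltr_wpDl.
have eta0 : 0 < eta by rewrite divr_gt0// mulr_gt0.
(* Chebyshev's bound for [A] outside the box, times [C], is at most e/4 once (K - 1)^2 exceeds 4 C s
   / (e eta^2); the extra 1 ensures K - 1 >= 1, so that squaring only helps. *)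
pose K := (Num.truncn (4 * C * s / e / eta ^+ 2 + 1)).+2.
have KE : 4 * C * s / e / eta ^+ 2 + 1 <= K%:R - 1.
  by rewrite /K -[X in _ <= X - 1]natr1 addrK ltW//; exact: truncnS_gt.
have q0 : 0 <= 4 * C * s / e / eta ^+ 2.
  apply: divr_ge0; last by rewrite exprn_ge0// ltW.
  by apply: divr_ge0; [rewrite mulr_ge0 ?(ltW s0)// mulr_ge0|exact: ltW].
have K1 : (1 : R) <= K%:R - 1 by apply: (@le_trans _ _ (4 * C * s / e / eta ^+ 2 + 1)) => //; rewrite lerDr.
pose Q := [set y : R | eta * (K%:R - 1) < `|y|].
have mQ : measurable Q.
  have := @normr_measurable R setT measurableT _ (measurable_itv `]eta * (K%:R - 1), +oo[).
  by rewrite setTI; congr measurable; apply/seteqP; split => y /=; rewrite in_itv/= andbT.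
have bQ : bmf (fun w => \1_Q (A w) : R).
  apply: (@bmf_comp _ _ _ (\1_Q) A) => //.
  by exists 1 => y; rewrite indicE; case: (_ \in _) => /=; rewrite ?normr1 ?normr0.
have PQ : C * E (fun w => \1_Q (A w) : R) <= e / 4.
  have -> : E (fun w => \1_Q (A w) : R) = fine (P [set w | eta * (K%:R - 1) < `|A w|]).
    rewrite -Ex_indic//.
    by have := mA measurableT _ mQ; rewrite setTI.
  have a0 : 0 < eta * (K%:R - 1) by rewrite mulr_gt0//; lra.
  have := gauss_tail (ltW s0) (W_gauss (ltW s0)) a0 => h.
  apply: (le_trans (ler_wpM2l C0 h)).
  rewrite mulrA ler_pdivrMr ?exprn_gt0// exprMn.
  have K2 : 4 * C * s / e / eta ^+ 2 <= (K%:R - 1) ^+ 2.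
    by rewrite expr2; apply: (@le_trans _ _ (K%:R - 1)); [lra|rewrite ler_peMl//; lra].
  have e2 : 0 < eta ^+ 2 by rewrite exprn_gt0.
  move: K2; rewrite ler_pdivrMr// ler_pdivrMr// => K2.
  move: ((K%:R - 1) ^+ 2) (eta ^+ 2) K2 => p r; lra.
have hl (g : R -> R) (y : R) : (forall a b, `|g a - g b| <= C * `|a - b|) ->
    forall a b, `|g (y + a) - g (y + b)| <= C * `|a - b|.
  by move=> gl a b; rewrite (le_trans (gl _ _))// (_ : y + a - (y + b) = a - b)//; ring.
have bq j : bmf (fun w => qbase (K := K) eta j (A w)) by exact: qbase_bmf.
have mq j : measurable_fun setT (qbase (K := K) eta j) /\ exists M, forall y, `|qbase (K := K) eta j y| <= M.
  have [C' [f1' [f2' h]]] := @qbase_Tay _ eta K j; have [m _ _] := Tay_meas h.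
  by split => //; exists C' => z; case: h => /(_ z)[].
have mfx (y : R) : measurable_fun setT (fun b : R => f (y + b)).
  by apply: measurableT_comp => //; exact: measurable_funD.
have bfx (y : R) : exists M, forall b, `|f (y + b)| <= M by exists C => b; case: (fb (y + b)).
have bB (y : R) : bmf (fun w => f (y + B w)).
  by apply: (@bmf_comp _ _ _ (fun b => f (y + b)) B).
have b1 : bmf (fun w => f (x + W (t + s) w)) by have [] := bmf_usem (t + s) x hT.
have b2 : bmf (fun w => usem f t (x + W s w)) by have [] := bmf_usem s x hTu.
have bS1 : bmf (fun w => \sum_j f (x + B w + qnode eta j) * qbase (K := K) eta j (A w)).
  apply: bmf_sum => j _; apply: bmfM => //.
  by under eq_fun do rewrite addrAC; exact: bB.
have bS2 : bmf (fun w => \sum_j usem f t (x + qnode eta j) * qbase (K := K) eta j (A w)).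
  by apply: bmf_sum => j _; exact: bmfZ.
have bE : bmf (fun w => C * (2 * eta) + C * \1_Q (A w)).
  by apply: bmfD; [exact: bmf_cst|exact: bmfZ].
have EE : E (fun w => C * (2 * eta) + C * \1_Q (A w)) <= e / 2.
  rewrite ExD; [|exact: bmf_cst|exact: bmfZ]; rewrite Ex_cst ExZ//.
  have : C * (2 * eta) <= e / 4.
    rewrite (_ : e / 4 = (C + 1) * (2 * eta)); last by rewrite /eta; field; rewrite gt_eqF.
    by apply: ler_wpM2r; [rewrite mulr_ge0// ltW|rewrite lerDl].
  lra.
have S12 : E (fun w => \sum_j f (x + B w + qnode eta j) * qbase (K := K) eta j (A w)) =
           E (fun w => \sum_j usem f t (x + qnode eta j) * qbase (K := K) eta j (A w)).
  rewrite Ex_sum => [|j _]; last by apply: bmfM => //; under eq_fun do rewrite addrAC; exact: bB.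
  rewrite Ex_sum => [|j _]; last exact: bmfZ.
  apply: eq_bigr => j _; rewrite ExZ//.
  rewrite (_ : E _ = E (fun w => qbase (K := K) eta j (A w) * f (x + qnode eta j + B w))); last first.
    by apply: eq_Ex => w; rewrite mulrC addrAC.
  have [m1 m2] := mq j.
  rewrite (ind _ (fun b => f (x + qnode eta j + b)))// mulrC.
  by rewrite (lawB (fun b => f (x + qnode eta j + b))).
have h1 : `|E (fun w => \sum_j f (x + B w + qnode eta j) * qbase (K := K) eta j (A w)) - usem f (t + s) x| <= e / 2.
  rewrite /usem -ExB//; apply: le_trans EE; apply: Ex_norm_le => //; first exact: bmfB.
  move=> w; have := @interp1_err C eta K (fun a => f (x + B w + a)) (A w) eta0.
  rewrite (_ : x + B w + A w = x + W (t + s) w); last by rewrite /A /B; ring.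
  apply; last by apply: hl => a b; case: (fl a b).
  by move=> y; case: (fb (x + B w + y)).
have h2 : `|E (fun w => \sum_j usem f t (x + qnode eta j) * qbase (K := K) eta j (A w)) - E (fun w => usem f t (x + W s w))| <= e / 2.
  rewrite -ExB//; apply: le_trans EE; apply: Ex_norm_le => //; first exact: bmfB.
  move=> w; apply: (@interp1_err C eta K (fun a => usem f t (x + a)) (A w) eta0).
    by move=> y; case: (ub (x + y)).
  by apply: hl => a b; case: (ul a b).
move: h1 h2; rewrite S12 !ler_norml; lra.
Qed.

(** By the semigroup law u_{t+s}(x) = E u_t(x + W_s); the Taylor expansion at x meets the moments 0
    and s, and the third absolute moment, at most 48 s^(3/2), bounds the defect. *)
Lemma heat_usem C f f1 f2 : Tay C f f1 f2 ->
  heat C (C * 48) (usem f) (usem f1) (usem f2).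
Proof.
move=> hT.
have C0 : 0 <= C by case: hT => + _ _ => /(_ 0)[+ _ _]; apply: le_trans.
split => [t _|t s x t0 s0]; first exact: Tay_usem.
rewrite (usem_semigroup x hT t0 s0).
have hTu := Tay_usem t hT.
have [b0 _ _] := bmf_usem s x hTu.
move: s0; rewrite le_eqVlt => /predU1P[<-|s0].
  rewrite mulr0 mul0r subr0 mul0r mulr0 (_ : E _ = usem f t x) ?subrr ?normr0//.
  by rewrite -[RHS](Ex_cst P); apply: eq_Ex => w; rewrite W0 addr0.
have gW := W_gauss (ltW s0).
have [i3 e3] := Ex_norm3 (ltW s0) gW s0.
have i1 := integrable_B gW; have i2 := integrable_B2 gW.
have e1 := Ex_B (ltW s0) gW; have e2 := Ex_B2 (ltW s0) gW.
pose g w := usem f1 t x * W s w + usem f2 t x / 2 * W s w ^+ 2.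
have ig1 : P.-integrable setT (EFin \o (fun w => usem f1 t x * W s w)).
  by rewrite (_ : _ \o _ = (fun w => (usem f1 t x)%:E * (W s w)%:E)%E)//; exact: integrableZl.
have ig2 : P.-integrable setT (EFin \o (fun w => usem f2 t x / 2 * W s w ^+ 2)).
  by rewrite (_ : _ \o _ = (fun w => (usem f2 t x / 2)%:E * (W s w ^+ 2)%:E)%E)//; exact: integrableZl.
have ig : P.-integrable setT (EFin \o g).
  rewrite (_ : _ \o _ = (EFin \o (fun w => usem f1 t x * W s w)) \+
     (EFin \o (fun w => usem f2 t x / 2 * W s w ^+ 2)))//.
  exact: integrableD.
have Eg : E g = usem f2 t x * s / 2.
  rewrite ExD_int// ExZ_int// e1 mulr0 add0r ExZ_int// e2; ring.
pose a w := usem f t (x + W s w) - usem f t x.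
have ba : bmf a by apply: bmfB => //; exact: bmf_cst.
have ia := bmf_int P ba.
have Ea : E a = E (fun w => usem f t (x + W s w)) - usem f t x.
  by rewrite ExB ?Ex_cst//; exact: bmf_cst.
rewrite -Ea -Eg.
have iag : P.-integrable setT (EFin \o (fun w => a w - g w)).
  rewrite (_ : _ \o _ = ((EFin \o a) \- (EFin \o g))%E)//.
  exact: integrableB.
have -> : E a - E g = E (fun w => a w - g w) by rewrite [RHS]RintegralB.
rewrite (le_trans (le_normr_Rintegral _ _))//.
have i3' : P.-integrable setT (EFin \o (fun w => C * `|W s w| ^+ 3)).
  by rewrite (_ : _ \o _ = (fun w => C%:E * (`|W s w| ^+ 3)%:E)%E)//; exact: integrableZl.
apply: (@le_trans _ _ (E (fun w => C * `|W s w| ^+ 3))).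
  have iag' := @integrable_abse _ _ _ P setT _ iag.
  apply: le_Ex_int => // w.
  case: hTu => _ _ /(_ x (W s w)); rewrite /a /g.
  by congr (`|_| <= _); field.
by rewrite ExZ_int// -mulrA ler_wpM2l.
Qed.

End brownian.

(** * Functionals on the Skorohod space *)

Section paths.
Context {R : realType}.
Implicit Types (x y : R -> R) (t s : R).

(** Continuity on the half-line in epsilon form: paths are functions on all of [R] whose values at
    negative times are irrelevant. *)
Definition econt (g : R -> R) := forall t (e : R), 0 <= t -> 0 < e ->
  exists2 r : R, 0 < r & forall s, 0 <= s -> `|t - s| < r -> `|g t - g s| <= e.

Lemma within_econt g : {within [set t : R | 0 <= t], continuous g} -> econt g.
Proof.
move=> /subspace_continuousP h t e t0 e0.
have /cvgrPdist_le/(_ e e0) := h t t0.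
rewrite near_withinE => -[r /= r0 hr].
exists r => // s s0 ts; exact: hr.
Qed.

Lemma econt_cadlag g : econt g -> cadlag g.
Proof.
move=> h; split => t t0.
  apply/cvgrPdist_le => e e0; have [r r0 hr] := h t e t0 e0.
  near=> s; apply: hr.
    by rewrite (le_trans t0)// ltW//; near: s; exact: nbhs_right_gt.
  rewrite distrC gtr0_norm ?subr_gt0; last by near: s; exact: nbhs_right_gt.
  by rewrite ltrBlDl; near: s; apply: nbhs_right_lt; rewrite ltrDl.
apply/cvg_ex; exists (g t); apply/cvgrPdist_le => e e0; have [r r0 hr] := h t e (ltW t0) e0.
near=> s; apply: hr.
  by rewrite ltW//; near: s; exact: nbhs_left_gt.
rewrite gtr0_norm ?subr_gt0; last by near: s; exact: nbhs_left_lt.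
by rewrite ltrBlDr -ltrBlDl; near: s; apply: nbhs_left_gt; rewrite ltrBlDl ltrDr.
Unshelve. all: by end_near. Qed.

Lemma econt_uniform g (m e : R) : econt g -> 0 < e -> exists2 r : R, 0 < r &
  forall t s, 0 <= t <= m -> 0 <= s -> `|t - s| <= r -> `|g t - g s| <= e.
Proof.
move=> h e0.
pose Q (r x : R) := 0 <= x -> forall s, 0 <= s -> `|x - s| <= r -> `|g x - g s| <= e.
have /compact_near_coveringP/(_ R 0^'+ Q) := @segment_compact R 0 m.
have : (forall x : R, `[0, m]%classic x -> \forall x' \near x & r \near 0^'+, Q r x').
  move=> x /=; rewrite in_itv/= => /andP[x0 _].
  have e2 : 0 < e / 2 by rewrite divr_gt0.
  have [r r0 hr] := h x _ x0 e2.
  have r2 : 0 < r / 2 by rewrite divr_gt0.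
  near=> x' b => x'0 s s0 xs.
  have h1 : `|x - x'| < r / 2 by near: x'; exact: cvgr_dist_lt.
  have h2 : b < r / 2 by near: b; exact: nbhs_right_lt.
  have h1' : `|x - x'| < r by lra.
  have h3 := hr x' x'0 h1'.
  have h4 : `|x - s| < r.
    have -> : x - s = (x - x') + (x' - s) by ring.
    by rewrite (le_lt_trans (ler_normD _ _))// (splitr r) ltrD// (le_lt_trans xs).
  have h5 := hr s s0 h4.
  have -> : g x' - g s = (g x - g s) - (g x - g x') by ring.
  rewrite (le_trans (ler_normB _ _))//; lra.
move=> H0 /(_ _ H0) H.
have [r [r0 hr]] : exists r : R, 0 < r /\ (`[0, m]%classic `<=` Q r).
  near (0 : R)^'+ => r; exists r; split; first by near: r; exact: nbhs_right_gt.
  by near: r; exact: H.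
by exists r => // t s /andP[t0 tm] s0 ts; apply: hr => //=; rewrite in_itv/= t0.
Unshelve. all: by end_near. Qed.

(** The cadlag property of an integer-valued path: constant just after each time and just before
    each positive time. Composition with any sequence of reals is then cadlag. *)
Definition stepidx (psi : R -> nat) :=
  (forall t, 0 <= t -> exists2 r : R, 0 < r & forall s, t <= s -> s < t + r -> psi s = psi t) /\
  (forall t, 0 < t -> exists k, exists2 r : R, 0 < r & forall s, 0 <= s -> t - r < s -> s < t -> psi s = k).

Lemma stepidx_truncn (a b : R) : 0 <= a -> 0 < b -> stepidx (fun t => Num.truncn (a + b * t)).
Proof.
move=> a0 b0; split => t t0.
  have y0 : 0 <= a + b * t by rewrite addr_ge0// mulr_ge0// ltW.
  have /andP[h1 h2] := truncn_itv y0.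
  set k := Num.truncn _ in h1 h2 *.
  exists ((k.+1%:R - (a + b * t)) / b); first by rewrite divr_gt0// subr_gt0.
  move=> s ts; rewrite -ltrBlDl ltr_pdivlMr// => hs.
  have := ler_wpM2l (ltW b0) ts => hb.
  by apply: truncn_def; apply/andP; split; lra.
have y0 : 0 < a + b * t by rewrite ltr_wpDl// mulr_gt0.
(* Just before an integer the truncation equals the preceding integer, hence an interval open on the
   left and closed on the right. *)
have [k /andP[k1 k2]] : exists k : nat, k%:R < a + b * t <= k%:R + 1.
  have /andP[h1 h2] := truncn_itv (ltW y0).
  move: h1; rewrite le_eqVlt => /orP[/eqP h1|h1]; last first.
    by exists (Num.truncn (a + b * t)); rewrite h1/= natr1 ltW.
  have k0 : (0 < Num.truncn (a + b * t))%N by rewrite -(ltr0n R) h1.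
  exists (Num.truncn (a + b * t)).-1; rewrite natr1 prednK// -[X in _ < X <= _]h1 lexx andbT.
  by rewrite ltr_nat prednK.
exists k, ((a + b * t - k%:R) / b); first by rewrite divr_gt0// subr_gt0.
move=> s s0; rewrite ltrBlDr -ltrBlDl ltr_pdivlMr// => h1 h2.
have : b * s < b * t by rewrite ltr_pM2l.
move=> h3; apply: truncn_def; rewrite -natr1; apply/andP; split; lra.
Qed.

Lemma cadlag_step (ph : R -> R) (psi : R -> nat) (y : nat -> R) :
  econt ph -> stepidx psi -> cadlag (fun t => ph t * y (psi t)).
Proof.
move=> /econt_cadlag[c1 c2] [s1 s2]; split => t t0.
  have [r r0 hr] := s1 t t0.
  apply: (@cvg_trans _ (ph s * y (psi t) @[s --> t^'+])); last first.
    by apply: cvgM; [exact: c1|exact: cvg_cst].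
  apply: near_eq_cvg; near=> s.
  have ts : t < s by near: s; exact: nbhs_right_gt.
  have sr : s < t + r by near: s; apply: nbhs_right_lt; rewrite ltrDl.
  by rewrite (hr s (ltW ts) sr).
have [k [r r0 hr]] := s2 t t0.
have /cvg_ex[l hl] := c2 t t0; apply/cvg_ex; exists (l * y k).
apply: (@cvg_trans _ (ph s * y k @[s --> t^'-])); last first.
  by apply: cvgM; [exact: hl|exact: cvg_cst].
apply: near_eq_cvg; near=> s.
have s0 : 0 < s by near: s; exact: nbhs_left_gt.
have rs : t - r < s by near: s; apply: nbhs_left_gt; rewrite ltrBlDr ltrDl.
have st : s < t by near: s; exact: nbhs_left_lt.
by rewrite (hr s (ltW s0) rs st).
Unshelve. all: by end_near. Qed.

Lemma econt_cst (a : R) : econt (fun=> a).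
Proof. by move=> t e t0 e0; exists 1 => // s _ _; rewrite subrr normr0 ltW. Qed.

Section functional.
Variables (F : (R -> R) -> R) (M : R).
Hypothesis FM : forall x, cadlag x -> `|F x| <= M.
Hypothesis Fc : skorohod_continuous F.

(* [Gfun m] is the inf-convolution of [F] with m times the uniform distance on
   [0, m]: it is m-Lipschitz for that distance and increases to [F]. *)
Definition Gset (m : nat) x := [set z | exists y (e : R), [/\ cadlag y, 0 <= e,
  (forall t, 0 <= t <= m%:R -> `|x t - y t| <= e) & z = F y + m%:R * e]].
Definition Gfun (m : nat) x : R := inf (Gset m x).

Lemma Gset_lb m x : lbound (Gset m x) (- M).
Proof.
move=> z [y [e [cy e0 _ ->]]]; have := FM cy; rewrite ler_norml => /andP[h _].
by rewrite (le_trans h)// lerDl mulr_ge0.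
Qed.

Lemma Gset_F m x : cadlag x -> Gset m x (F x).
Proof. by move=> cx; exists x, 0; split => // [t _|]; rewrite ?subrr ?normr0// mulr0 addr0. Qed.

Lemma Gfun_le m x : cadlag x -> Gfun m x <= F x.
Proof. by move=> cx; apply: ge_inf; [exists (- M); exact: Gset_lb|exact: Gset_F]. Qed.

Lemma Gfun_ge m x : cadlag x -> - M <= Gfun m x.
Proof.
by move=> cx; apply: lb_le_inf; [exists (F x); exact: Gset_F|exact: Gset_lb].
Qed.

Lemma Gfun_bound m x : cadlag x -> `|Gfun m x| <= M.
Proof.
move=> cx; rewrite ler_norml Gfun_ge//= (le_trans (Gfun_le m cx))//.
by have := FM cx; rewrite ler_norml => /andP[].
Qed.

Lemma Gfun_shift m x x' (a : R) : cadlag x -> 0 <= a ->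
  (forall t, 0 <= t <= m%:R -> `|x t - x' t| <= a) -> Gfun m x' <= Gfun m x + m%:R * a.
Proof.
move=> cx a0 h; rewrite -lerBlDr; apply: lb_le_inf; first by exists (F x); exact: Gset_F.
move=> z [y [e [cy e0 hy ->]]]; rewrite lerBlDr -addrA -mulrDr.
apply: ge_inf; first by exists (- M); exact: Gset_lb.
exists y, (e + a); split => //; first by rewrite addr_ge0.
move=> t ht; rewrite (_ : x' t - y t = (x t - y t) - (x t - x' t)); last by ring.
by rewrite (le_trans (ler_normB _ _))// lerD ?hy ?h.
Qed.

Lemma Gfun_lip m x x' (a : R) : cadlag x -> cadlag x' -> 0 <= a ->
  (forall t, 0 <= t <= m%:R -> `|x t - x' t| <= a) -> `|Gfun m x - Gfun m x'| <= m%:R * a.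
Proof.
move=> cx cx' a0 h; have h1 := Gfun_shift cx a0 h.
have h2 : Gfun m x <= Gfun m x' + m%:R * a.
  by apply: Gfun_shift => // t ht; rewrite distrC; exact: h.
rewrite ler_norml; lra.
Qed.

Lemma time_change_id : time_change (id : R -> R).
Proof.
split; [|split => //].
- by apply: continuous_subspaceT => x; exact: cvg_id.
- by move=> u u0; exists u.
Qed.

Lemma skorohod_cvg_unif (ys : nat -> R -> R) x : 
  (forall (m e : R), 0 <= m -> 0 < e -> \forall n \near \oo,
      forall t, 0 <= t <= m -> `|ys n t - x t| <= e) -> skorohod_cvg ys x.
Proof.
move=> h; exists (fun=> id); first by move=> _; exact: time_change_id.
split => // e e0; apply: nearW => n t _; by rewrite subrr normr0 ltW.
Qed.

(** Comparison with [x] itself shows that a near-minimiser pays at most [2 * M + 1], so its distance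
    to [x] on [0, m] is of order 1/m. Near-minimisers thus converge to [x] uniformly on compacts,
    hence for the Skorohod topology with identity time changes, and continuity of [F] squeezes the
    infima. *)
Lemma Gfun_cvg x : cadlag x -> Gfun m x @[m --> \oo] --> F x.
Proof.
move=> cx.
have : forall m, exists ye : (R -> R) * R, [/\ cadlag ye.1, 0 <= ye.2,
  (forall t, 0 <= t <= m%:R -> `|x t - ye.1 t| <= ye.2) &
  F ye.1 + m%:R * ye.2 <= Gfun m x + m.+1%:R^-1].
  move=> m; have i0 : (0 : R) < m.+1%:R^-1 by rewrite invr_gt0.
  have hi : has_inf (Gset m x).
    by split; [exists (F x); exact: Gset_F|exists (- M); exact: Gset_lb].
  have [z [y [e [cy e0 hy ->]]] hz] := inf_adherent i0 hi.
  by exists (y, e); split => //; exact: ltW.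
move=> /choice[ye hye].
have M0 : 0 <= M by rewrite (le_trans _ (FM cx)).
have em m : (0 < m)%N -> (ye m).2 <= (2 * M + 1) / m%:R.
  move=> m0; have [cy e0 _ h] := hye m.
  rewrite ler_pdivlMr ?ltr0n// mulrC.
  have := Gfun_le m cx; have := FM cx; have := FM cy; rewrite !ler_norml => /andP[? ?] /andP[? ?] ?.
  have : m.+1%:R^-1 <= 1 :> R by rewrite invf_le1// ler1n.
  move: (m.+1%:R^-1) h => i h i1; lra.
have Fy : F (ye n).1 @[n --> \oo] --> F x.
  apply: Fc => //; first by move=> n; case: (hye n).
  apply: skorohod_cvg_unif => m e m0 e0; near=> n => t /andP[t0 tm].
  have [cy en0 hy _] := hye n.
  have n0 : (0 < n)%N by near: n; exact: nbhs_infty_gt.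
  rewrite distrC (le_trans (hy t _))//.
    by rewrite t0/= (le_trans tm)//; near: n; exact: nbhs_infty_ger.
  rewrite (le_trans (em n n0))// ler_pdivrMr ?ltr0n// [leRHS]mulrC -ler_pdivrMr//.
  by near: n; exact: nbhs_infty_ger.
apply: (@squeeze_cvgr _ _ _ _ (fun n => F (ye n).1 - n.+1%:R^-1) (fun=> F x)).
- near=> n; rewrite Gfun_le// andbT lerBlDr; have [_ en0 _ h] := hye n.
  by apply: le_trans h; rewrite lerDl mulr_ge0.
- rewrite -[X in _ --> X]subr0; apply: cvgB => //; exact: cvg_harmonic.
- exact: cvg_cst.
Unshelve. all: by end_near. Qed.

End functional.

End paths.

Lemma block_sum (R : realType) (a : nat -> R) k0 k1 : (k0 <= k1)%N ->
  \sum_(i < k1 - k0) a (k0 + i)%N = \sum_(k < k1) a k - \sum_(k < k0) a k.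
Proof.
move=> /subnKC; move: (k1 - k0)%N => j <- {k1}.
elim: j => [|j IH]; first by rewrite big_ord0 addn0 subrr.
by rewrite addnS !big_ord_recr/= IH; ring.
Qed.

Lemma near_ord (l : nat) (Q : nat -> nat -> Prop) :
  (forall i, (i < l)%N -> \forall n \near \oo, Q i n) ->
  \forall n \near \oo, forall i, (i < l)%N -> Q i n.
Proof.
elim: l => [|l IH] h; first exact: nearW.
have h1 := IH (fun i il => h i (ltnW il)); have h2 := h l (ltnSn l).
near=> n => i; rewrite ltnS leq_eqVlt => /orP[/eqP->|il].
  by near: n.
by move: i il; near: n.
Unshelve. all: by end_near. Qed.

(** * Convergence of finitely many increments *)

Section fdd.
Context {R : realType} d {T : measurableType d} (P : probability T R).
Variable (Fg : nat -> set (set T)).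
Hypothesis Fsub : forall k A, Fg k A -> measurable A.
Hypothesis Fmono : forall k, Fg k `<=` Fg k.+1.
Variables (D v L : nat -> T -> R) (c : nat -> R).
Hypothesis hD : mdiff P Fg D v.
Hypothesis adL : forall k, adp Fg k (L k).
Hypothesis LS : forall k w, L k.+1 w = L k w + c k * D k w.
Variable sg : R.
Hypothesis sg01 : 0 < sg <= 1.
Context d' {T' : measurableType d'} (P' : probability T' R) (W : R -> T' -> R).
Hypothesis hW : std_brownian P' W.
Variable h : nat -> R.
Local Notation E := (Ex P).

Lemma usem_cvg C f f1 f2 (a : nat -> R) (b x : R) : Tay C f f1 f2 ->
  (forall n, 0 <= a n) -> 0 <= b -> a n @[n --> \oo] --> b ->
  usem P' W f (a n) x @[n --> \oo] --> usem P' W f b x.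
Proof.
move=> hT a0 b0 ab.
have C0 : 0 <= C by case: hT => + _ _ => /(_ 0)[+ _ _]; apply: le_trans.
have [hu hh] := heat_usem hW hT.
have key s t : 0 <= s -> s <= t -> `|usem P' W f t x - usem P' W f s x| <=
    C * `|t - s| + C * 48 * (`|t - s| * Num.sqrt `|t - s|).
  move=> s0 st; have ts0 : 0 <= t - s by rewrite subr_ge0.
  have := hh s (t - s) x s0 ts0; rewrite subrKC (ger0_norm ts0).
  have [/(_ x)[_ _ h2] _ _] := hu s s0.
  have h3 : `|usem P' W f2 s x * (t - s) / 2| <= C * (t - s).
    rewrite !normrM (ger0_norm ts0) [`|2^-1|]ger0_norm//.
    have := ler_wpM2r ts0 h2; have := mulr_ge0 C0 ts0.
    have := mulr_ge0 (normr_ge0 (usem P' W f2 s x)) ts0; lra.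
  move=> h4; have := lerD h3 h4; apply: le_trans.
  rewrite [X in `|X| <= _](_ : _ = usem P' W f2 s x * (t - s) / 2 +
    (usem P' W f t x - usem P' W f s x - usem P' W f2 s x * (t - s) / 2)); last by ring.
  exact: ler_normD.
have key2 n : `|usem P' W f b x - usem P' W f (a n) x| <=
    C * `|b - a n| + C * 48 * (`|b - a n| * Num.sqrt `|b - a n|).
  have [ba|ab'] := leP (a n) b; first exact: key.
  by rewrite distrC [`|b - _|]distrC; apply: key => //; exact: ltW.
apply/cvgrPdist_le => e e0; near=> n.
apply: (le_trans (key2 n)).
have h1 : `|b - a n| <= Num.min 1 (e / (C * 49 + 1)).
  near: n; move/cvgrPdist_le: ab; apply.
  by rewrite lt_min ltr01 divr_gt0// ltr_wpDl// mulr_ge0.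
move: h1; rewrite le_min => /andP[h1 h2].
have h3 : Num.sqrt `|b - a n| <= 1 by rewrite -sqrtr1 ler_wsqrtr.
have h4 : `|b - a n| * Num.sqrt `|b - a n| <= `|b - a n| by rewrite ler_piMr.
move: h2; rewrite ler_pdivlMr; last by rewrite ltr_wpDl// mulr_ge0.
have := ler_wpM2l C0 h4; move: (normr_ge0 (b - a n)) => h5; lra.
Unshelve. all: by end_near. Qed.

Lemma adp_prod k l (g : nat -> T -> R) : (forall i, (i < l)%N -> adp Fg k (g i)) ->
  adp Fg k (fun w => \prod_(i < l) g i w).
Proof.
elim: l => [|l IH] hg.
  by under eq_fun do rewrite big_ord0; exact: adp_cst.
under eq_fun do rewrite big_ord_recr/=; apply: adpM; last exact: (hg l (ltnSn l)).
by apply: IH => i il; apply: hg; exact: ltnW.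
Qed.

Section scaled.
Variable n : nat.
Lemma adp_scaled k : adp Fg k (fun w => h n * L k w).
Proof. by apply: adpM; [exact: adp_cst|exact: adL]. Qed.
Lemma step_scaled k w : h n * L k.+1 w = h n * L k w + h n * c k * D k w.
Proof. by rewrite LS; ring. Qed.

Lemma incr2 k0 k1 : (k0 <= k1)%N ->
  [/\ bmf (fun w => h n * L k1 w - h n * L k0 w) &
  E (fun w => (h n * L k1 w - h n * L k0 w) ^+ 2) <= \sum_(k < k1) (h n * c k) ^+ 2].
Proof.
move=> k01; have e : (k0 + (k1 - k0))%N = k1 by exact: subnKC.
split.
  by have := bmf_incr Fsub hD step_scaled k0 (k1 - k0); rewrite e.
have := @moment2 _ _ _ P Fg Fsub D v hD k0 (fun j _ => h n * c (k0 + j)%N)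
  (fun j w => h n * L (k0 + j)%N w - h n * L k0 w) (fun j => `|h n * c (k0 + j)%N|)
  (fun j => @adp_cst _ _ _ Fg _ _) _ _ _ _ (k1 - k0)%N.
rewrite e; under eq_bigr do rewrite real_normK ?num_real//.
rewrite (block_sum (fun k => (h n * c k) ^+ 2) k01) => H.
apply: le_trans (H _ _ _ _) _.
- move=> j; apply: adpB; first exact: adp_scaled.
  by apply: adpS_le (@adp_scaled k0) => //; exact: leq_addr.
- by [].
- by move=> w; rewrite addn0 subrr.
- by move=> j w; rewrite addnS step_scaled; ring.
- by rewrite lerBlDr lerDl sumr_ge0// => k _; rewrite sqr_ge0.
Qed.
End scaled.

Variables (K : nat -> nat -> nat) (VV : nat -> R).
Hypothesis KS : forall n i, (K n i <= K n i.+1)%N.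
Hypothesis VV0 : 0 <= VV 0%N.
Hypothesis VVS : forall i, VV i <= VV i.+1.
Hypothesis cV : forall i, sg * \sum_(k < K n i) (h n * c k) ^+ 2 @[n --> \oo] --> VV i.
Hypothesis ce : forall i, \sum_(k < K n i) (h n * c k) ^+ 2 * E (fun w => `|v k w - sg|)
   @[n --> \oo] --> (0 : R).
Hypothesis c3 : forall i, \sum_(k < K n i) `|h n * c k| ^+ 3 @[n --> \oo] --> (0 : R).

Lemma Kle n i j : (i <= j)%N -> (K n i <= K n j)%N.
Proof.
move=> /subnKC <-; elim: (j - i)%N => [|k IH]; first by rewrite addn0.
by rewrite addnS (leq_trans IH).
Qed.

Lemma fdd_cvg (f : nat -> R -> R) l : (forall i, exists C f1 f2, Tay C (f i) f1 f2) ->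
  E (fun w => \prod_(i < l) f i (h n * L (K n i.+1) w - h n * L (K n i) w)) @[n --> \oo] -->
  \prod_(i < l) usem P' W (f i) (VV i.+1 - VV i) 0.
Proof.
move=> hf; elim: l => [|l IH].
  rewrite big_ord0; under eq_fun do (under eq_Ex do rewrite big_ord0).
  by under eq_fun do rewrite Ex_cst; exact: cvg_cst.
have /choice[C hC] : forall i, exists C, exists f1 f2, Tay C (f i) f1 f2 by [].
have [f1 [f2 hT]] := hC l.
have [sg0 sg1] := andP sg01.
have C0 i : 0 <= C i by have [? [? [+ _ _]]] := hC i => /(_ 0)[+ _ _]; apply: le_trans.
have mf i : measurable_fun setT (f i) by have [? [? /Tay_meas[]]] := hC i.
pose Phi n w := \prod_(i < l) f i (h n * L (K n i.+1) w - h n * L (K n i) w).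
have adPhi n : adp Fg (K n l) (Phi n).
  apply: (@adp_prod (K n l) l (fun i w => f i (h n * L (K n i.+1) w - h n * L (K n i) w))) => i il.
  apply: adp_comp => //; apply: adpB.
    by apply: adpS_le (@adp_scaled n (K n i.+1)) => //; exact: Kle.
  by apply: adpS_le (@adp_scaled n (K n i)) => //; apply: Kle; exact: ltnW.
pose M := \prod_(i < l) C i.
have hM n w : `|Phi n w| <= M.
  rewrite normr_prod; apply: ler_prod => i _; rewrite normr_ge0/=.
  by have [? [? [+ _ _]]] := hC i => /(_ (h n * L (K n i.+1) w - h n * L (K n i) w))[].
have M0 : 0 <= M by apply: prodr_ge0.
pose del n := sg * (\sum_(k < K n l.+1) (h n * c k) ^+ 2 - \sum_(k < K n l) (h n * c k) ^+ 2).
have del0 n : 0 <= del n.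
  rewrite mulr_ge0 ?(ltW sg0)// -(block_sum (fun k => (h n * c k) ^+ 2) (KS n l)).
  by rewrite sumr_ge0// => i _; rewrite sqr_ge0.
have delc : del n @[n --> \oo] --> VV l.+1 - VV l.
  by under eq_fun do rewrite /del mulrBr; apply: cvgB.
have hu := heat_usem hW hT.
pose A := C l; pose B := C l + `|C l * 48|.
pose err n := M * (A * (\sum_(k < K n l.+1) (h n * c k) ^+ 2 * E (fun w => `|v k w - sg|)) +
   B * \sum_(k < K n l.+1) `|h n * c k| ^+ 3).
have err0 : err n @[n --> \oo] --> (0 : R).
  rewrite (_ : 0 = M * (A * 0 + B * 0)); last by rewrite !mulr0 addr0 mulr0.
  apply: cvgM; first exact: cvg_cst.
  by apply: cvgD; apply: cvgM; do ?exact: cvg_cst.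
have main n : `|E (fun w => \prod_(i < l.+1) f i (h n * L (K n i.+1) w - h n * L (K n i) w)) -
    E (Phi n) * usem P' W (f l) (del n) 0| <= err n.
  have := @lindeberg _ _ _ P Fg Fsub Fmono D v hD (fun k w => h n * L k w) (fun k => h n * c k)
    (fun k => @adp_scaled n k) (fun k w => step_scaled n k w) (C l) (C l * 48) _ _ _ sg hu _ (K n l)
    (K n l.+1 - K n l)%N (Phi n) M 0 (adPhi n) (hM n) (lexx 0).
  have -> : (0 <= sg <= 1) by rewrite ltW.
  move=> /(_ isT).
  rewrite (block_sum (fun k => (h n * c k) ^+ 2) (KS n l)).
  rewrite (block_sum (fun k => (h n * c k) ^+ 2 * E (fun w => `|v k w - sg|)) (KS n l)).
  rewrite (block_sum (fun k => `|h n * c k| ^+ 3) (KS n l)).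
  rewrite subnKC// add0r -/(del n).
  have -> : E (fun w => Phi n w * usem P' W (f l) 0 (h n * L (K n l.+1) w - h n * L (K n l) w)) =
     E (fun w => \prod_(i < l.+1) f i (h n * L (K n i.+1) w - h n * L (K n i) w)).
    apply: eq_Ex => w; rewrite big_ord_recr/=; congr (_ * _).
    rewrite /usem (_ : (fun _ => _) = fun=> f l (h n * L (K n l.+1) w - h n * L (K n l) w)) ?Ex_cst//.
    by apply/funext => w'; case: hW => -> _; rewrite addr0.
  move=> H; apply: (le_trans H); rewrite ler_wpM2l// lerD// ler_wpM2l ?C0 ?addr_ge0//.
    rewrite lerBlDr lerDl sumr_ge0// => k _; rewrite mulr_ge0 ?sqr_ge0//.
    by apply: Ex_ge0.
  by rewrite lerBlDr lerDl sumr_ge0// => k _; rewrite exprn_ge0.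
rewrite big_ord_recr/=.
have lim2 : E (Phi n) * usem P' W (f l) (del n) 0 @[n --> \oo] -->
   \prod_(i < l) usem P' W (f i) (VV i.+1 - VV i) 0 * usem P' W (f l) (VV l.+1 - VV l) 0.
  apply: cvgM; first exact: IH.
  by apply: (@usem_cvg _ _ _ _ del (VV l.+1 - VV l) 0 hT del0); rewrite ?subr_ge0.
apply/cvgrPdist_le => e e0; have e2 : 0 < e / 2 by rewrite divr_gt0.
near=> n.
have h1 : `|\prod_(i < l) usem P' W (f i) (VV i.+1 - VV i) 0 * usem P' W (f l) (VV l.+1 - VV l) 0 -
   E (Phi n) * usem P' W (f l) (del n) 0| <= e / 2.
  by near: n; move/cvgrPdist_le: lim2; apply.
have h2 : err n <= e / 2.
  have : `|0 - err n| <= e / 2 by near: n; move/cvgrPdist_le: err0; apply.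
  by rewrite sub0r normrN; apply: le_trans; exact: ler_norm.
have := le_trans (main n) h2; move: h1; rewrite !ler_norml; lra.
Unshelve. all: by end_near. Qed.

(** [std_brownian] speaks of strictly increasing times, so a clock that is identically 0, as for rho
    = 0, is treated apart. *)
Lemma fdd_brownian (f : nat -> R -> R) l : (forall i, exists C f1 f2, Tay C (f i) f1 f2) ->
  ((forall i, VV i < VV i.+1) \/ (forall i, VV i = 0)) ->
  Ex P' (fun w => \prod_(i < l) f i (W (VV i.+1) w - W (VV i) w)) =
  \prod_(i < l) usem P' W (f i) (VV i.+1 - VV i) 0.
Proof.
move=> hf; have W0 w : W 0 w = 0 by case: hW.
have mW t : measurable_fun setT (W t) by case: hW => _ [_ [H _]]; exact: H.
have VVp i : 0 <= VV i by elim: i => // i IH; rewrite (le_trans IH).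
have bf i : measurable_fun setT (f i) /\ exists M, forall x, `|f i x| <= M.
  have [C [f1 [f2 H]]] := hf i; have [m _ _] := Tay_meas H; split => //.
  by exists C => x; case: H => /(_ x)[].
case=> [VVlt|VV00].
  rewrite (@brownian_prod _ _ _ P' W hW VV l f)//.
  apply: eq_bigr => i _; rewrite /usem.
  have [mfi bfi] := bf i.
  under [RHS]eq_Ex do rewrite add0r.
  apply: Ex_eq_law => //; first exact: measurable_funB.
  move=> A mA; rewrite (incr_law hW)//.
  have p0 : 0 < VV i.+1 - VV i by rewrite subr_gt0.
  have := incr_law hW (lexx 0) p0 mA; rewrite subr0 => <-.
  by congr (P' _); apply/seteqP; split => w /=; rewrite W0 subr0.
under eq_Ex => w.
  under eq_bigr do rewrite !VV00 subrr.
  over.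
rewrite Ex_cst; apply: eq_bigr => i _; rewrite /usem !VV00 subr0.
by under [RHS]eq_Ex do rewrite W0 addr0; rewrite Ex_cst.
Qed.

End fdd.

Lemma Ex_bounded_cvg (R : realType) d (T : measurableType d) (P : probability T R)
    (f_ : nat -> T -> R) (f : T -> R) (M : R) :
  (forall n, measurable_fun setT (f_ n)) -> (forall n w, `|f_ n w| <= M) ->
  (forall w, f_ n w @[n --> \oo] --> f w) ->
  bmf f /\ Ex P (f_ n) @[n --> \oo] --> Ex P f.
Proof.
move=> mf bf cf.
have mff : measurable_fun setT f.
  by apply: (@measurable_fun_cvg _ _ _ setT f_) => // w _; exact: cf.
have bff w : `|f w| <= M.
  have hc : `|f_ n w| @[n --> \oo] --> `|f w| by apply: cvg_norm; exact: cf.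
  rewrite -(cvg_lim _ hc)//; apply: limr_le; first by apply/cvg_ex; exists `|f w|.
  by apply: nearW.
have bmff : bmf f by split => //; exists M.
split => //.
have := @dominated_cvg _ _ _ P setT measurableT (fun n w => (f_ n w)%:E) (fun w => (f w)%:E)
  (fun=> M%:E).
move=> H.
have {}H : (\int[P]_w (f_ n w)%:E)%E @[n --> \oo] --> (\int[P]_w (f w)%:E)%E.
  apply: H => //.
  - by move=> n; exact/measurable_EFinP.
  - by move=> w _; apply: cvg_EFin; [exact: nearW|exact: cf].
  - exact: (bmf_int P (bmf_cst M)).
  - by move=> n w _; rewrite lee_fin.
rewrite (ExE P bmff) in H.
exact: (fine_cvg H).
Qed.

Lemma union_bad (R : realType) d (T : measurableType d) (P : probability T R) (j : nat)
    (Q : nat -> T -> Prop) (p : R) :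
  (forall i, (i < j)%N -> exists B, [/\ measurable B, fine (P B) <= p & forall w, ~ B w -> Q i w]) ->
  exists B, [/\ measurable B, fine (P B) <= j%:R * p & forall w, ~ B w -> forall i, (i < j)%N -> Q i w].
Proof.
elim: j => [|j IH] hB.
  by exists set0; split => //; rewrite measure0 mul0r.
have [B [mB pB hB1]] := IH (fun i ij => hB i (ltnW ij)).
have [C [mC pC hC]] := hB j (ltnSn j).
exists (B `|` C); split; first exact: measurableU.
  apply: (@le_trans _ _ (fine (P B) + fine (P C))); last by rewrite -natr1 mulrDl mul1r lerD.
  rewrite -fineD ?fin_num_measure//; apply: fine_le.
  - by apply: fin_num_measure; exact: measurableU.
  - by rewrite fin_numD !fin_num_measure.
  - exact: measureU2.
move=> w /not_orP[nB nC] i; rewrite ltnS leq_eqVlt => /orP[/eqP->|ij]; first exact: hC.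
exact: hB1.
Qed.

(** * The abstract functional limit theorem *)

Section fclt.
Context {R : realType} d {T : measurableType d} (P : probability T R).
Variable (Fg : nat -> set (set T)).
Hypothesis Fsub : forall k A, Fg k A -> measurable A.
Hypothesis Fmono : forall k, Fg k `<=` Fg k.+1.
Variables (D v L : nat -> T -> R) (c : nat -> R).
Hypothesis hD : mdiff P Fg D v.
Hypothesis adL : forall k, adp Fg k (L k).
Hypothesis LS : forall k w, L k.+1 w = L k w + c k * D k w.
Variable sg : R.
Hypothesis sg01 : 0 < sg <= 1.
Context d' {T' : measurableType d'} (P' : probability T' R) (W : R -> T' -> R).
Hypothesis hW : std_brownian P' W.
Variables (h : nat -> R) (kap : nat -> R -> nat) (V : R -> R) (B0 : R).
Hypothesis kap_mono : forall n (s t : R), 0 <= s -> s <= t -> (kap n s <= kap n t)%N.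
Hypothesis L0B : forall w, `|L 0%N w| <= B0.
Hypothesis h_cvg : h n @[n --> \oo] --> (0 : R).
Hypothesis cV : forall t : R, 0 <= t ->
  sg * \sum_(k < kap n t) (h n * c k) ^+ 2 @[n --> \oo] --> V t.
Hypothesis ce : forall t : R, 0 <= t ->
  \sum_(k < kap n t) (h n * c k) ^+ 2 * Ex P (fun w => `|v k w - sg|) @[n --> \oo] --> (0 : R).
Hypothesis c3 : forall t : R, 0 <= t ->
  \sum_(k < kap n t) `|h n * c k| ^+ 3 @[n --> \oo] --> (0 : R).
Hypothesis Vpos : (0 < V 0 /\ forall s t, 0 <= s -> s < t -> V s < V t) \/
  (forall t, 0 <= t -> V t = 0).
Hypothesis Vlip : forall m : R, exists2 Lp : R, 0 <= Lp &
  forall s t, 0 <= s <= m -> 0 <= t <= m -> `|V s - V t| <= Lp * `|s - t|.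
Variables (a b : nat -> R -> R) (U : nat -> T -> R).
Hypothesis mU : forall k, measurable_fun setT (U k).
Hypothesis cad_a : forall n, (0 < n)%N -> econt (a n) /\ stepidx (kap n).
Hypothesis bnd_a : forall n (m : nat), exists2 B : R, 0 <= B & forall t, 0 <= t <= m%:R -> `|a n t| <= B.
Hypothesis aU : forall n t w, (0 < n)%N -> 0 <= t ->
  a n t * U (kap n t) w = b n t * (h n * L (kap n t) w).
Hypothesis b_cvg : forall (m e : R), 0 < e -> \forall n \near \oo,
  forall t, 0 <= t <= m -> `|b n t - 1| <= e.

Local Notation E := (Ex P).
Local Notation E' := (Ex P').

Let mW t : measurable_fun setT (W t). Proof. by case: hW => _ [_ [H _]]; exact: H. Qed.
Let W0 w : W 0 w = 0. Proof. by case: hW. Qed.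

Lemma V_ge0 t : 0 <= t -> 0 <= V t.
Proof.
move=> t0; case: Vpos => [[V0 VS]|V0]; last by rewrite V0.
move: t0; rewrite le_eqVlt => /predU1P[<-|t0]; first exact: ltW.
by rewrite (le_trans (ltW V0))// ltW// VS.
Qed.

Lemma V_mono s t : 0 <= s -> s <= t -> V s <= V t.
Proof.
move=> s0; case: Vpos => [[V0 VS]|V0]; last by move=> st; rewrite !V0// (le_trans s0).
by rewrite le_eqVlt => /predU1P[->//|st]; rewrite ltW// VS.
Qed.

Definition limX (w : T') (t : R) := W (V t) w.
Definition preX (n : nat) (w : T) (t : R) := a n t * U (kap n t) w.

Lemma limX_econt w : econt (limX w).
Proof.
have hc : econt (W^~ w) by apply: within_econt; case: hW => _ [+ _]; exact.
move=> t e t0 e0; have [r r0 hr] := hc (V t) e (V_ge0 t0) e0.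
have [Lp Lp0 hL] := Vlip (t + 1).
exists (Num.min 1 (r / (Lp + 1))); first by rewrite lt_min ltr01 divr_gt0// ltr_wpDl.
move=> s s0; rewrite lt_min => /andP[h1]; rewrite ltr_pdivlMr; last by rewrite ltr_wpDl.
move=> h2; apply: hr; first exact: V_ge0.
apply: le_lt_trans (hL t s _ _) _.
- by rewrite t0 lerDl ler01.
- by rewrite s0/=; move: h1; rewrite ltr_norml => /andP[]; lra.
- by apply: le_lt_trans h2; rewrite mulrC ler_wpM2l// lerDl.
Qed.

Lemma preX_cadlag n w : (0 < n)%N -> cadlag (preX n w).
Proof. by move=> n0; have [ea sa] := cad_a n0; exact: (cadlag_step (fun k => U k w) ea sa). Qed.

Section grid.
Variables (m j : nat).
Hypothesis m0 : (0 < m)%N.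
Hypothesis j0 : (0 < j)%N.

Let del : R := m%:R / j%:R.
Let del0 : 0 < del. Proof. by rewrite divr_gt0// ltr0n. Qed.
Definition gridt i : R := i%:R * del.
(** The [0 +] here and the factor [1 *] in [ppath] give these terms the shape of [stepidx_truncn]
    and [cadlag_step]. *)
Definition gidx (t : R) : nat := Num.truncn (0 + del^-1 * t).
Definition pval (x : 'I_j.+1 -> R) (i : nat) : R := \sum_(k < j.+1 | (k <= i)%N) x k.
Definition ppath (x : 'I_j.+1 -> R) (t : R) : R := 1 * pval x (gidx t).
(* The grid starts one step early, at time index 0 of the martingale, so that the
   first increment carries the whole past. *)
Definition gK n i := if i is k.+1 then kap n (gridt k) else 0%N.
Definition gV i := if i is k.+1 then V (gridt k) else 0.

Lemma gridt_ge0 i : 0 <= gridt i. Proof. by rewrite mulr_ge0// ltW. Qed.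

Lemma gidxP t : 0 <= t <= m%:R -> [/\ gridt (gidx t) <= t, t < gridt (gidx t).+1 & (gidx t <= j)%N].
Proof.
move=> /andP[t0 tm].
have y0 : 0 <= 0 + del^-1 * t by rewrite add0r mulr_ge0// invr_ge0 ltW.
have /andP[h1 h2] := truncn_itv y0; split.
- by rewrite /gridt -ler_pdivlMr// mulrC -[leRHS]add0r; exact: h1.
- by rewrite /gridt -ltr_pdivrMr// mulrC -[X in X < _]add0r; exact: h2.
- rewrite -ltnS truncn_lt_nat// add0r mulrC ltr_pdivrMr//.
  apply: (le_lt_trans tm); rewrite /del -natr1 mulrDl mul1r mulrC divfK ?ltrDl//.
  by rewrite pnatr_eq0 -lt0n.
Qed.

Lemma gridt_j : gridt j = m%:R.
Proof. by rewrite /gridt /del mulrC divfK// pnatr_eq0 -lt0n. Qed.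

Lemma gidx_step t : 0 <= t <= m%:R -> `|t - gridt (gidx t)| <= del.
Proof.
move=> /gidxP[h1 h2 _]; rewrite ger0_norm ?subr_ge0// lerBlDl.
by rewrite ltW// (lt_le_trans h2)// /gridt -natr1 mulrDl mul1r.
Qed.

Lemma ppath_cadlag x : cadlag (ppath x).
Proof.
apply: cadlag_step; first exact: econt_cst.
by apply: stepidx_truncn => //; rewrite invr_gt0.
Qed.

Lemma pval_tel (g : nat -> R) i : (i < j.+1)%N ->
  pval (fun k => g k.+1 - g k) i = g i.+1 - g 0%N.
Proof.
move=> ij; rewrite /pval.
have H l : \sum_(k < l | (k <= i)%N) (g k.+1 - g k) = g (minn l i.+1) - g 0%N.
  elim: l => [|l IH]; first by rewrite big_ord0 min0n subrr.
  rewrite big_mkcond big_ord_recr/= -big_mkcond/= IH.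
  have [li|il] := leqP l i.
    rewrite (minn_idPl _); last by rewrite leqW.
    by rewrite (minn_idPl _) ?ltnS//; ring.
  by rewrite addr0 (minn_idPr _)// (minn_idPr _)// ltnW.
by rewrite H (minn_idPr _).
Qed.

Lemma pval_lip x y (e : R) i : (forall k, `|x k - y k| <= e) -> `|pval x i - pval y i| <= j.+1%:R * e.
Proof.
move=> hxy; have e0 : 0 <= e by exact: le_trans (hxy ord0).
rewrite -sumrB (le_trans (ler_norm_sum _ _ _))//.
apply: (@le_trans _ _ (\sum_(k < j.+1) e)).
  rewrite big_mkcond/=; apply: ler_sum => k _; case: ifP => // _.
by rewrite sumr_const card_ord mulr_natl.
Qed.

Lemma gK_step n i : (gK n i <= gK n i.+1)%N.
Proof.
by case: i => //= i; apply: kap_mono; [exact: gridt_ge0|rewrite ler_wpM2r ?ler_nat// ltW].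
Qed.

Lemma gV_step i : gV i <= gV i.+1.
Proof.
case: i => [|i] /=; first by apply: V_ge0; exact: gridt_ge0.
by apply: V_mono; [exact: gridt_ge0|rewrite ler_wpM2r ?ler_nat// ltW].
Qed.

Lemma gV_alt : (forall i, gV i < gV i.+1) \/ (forall i, gV i = 0).
Proof.
case: Vpos => [[V0 VS]|V0]; [left|right].
- case=> [|i] /=; first by rewrite /gridt mul0r.
  by apply: VS; [exact: gridt_ge0|rewrite ltr_pM2r// ltr_nat].
- by case=> //= i; rewrite V0//; exact: gridt_ge0.
Qed.

Lemma gcV i : sg * \sum_(k < gK n i) (h n * c k) ^+ 2 @[n --> \oo] --> gV i.
Proof.
case: i => [|i] /=; last by apply: cV; exact: gridt_ge0.
by under eq_fun do rewrite big_ord0 mulr0; exact: cvg_cst.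
Qed.
Lemma gce i : \sum_(k < gK n i) (h n * c k) ^+ 2 * E (fun w => `|v k w - sg|) @[n --> \oo] --> (0 : R).
Proof.
case: i => [|i] /=; last by apply: ce; exact: gridt_ge0.
by under eq_fun do rewrite big_ord0; exact: cvg_cst.
Qed.
Lemma gc3 i : \sum_(k < gK n i) `|h n * c k| ^+ 3 @[n --> \oo] --> (0 : R).
Proof.
case: i => [|i] /=; last by apply: c3; exact: gridt_ge0.
by under eq_fun do rewrite big_ord0; exact: cvg_cst.
Qed.

Definition xi n (i : 'I_j.+1) w := h n * L (gK n i.+1) w - h n * L (gK n i) w.
Definition ze (i : 'I_j.+1) w := W (gV i.+1) w - W (gV i) w.

Lemma mxi n i : measurable_fun setT (xi n i).
Proof.
by have [H _] := incr2 Fsub Fmono hD adL LS h n (gK_step n i); apply: bmf_meas H.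
Qed.
Lemma mze i : measurable_fun setT (ze i).
Proof. exact: measurable_funB. Qed.

Lemma tail_xi_ze (e : R) : 0 < e -> exists2 A : R, 0 < A & \forall n \near \oo, forall i : 'I_j.+1,
   fine (P [set w | A < `|xi n i w|]) <= e /\ fine (P' [set w | A < `|ze i w|]) <= e.
Proof.
move=> e0; have [sg0 sg1] := andP sg01.
have Vj i : (i <= j.+1)%N -> gV i <= V m%:R.
  case: i => [|i] ij /=; first exact: V_ge0.
  rewrite -gridt_j; apply: V_mono; first exact: gridt_ge0.
  by rewrite /gridt ler_wpM2r ?ler_nat// ltW.
have gV0 i : 0 <= gV i by case: i => //= i; apply: V_ge0; exact: gridt_ge0.
(* An eventual bound on the sums of squares, divided by [sg] because [cV] carries that factor. The
   level [A] below is at least 1, so its square exceeds [Q / e]. *)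
pose Q := V m%:R / sg + 1.
have Vm0 : 0 <= V m%:R by exact: V_ge0.
have Q0 : 0 < Q by rewrite ltr_wpDl// divr_ge0// ltW.
have VQ : V m%:R <= Q.
  by rewrite (@le_trans _ _ (V m%:R / sg))// ?lerDl// ler_peMr// invf_ge1.
pose A := Q / e + 1.
have A1 : 1 <= A by rewrite lerDr divr_ge0// ltW.
have A0 : 0 < A by exact: lt_le_trans A1.
have QA : Q / A ^+ 2 <= e.
  rewrite ler_pdivrMr ?exprn_gt0// mulrC -ler_pdivrMr//.
  apply: (@le_trans _ _ A); first by rewrite lerDl.
  by rewrite expr2 ler_peMr// ltW.
exists A => //.
have H := @near_ord j.+1 (fun i n => \sum_(k < gK n i.+1) (h n * c k) ^+ 2 <= Q).
near=> n.
have hn : forall i, (i < j.+1)%N -> \sum_(k < gK n i.+1) (h n * c k) ^+ 2 <= Q.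
  near: n; apply: H => i ij.
  have e1 : 0 < sg by [].
  have := @gcV i.+1 => /cvgrPdist_le/(_ _ e1); apply: filterS => n.
  rewrite ler_norml => /andP[h2 _]; have := Vj i.+1 ij; rewrite /Q => h1.
  rewrite -(ler_pM2l sg0) mulrDr mulr1 mulrCA divff ?gt_eqF// mulr1; lra.
move=> i; have [bxi hxi] := incr2 Fsub Fmono hD adL LS h n (gK_step n i); split.
  apply: (le_trans _ QA).
  have mA : measurable [set w | A < `|xi n i w|].
    have mn : measurable_fun setT (fun w => `|xi n i w|).
      by apply: measurableT_comp => //; exact: mxi.
    have := mn measurableT _ (measurable_itv `]A, +oo[); rewrite setTI.
    by congr measurable; apply/seteqP; split => x /=; rewrite in_itv/= andbT.
  rewrite ler_pdivlMr ?exprn_gt0// -Ex_indic// mulrC -ExZ; last exact: bmf_indic.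
  apply: le_trans (le_trans hxi (hn i (ltn_ord i))).
  apply: le_Ex => [||w].
  - by apply: bmfZ; exact: bmf_indic.
  - exact: bmfX.
  - rewrite indicE; case: (boolP (w \in _)) => [/set_mem/= he|_].
      rewrite mulr1 -[leRHS]real_normK ?num_real// lerXn2r ?nnegrE ?(ltW A0)//.
      exact: ltW.
    by rewrite mulr0 sqr_ge0.
have := gV_alt; case=> [VS|V00].
  have g0 : 0 <= gV i.+1 - gV i by rewrite subr_ge0 ltW.
  have := gauss_tail g0 (W_gauss_incr hW (gV0 i) (VS i)) A0; move/le_trans; apply.
  apply: (le_trans _ QA); rewrite ler_wpM2r ?invr_ge0 ?exprn_ge0 ?(ltW A0)//.
  have := Vj i.+1 (ltn_ord i); have := gV0 i; lra.
rewrite (_ : [set w | _] = set0) ?measure0 ?ltW//.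
by apply/seteqP; split => w //=; rewrite /ze !V00 subrr normr0 ltNge ltW.
Unshelve. all: by end_near. Qed.

Section functional.
Variables (F : (R -> R) -> R) (M : R).
Hypothesis FM : forall x, cadlag x -> `|F x| <= M.

Lemma lip_Gpath : lip_bdd M (m%:R * j.+1%:R) (fun x => Gfun F m (ppath x)).
Proof.
split; first by move=> x; apply: Gfun_bound => //; exact: ppath_cadlag.
move=> x y e hxy; rewrite -mulrA; apply: (Gfun_lip FM).
- exact: ppath_cadlag.
- exact: ppath_cadlag.
- by rewrite mulr_ge0//; exact: le_trans (hxy ord0).
- by move=> t _; rewrite /ppath !mul1r; exact: pval_lip.
Qed.

Lemma fdd_functional : E (fun w => Gfun F m (ppath ((xi n)^~ w))) @[n --> \oo] -->
  E' (fun w => Gfun F m (ppath (ze^~ w))).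
Proof.
apply: (cvg_lip_bdd lip_Gpath) => [n i|i||f hf].
- exact: mxi.
- exact: mze.
- exact: tail_xi_ze.
pose f' i := f (inord i : 'I_j.+1).
have hf' i : exists C f1 f2, Tay C (f' i) f1 f2 by exact: hf.
have := @fdd_cvg _ _ _ P Fg Fsub Fmono D v L c hD adL LS sg sg01 _ _ P' W hW h gK gV gK_step
  gV_step (fun i => @gcV i) (fun i => @gce i) (fun i => @gc3 i) f' j.+1 hf'.
have := @fdd_brownian _ _ _ P' W hW gV (lexx 0) gV_step f' j.+1 hf' gV_alt.
move=> <-.
have e1 (i : 'I_j.+1) : f' i = f i by rewrite /f' inord_val.
under eq_cvg => n.
  under eq_Ex => w do under eq_bigr => i _ do rewrite e1.
  over.
rewrite (_ : Ex P' (fun w => \prod_(i < j.+1) f' i _) = Ex P' (fun w => \prod_(i < j.+1) f i (ze i w)))//.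
by apply: eq_Ex => w; apply: eq_bigr => i _; rewrite e1.
Qed.

End functional.
End grid.

(** The exceptional set has two pieces: [BA], where the martingale leaves [-A, A] and the factor
    [b n t - 1] cannot be neglected, and [BB], where it oscillates too much within one block. The
    latter is a union of [j] events of probability of order 1/j^2. *)
Lemma osc (m : nat) (eta e : R) : (0 < m)%N -> 0 < eta -> 0 < e ->
  \forall j \near \oo, (0 < j)%N -> \forall n \near \oo, exists B,
  [/\ measurable B, fine (P B) <= e & forall w, ~ B w -> forall t, 0 <= t <= m%:R ->
     `|preX n w t - ppath m (xi m n (j := j) ^~ w) t| <= eta].
Proof.
move=> m0 eta0 e0; have [sg0 sg1] := andP sg01.
have [Lp Lp0 hLp] := Vlip m%:R.
have mR : (0 : R) < m%:R by rewrite ltr0n.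
(* A block of length m/j has limiting sum of squares at most Lp m / (sg j); the added 1 leaves room
   1/j for the convergence in [n]. *)
pose q := Lp * m%:R / sg + 1.
have q0 : 0 < q by rewrite ltr_wpDl// divr_ge0 ?mulr_ge0 ?(ltW sg0)// ltW.
pose Q := V m%:R / sg + 1.
have Q0 : 0 < Q by rewrite ltr_wpDl// divr_ge0 ?(ltW sg0)// V_ge0.
pose A := 22 * Q ^+ 2 / e + 1.
have A1 : 1 <= A by rewrite lerDr divr_ge0 ?(ltW e0)// mulr_ge0// sqr_ge0.
have A0 : 0 < A by exact: lt_le_trans A1.
have QA : 11 * Q ^+ 2 / A ^+ 4 <= e / 2.
  rewrite ler_pdivrMr ?exprn_gt0//.
  have AA : A <= A ^+ 4 by rewrite -{1}[A]expr1 ler_weXn2l.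
  have : 22 * Q ^+ 2 / e <= A ^+ 4 by apply: le_trans AA; rewrite /A lerDl.
  rewrite ler_pdivrMr//; lra.
(* Three errors share [eta]: the factor [b n t - 1], the oscillation within a block, and the initial
   value of the martingale. *)
pose eta4 := eta / 4; have eta40 : 0 < eta4 by rewrite divr_gt0.
pose Z := 11 / eta4 ^+ 4 * q ^+ 2.
have Z0 : 0 <= Z by rewrite mulr_ge0 ?sqr_ge0// divr_ge0// exprn_ge0// ltW.
near=> j => j0.
have jR : (0 : R) < j%:R by rewrite ltr0n.
have jZ : j%:R * (11 * (q / j%:R) ^+ 2 / eta4 ^+ 4) <= e / 2.
  rewrite (_ : _ * _ = Z / j%:R); last first.
    by rewrite /Z; field; rewrite !gt_eqF.
  rewrite ler_pdivrMr// mulrC -ler_pdivrMr; last by rewrite divr_gt0.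
  by near: j; exact: nbhs_infty_ger.
have hb1 : \forall n \near \oo, \sum_(k < kap n m%:R) (h n * c k) ^+ 2 <= Q.
  have := @cV m%:R (ltW mR) => /cvgrPdist_le/(_ _ sg0); apply: filterS => n.
  rewrite ler_norml => /andP[h2 _].
  by rewrite -(ler_pM2l sg0) /Q mulrDr mulr1 mulrCA divff ?gt_eqF// mulr1; lra.
have hb2 : \forall n \near \oo, forall i, (i < j)%N ->
    \sum_(k < kap n (gridt m j i.+1)) (h n * c k) ^+ 2 -
    \sum_(k < kap n (gridt m j i)) (h n * c k) ^+ 2 <= q / j%:R.
  apply: near_ord => i ij.
  have g0 k : 0 <= gridt m j k by exact: gridt_ge0.
  have gm k : (k <= j)%N -> gridt m j k <= m%:R.
    move=> kj; rewrite -[leRHS](gridt_j m j0) /gridt.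
    by apply: ler_wpM2r; [rewrite divr_ge0|rewrite ler_nat].
  have sj : 0 < sg / j%:R by rewrite divr_gt0.
  have hc : sg * \sum_(k < kap n (gridt m j i.+1)) (h n * c k) ^+ 2 -
      sg * \sum_(k < kap n (gridt m j i)) (h n * c k) ^+ 2 @[n --> \oo] -->
      V (gridt m j i.+1) - V (gridt m j i) by apply: cvgB; exact: cV.
  move/cvgrPdist_le: hc => /(_ _ sj); apply: filterS => n.
  rewrite ler_norml => /andP[h2 _].
  have h3 : V (gridt m j i.+1) - V (gridt m j i) <= Lp * (m%:R / j%:R).
    apply: le_trans (ler_norm _) _; apply: le_trans (hLp _ _ _ _) _.
    - by rewrite g0 gm.
    - by rewrite g0 gm// ltnW.
    - rewrite ler_wpM2l// /gridt -mulrBl -natrB// subSnn mul1r ger0_norm//.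
  rewrite -(ler_pM2l sg0) mulrBr.
  have -> : sg * (q / j%:R) = Lp * (m%:R / j%:R) + sg / j%:R.
    by rewrite /q; field; rewrite !gt_eqF.
  lra.
have eA : 0 < eta4 / (A + 1) by rewrite divr_gt0// ltr_wpDl// ltW.
have hb3 := b_cvg m%:R eA.
have hb4 : \forall n \near \oo, `|h n| * `|B0| <= Num.min 1 eta4.
  have hc : `|h n| * `|B0| @[n --> \oo] --> (0 : R).
    rewrite -[X in _ --> X](mul0r `|B0|); apply: cvgM; last exact: cvg_cst.
    by rewrite -[X in _ --> X](@normr0 R R); apply: cvg_norm.
  have m1 : 0 < Num.min 1 eta4 by rewrite lt_min ltr01.
  move/cvgrPdist_le: hc => /(_ _ m1); apply: filterS => n.
  by rewrite sub0r normrN ger0_norm// mulr_ge0.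
near=> n.
have n0 : (0 < n)%N by near: n; exact: nbhs_infty_gt.
have nb1 : \sum_(k < kap n m%:R) (h n * c k) ^+ 2 <= Q by near: n.
have nb2 : forall i, (i < j)%N ->
    \sum_(k < kap n (gridt m j i.+1)) (h n * c k) ^+ 2 -
    \sum_(k < kap n (gridt m j i)) (h n * c k) ^+ 2 <= q / j%:R by near: n.
have nb3 : forall t, 0 <= t <= m%:R -> `|b n t - 1| <= eta4 / (A + 1) by near: n.
have nb4 : `|h n| * `|B0| <= Num.min 1 eta4 by near: n.
have [BA [mBA pBA hBA]] := maximal Fsub Fmono hD (fun k => @adp_scaled _ _ _ _ _ adL h n k)
   (fun k w => step_scaled LS h n k w) 0 (kap n m%:R) A0.
have [BB [mBB pBB hBB]] : exists B, [/\ measurable B,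
    fine (P B) <= j%:R * (11 * (q / j%:R) ^+ 2 / eta4 ^+ 4) &
    forall w, ~ B w -> forall i, (i < j)%N -> forall k,
    (kap n (gridt m j i) <= k <= kap n (gridt m j i.+1))%N ->
    `|h n * L k w - h n * L (kap n (gridt m j i)) w| <= eta4].
  apply: union_bad => i ij.
  have kk : (kap n (gridt m j i) <= kap n (gridt m j i.+1))%N.
    apply: kap_mono; first exact: gridt_ge0.
    by rewrite /gridt; apply: ler_wpM2r; [rewrite divr_ge0|rewrite ler_nat].
  have [B [mB pB hB]] := maximal Fsub Fmono hD (fun k => @adp_scaled _ _ _ _ _ adL h n k)
   (fun k w => step_scaled LS h n k w) (kap n (gridt m j i))
   (kap n (gridt m j i.+1) - kap n (gridt m j i)) eta40.
  exists B; split => //.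
    apply: (le_trans pB); rewrite (block_sum (fun k => (h n * c k) ^+ 2) kk).
    apply: ler_wpM2r; first by rewrite invr_ge0 exprn_ge0// ltW.
    apply: ler_wpM2l => //; rewrite lerXn2r ?nnegrE ?nb2//.
      rewrite -(block_sum (fun k => (h n * c k) ^+ 2) kk).
      by rewrite sumr_ge0// => k _; rewrite sqr_ge0.
    by rewrite divr_ge0// ltW.
  move=> w nB k /andP[k1 k2].
  by have := hB w nB (k - kap n (gridt m j i))%N; rewrite subnKC//; apply; rewrite leq_sub2r.
exists (BA `|` BB); split; first exact: measurableU.
  apply: (@le_trans _ _ (fine (P BA) + fine (P BB))).
    rewrite -fineD ?fin_num_measure//; apply: fine_le.
    - by apply: fin_num_measure; exact: measurableU.
    - by rewrite fin_numD !fin_num_measure.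
    - exact: measureU2.
  rewrite [leRHS]splitr; apply: lerD; last exact: le_trans pBB jZ.
  apply: le_trans (le_trans _ QA); first exact: pBA.
  apply: ler_wpM2r; first by rewrite invr_ge0 exprn_ge0// ltW.
  apply: ler_wpM2l => //; rewrite lerXn2r ?nnegrE ?(ltW Q0)//.
  by rewrite sumr_ge0// => k _; rewrite sqr_ge0.
move=> w /not_orP[nA nB] t tm; have /andP[t0 t1] := tm.
rewrite /preX aU//.
have [g1 g2 gj] := gidxP m0 j0 tm.
set i := gidx m j t in g1 g2 gj.
have -> : ppath m (xi m n (j := j) ^~ w) t = h n * L (kap n (gridt m j i)) w - h n * L 0%N w.
  rewrite /ppath mul1r -/i.
  exact: (@pval_tel j (fun k => h n * L (gK m j n k) w) i gj).
set k := kap n t.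
have km : (k <= kap n m%:R)%N by exact: kap_mono.
have M0 : `|h n * L 0%N w| <= Num.min 1 eta4.
  rewrite normrM; apply: le_trans nb4; rewrite ler_wpM2l//.
  by apply: le_trans (L0B w) _; exact: ler_norm.
move: M0; rewrite le_min => /andP[M01 M0e].
have hA : `|h n * L k w - h n * L 0%N w| <= A by have := hBA w nA k km; rewrite add0n.
have hB : `|h n * L k w - h n * L (kap n (gridt m j i)) w| <= eta4.
  (* The last index [j] has no block to its right; it occurs only for [t = m], where the oscillation
     is 0. *)
  move: gj; rewrite leq_eqVlt => /orP[/eqP ij|ij].
    have e1 : t = gridt m j i.
      apply/eqP; rewrite eq_le g1 andbT.
      by rewrite ij gridt_j.
    by rewrite /k -e1 subrr normr0 ltW.
  apply: (hBB w nB i ij); apply/andP; split; apply: kap_mono => //.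
  - exact: gridt_ge0.
  - exact: ltW.
have hAk : `|h n * L k w| <= A + 1.
  rewrite (_ : h n * L k w = (h n * L k w - h n * L 0%N w) + h n * L 0%N w); last by ring.
  by rewrite (le_trans (ler_normD _ _))// lerD.
have hbt := nb3 t tm.
have hbt2 : `|(b n t - 1) * (h n * L k w)| <= eta4.
  have A2 : A + 1 != 0 by rewrite gt_eqF// addr_gt0.
  by rewrite normrM (le_trans (ler_pM _ _ hbt hAk))// divfK.
rewrite (_ : b n t * (h n * L k w) - (_ - _) = (b n t - 1) * (h n * L k w) +
  (h n * L k w - h n * L (kap n (gridt m j i)) w) + h n * L 0%N w); last by ring.
rewrite (le_trans (ler_normD _ _))// (le_trans (lerD (ler_normD _ _) (lexx _)))//.
rewrite /eta4 in hB hbt2 M0e *; lra.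
Unshelve. all: by end_near. Qed.

Section functional2.
Variables (F : (R -> R) -> R) (M : R).
Hypothesis FM : forall x, cadlag x -> `|F x| <= M.
Hypothesis Fc : skorohod_continuous F.

(** [F] is a limit of the functionals [Gfun F m], and along a step path each of these is a Lipschitz
    function of the finitely many variables [U 0], ..., [U (kap n m%:R)], hence measurable. *)
Lemma bmf_preX n : (0 < n)%N -> bmf (fun w => F (preX n w)).
Proof.
move=> n0; have [ea sa] := cad_a n0.
apply: (@Ex_bounded_cvg _ _ _ P (fun m w => Gfun F m (preX n w)) _ M _ _ _).1.
- move=> m; have [B B0' hB] := bnd_a n m.
  pose l := (kap n m%:R).
  pose G (y : 'I_l.+1 -> R) := Gfun F m (fun t => a n t * (fun k => y (inord k)) (kap n t)).
  have cG (y : 'I_l.+1 -> R) : cadlag (fun t => a n t * (fun k => y (inord k)) (kap n t)).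
    exact: (@cadlag_step _ (a n) (kap n) (fun k => y (inord k)) ea sa).
  have lG : lip_bdd M (m%:R * B) G.
    split; first by move=> y; exact: (Gfun_bound FM).
    move=> x y e hxy; have e0' : 0 <= e by exact: le_trans (hxy ord0).
    rewrite -mulrA; apply: (Gfun_lip FM); [exact: cG|exact: cG|by rewrite mulr_ge0|].
    move=> t tm; rewrite -mulrBr normrM ler_pM//; exact: hB.
  have -> : (fun w => Gfun F m (preX n w)) = (fun w => G (fun i => U i w)).
    apply/funext => w; apply/eqP; rewrite -subr_eq0 -normr_eq0 eq_le normr_ge0 andbT.
    rewrite -(mulr0 m%:R); apply: (Gfun_lip FM); [exact: preX_cadlag|exact: (cG (fun i : 'I_l.+1 => U i w))|exact: lexx|].
    move=> t /andP[t0 tm].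
    by rewrite /preX inordK ?subrr ?normr0// ltnS kap_mono.
  by apply: bmf_meas; exact: (lip_bdd_bmf lG (fun i => mU i)).
- by move=> m w; apply: (Gfun_bound FM); exact: preX_cadlag.
- by move=> w; apply: (Gfun_cvg FM) => //; exact: preX_cadlag.
Qed.

Lemma limX_cadlag w : cadlag (limX w).
Proof. by apply: econt_cadlag; exact: limX_econt. Qed.

Lemma ppath_ze m j w t : (0 < m)%N -> (0 < j)%N -> 0 <= t <= m%:R ->
  ppath m (ze m (j := j) ^~ w) t = limX w (gridt m j (gidx m j t)).
Proof.
move=> m0 j0 tm; have [_ _ gj] := gidxP m0 j0 tm.
rewrite /ppath mul1r (@pval_tel j (fun k => W (gV m j k) w) _ gj)/= W0 subr0//.
Qed.

(** A path of the limit is uniformly continuous on [0, m], so its grid approximations converge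
    uniformly there and bounded convergence applies. *)
Lemma Gfun_grid m : (0 < m)%N ->
  bmf (fun w => Gfun F m (limX w)) /\
  E' (fun w => Gfun F m (ppath m (ze m (j := j.+1) ^~ w))) @[j --> \oo] -->
  E' (fun w => Gfun F m (limX w)).
Proof.
move=> m0; apply: (@Ex_bounded_cvg _ _ _ P' _ _ M).
- by move=> j; apply: bmf_meas; apply: (lip_bdd_bmf (lip_Gpath m0 (ltn0Sn j) FM)) => i; exact: mze.
- by move=> j w; apply: (Gfun_bound FM); exact: ppath_cadlag.
move=> w; apply/cvgrPdist_le => e e0.
have mR : (0 : R) < m%:R by rewrite ltr0n.
have em : 0 < e / m%:R by rewrite divr_gt0.
have [r r0 hr] := econt_uniform m%:R (limX_econt w) em.
near=> j.
have hj : m%:R / j.+1%:R <= r.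
  rewrite ler_pdivrMr// mulrC -ler_pdivrMr//.
  apply: (@le_trans _ _ j%:R); last by rewrite ler_nat.
  by near: j; exact: nbhs_infty_ger.
rewrite -[leRHS](@divfK _ m%:R) ?gt_eqF// mulrC; apply: (Gfun_lip FM).
- exact: limX_cadlag.
- exact: ppath_cadlag.
- exact: ltW.
- move=> t tm; rewrite ppath_ze//; apply: hr => //; first exact: gridt_ge0.
  by apply: le_trans (gidx_step m0 _ tm) hj.
Unshelve. all: by end_near. Qed.

Lemma Gfun_limX : bmf (fun w => F (limX w)) /\
  E' (fun w => Gfun F m.+1 (limX w)) @[m --> \oo] --> E' (fun w => F (limX w)).
Proof.
apply: (@Ex_bounded_cvg _ _ _ P' _ _ M).
- by move=> m; apply: bmf_meas; exact: (Gfun_grid (ltn0Sn m)).1.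
- by move=> m w; apply: (Gfun_bound FM); exact: limX_cadlag.
- move=> w; have := Gfun_cvg FM Fc (limX_cadlag w).
  by rewrite -(cvg_shiftS (fun m => Gfun F m (limX w))).
Qed.

(** The order of choice is essential: first [m], making [Gfun F m] close to [F] in mean under the
    limit law, then the grid size, then [n]. On the prelimit side only [Gfun F m <= F] is available,
    which is why the bound is one-sided. *)
Lemma fclt_lower (e : R) : 0 < e -> \forall n \near \oo,
  E' (fun w => F (limX w)) - e <= E (fun w => F (preX n w)).
Proof.
move=> e0; have e8 : 0 < e / 8 by rewrite divr_gt0.
have M0 : 0 <= M by rewrite (le_trans _ (FM (limX_cadlag point))).
have [bF cF] := Gfun_limX.
near \oo => m1.
have h1 : `|E' (fun w => F (limX w)) - E' (fun w => Gfun F m1.+1 (limX w))| <= e / 8.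
  by near: m1; move/cvgrPdist_le: cF; exact.
move: h1; move: (m1.+1) (ltn0Sn m1) => m m0 h1.
have mR : (0 : R) < m%:R by rewrite ltr0n.
have [bG cG] := Gfun_grid m0.
pose eta := e / 8 / m%:R; have eta0 : 0 < eta by rewrite divr_gt0.
pose p := e / 8 / (2 * M + 1).
have M1 : 0 < 2 * M + 1 by rewrite ltr_wpDl// mulr_ge0.
have p0 : 0 < p by rewrite divr_gt0.
have hosc := osc m0 eta0 p0.
near \oo => j1.
have h2 : `|E' (fun w => Gfun F m (limX w)) - E' (fun w => Gfun F m (ppath m (ze m (j := j1.+1) ^~ w)))| <= e / 8.
  by near: j1; move/cvgrPdist_le: cG; exact.
have hj : (0 < j1.+1)%N -> \forall n \near \oo, exists B,
  [/\ measurable B, fine (P B) <= p & forall w, ~ B w -> forall t, 0 <= t <= m%:R ->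
     `|preX n w t - ppath m (xi m n (j := j1.+1) ^~ w) t| <= eta].
  near: j1.
  case: hosc => N _ hN; exists N => // j1 Nj; apply: hN; exact: leq_trans Nj _.
have {}hj := hj (ltn0Sn j1).
move: h2 hj; move: (j1.+1) (ltn0Sn j1) => j j0 h2 hj.
have hfdd := fdd_functional m0 j0 FM.
near=> n.
have n0 : (0 < n)%N by near: n; exact: nbhs_infty_gt.
have h3 : `|E' (fun w => Gfun F m (ppath m (ze m (j := j) ^~ w))) -
   E (fun w => Gfun F m (ppath m (xi m n (j := j) ^~ w)))| <= e / 8.
  by near: n; move/cvgrPdist_le: hfdd; exact.
have [B [mB pB hB]] : exists B,
  [/\ measurable B, fine (P B) <= p & forall w, ~ B w -> forall t, 0 <= t <= m%:R ->
     `|preX n w t - ppath m (xi m n (j := j) ^~ w) t| <= eta] by near: n.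
have bx : bmf (fun w => Gfun F m (ppath m (xi m n (j := j) ^~ w))).
  by apply: (lip_bdd_bmf (lip_Gpath m0 j0 FM)) => i; exact: mxi.
have bB : bmf (fun w => \1_B w : R) by exact: bmf_indic.
have h4 : E (fun w => Gfun F m (ppath m (xi m n (j := j) ^~ w)) - (e / 8 + 2 * M * \1_B w)) <=
    E (fun w => F (preX n w)).
  apply: le_Ex => [||w].
  - by apply: bmfB => //; apply: bmfD; [exact: bmf_cst|exact: bmfZ].
  - exact: bmf_preX.
  - have cX := preX_cadlag w n0.
    have cP : cadlag (ppath m (xi m n (j := j) ^~ w)) by exact: ppath_cadlag.
    rewrite indicE; case: (boolP (w \in B)) => [_|/negP nB].
      rewrite mulr1; have := Gfun_bound FM m cP; have := FM cX; rewrite !ler_norml; lra.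
    rewrite mulr0 addr0 lerBlDr; apply: le_trans (_ : Gfun F m (preX n w) + e / 8 <= _).
      have -> : e / 8 = m%:R * eta by rewrite /eta; field; rewrite gt_eqF.
      apply: (Gfun_shift FM) => //; first exact: ltW.
      by move=> t tm; apply: hB => // /mem_set.
    by rewrite lerD2r (Gfun_le FM).
move: h4; rewrite ExB//; last by apply: bmfD; [exact: bmf_cst|exact: bmfZ].
rewrite ExD; [|exact: bmf_cst|exact: bmfZ].
rewrite Ex_cst ExZ// Ex_indic//.
have h5 : 2 * M * fine (P B) <= e / 8.
  apply: (@le_trans _ _ ((2 * M + 1) * p)); last by rewrite /p mulrCA divff ?mulr1// gt_eqF.
  apply: ler_pM => //; first by rewrite mulr_ge0.
    by rewrite fine_ge0.
  by rewrite lerDl.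
move: h1 h2 h3; rewrite !ler_norml; lra.
Unshelve. all: by end_near. Qed.

End functional2.

Theorem fclt : cvg_dist_skorohod P P' preX limX.
Proof.
move=> F [M FM] Fc.
have FMN x : cadlag x -> `|- F x| <= M by move=> cx; rewrite normrN; exact: FM.
have FcN : skorohod_continuous (fun x => - F x).
  by move=> xs x cxs cx hx; apply: cvgN; exact: Fc.
have [bF _] := Gfun_limX FM Fc.
rewrite (ExE P' bF).
apply: (@cvg_trans _ ((Ex P (fun w => F (preX n w)))%:E @[n --> \oo])).
  apply: near_eq_cvg; near=> n; rewrite ExE//; apply: bmf_preX FM Fc _ _.
  by near: n; exact: nbhs_infty_gt.
apply: cvg_EFin; first exact: nearW.
apply/cvgrPdist_le => e e0.
have h1 := fclt_lower FM Fc e0; have h2 := fclt_lower FMN FcN e0.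
near=> n.
have n0 : (0 < n)%N by near: n; exact: nbhs_infty_gt.
have H1 : E' (fun w => F (limX w)) - e <= E (fun w => F (preX n w)) by near: n.
have H2 : E' (fun w => - F (limX w)) - e <= E (fun w => - F (preX n w)) by near: n.
rewrite (ExN P' bF) (ExN P (bmf_preX FM Fc n0)) in H2.
rewrite /= ler_norml; apply/andP; split; lra.
Unshelve. all: by end_near. Qed.

End fclt.

(** * Deterministic asymptotics of the step sizes *)

Section recursions.
Context {R : realType}.
Implicit Types (x y r : nat -> R).

(** Once the forcing is below [e / 2 * th], the excess of [x] over e/2 contracts by exp(- th r_n) at
    each step, and divergence of the sum of [r] drives it to 0. *)
Lemma contraction_cvg0 x r (eps : nat -> R) (th : R) :
  0 < th -> (forall n, 0 <= x n) -> (forall n, 0 <= r n) ->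
  (forall A : R, exists n, A <= \sum_(k < n) r k) ->
  eps n @[n --> \oo] --> (0 : R) -> r n @[n --> \oo] --> (0 : R) ->
  (\forall n \near \oo, x n.+1 <= (1 - th * r n) * x n + eps n * r n) ->
  x n @[n --> \oo] --> (0 : R).
Proof.
move=> th0 x0 r0 rS ce cr hx; apply/cvgrPdist_le => e e0.
have e1 : 0 < e / 2 * th by rewrite mulr_gt0// divr_gt0.
have th1 : 0 < th^-1 by rewrite invr_gt0.
have [N hN] : exists N, forall n, (N <= n)%N ->
    [/\ x n.+1 <= (1 - th * r n) * x n + eps n * r n, eps n <= e / 2 * th & th * r n <= 1].
  have : \forall n \near \oo, [/\ x n.+1 <= (1 - th * r n) * x n + eps n * r n, eps n <= e / 2 * th & th * r n <= 1].
    near=> n; split; first by near: n.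
      have : `|0 - eps n| <= e / 2 * th by near: n; move/cvgrPdist_le: ce; exact.
      by rewrite sub0r normrN; apply: le_trans; exact: ler_norm.
    have : `|0 - r n| <= th^-1 by near: n; move/cvgrPdist_le: cr; exact.
    rewrite sub0r normrN ger0_norm// => h.
    by rewrite mulrC -ler_pdivlMr// mul1r.
  by case=> N _ hN; exists N => n Nn; exact: hN.
pose p n := Num.max 0 (x n - e / 2).
have p0 n : 0 <= p n by rewrite le_max lexx.
have pS n : (N <= n)%N -> p n.+1 <= expR (- (th * r n)) * p n.
  move=> Nn; have [h1 h2 h3] := hN n Nn.
  apply: (@le_trans _ _ ((1 - th * r n) * p n)); last first.
    by apply: ler_wpM2r => //; have := expR_ge1Dx (- (th * r n)); lra.
  rewrite {1}/p ge_max; apply/andP; split; first by rewrite mulr_ge0// subr_ge0.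
  apply: (@le_trans _ _ ((1 - th * r n) * (x n - e / 2))); last first.
    by apply: ler_wpM2l; [rewrite subr_ge0|rewrite /p le_max lexx orbT].
  have := ler_wpM2r (r0 n) h2; lra.
have pN k : p (N + k)%N <= expR (- (th * \sum_(i < k) r (N + i)%N)) * p N.
  elim: k => [|k IH]; first by rewrite big_ord0 mulr0 oppr0 expR0 mul1r addn0.
  rewrite addnS (le_trans (pS _ (leq_addr _ _)))// big_ord_recr/=.
  rewrite (_ : - (th * (_ + _)) = - (th * r (N + k)%N) + - (th * \sum_(i < k) r (N + i)%N)); last by ring.
  rewrite expRD -mulrA.
  by apply: ler_wpM2l => //; exact: expR_ge0.
(* Since y <= exp y, an accumulated exponent of 2 p_N / e already reduces the excess p_N to e/2. *)
have [n0 hn0] := rS (\sum_(k < N) r k + 2 * p N / e / th).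
exists (maxn N n0) => // n /=; rewrite geq_max => /andP[Nn n0n].
rewrite sub0r normrN ger0_norm//.
have xp : x n <= p n + e / 2 by rewrite -lerBlDr /p le_max lexx orbT.
suff : p n <= e / 2 by lra.
have mono m1 m2 : (m1 <= m2)%N -> \sum_(k < m1) r k <= \sum_(k < m2) r k.
  move=> /subnKC <-; elim: (m2 - m1)%N => [|j IH]; first by rewrite addn0.
  by rewrite addnS big_ord_recr/= (le_trans IH)// lerDl.
have hs : 2 * p N / e <= th * \sum_(i < n - N) r (N + i)%N.
  rewrite block_sum// [leRHS]mulrC -ler_pdivrMr// lerBrDl (le_trans hn0)//; exact: mono.
have := pN (n - N)%N; rewrite subnKC// => h; apply: (le_trans h).
set y := th * _ in hs *.
have y0 : 0 <= 2 * p N / e by rewrite divr_ge0 ?mulr_ge0// ltW.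
rewrite expRN mulrC ler_pdivrMr ?expR_gt0//.
have hy : y <= expR y by have := expR_ge1Dx y; lra.
rewrite (le_trans _ (ler_wpM2l _ (le_trans hs hy)))//; last by rewrite divr_ge0// ltW.
by rewrite le_eqVlt; apply/orP; left; apply/eqP; field; rewrite gt_eqF.
Unshelve. all: by end_near. Qed.

(** The distance to the fixed point be/th contracts at rate th/2 eventually, with forcing
    [|bn n - tn n * l|], which vanishes in the limit. *)
Lemma recursion_cvg y r (tn bn : nat -> R) (th be : R) :
  0 < th -> (forall n, 0 <= r n) ->
  (forall A : R, exists n, A <= \sum_(k < n) r k) ->
  r n @[n --> \oo] --> (0 : R) -> tn n @[n --> \oo] --> th -> bn n @[n --> \oo] --> be ->
  (\forall n \near \oo, y n.+1 = (1 - tn n * r n) * y n + bn n * r n) ->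
  y n @[n --> \oo] --> be / th.
Proof.
move=> th0 r0 rS cr ct cb hy.
pose l := be / th.
have th2 : 0 < th / 2 by rewrite divr_gt0.
have c0 : `|y n - l| @[n --> \oo] --> (0 : R).
  apply: (@contraction_cvg0 _ r (fun n => `|bn n - tn n * l|) (th / 2)) => //.
    have : `|bn n - tn n * l| @[n --> \oo] --> `|be - th * l|.
      by apply: cvg_norm; apply: cvgB => //; apply: cvgM => //; exact: cvg_cst.
    by rewrite (_ : be - th * l = 0) ?normr0// /l mulrCA divff ?mulr1 ?subrr// gt_eqF.
  near=> n.
  have -> : y n.+1 = (1 - tn n * r n) * y n + bn n * r n by near: n.
  have h1 : `|th - tn n| <= th / 2 by near: n; move/cvgrPdist_le: ct; exact.
  have th20 : 0 < (2 * th)^-1 by rewrite invr_gt0 mulr_gt0.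
  have h2 : r n <= (2 * th)^-1.
    have : `|0 - r n| <= (2 * th)^-1.
      by near: n; move/cvgrPdist_le: cr; apply; rewrite invr_gt0 mulr_gt0.
    by rewrite sub0r normrN ger0_norm.
  move: h1; rewrite ler_norml => /andP[h1 h1'].
  have t0 : 0 <= tn n by lra.
  have h3 : tn n * r n <= 1.
    apply: (@le_trans _ _ (2 * th * (2 * th)^-1)); last by rewrite divff// gt_eqF// mulr_gt0.
    by apply: ler_pM => //; lra.
  rewrite (_ : _ - l = (1 - tn n * r n) * (y n - l) + (bn n - tn n * l) * r n); last by ring.
  rewrite (le_trans (ler_normD _ _))// !normrM (ger0_norm (r0 n)) lerD2r.
  rewrite ger0_norm ?subr_ge0//; apply: ler_wpM2r => //.
  by rewrite lerD2l lerN2; apply: ler_wpM2r => //; lra.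
apply/cvgrPdist_le => e e0; have /cvgrPdist_le/(_ e e0) := c0.
by apply: filterS => n; rewrite sub0r normrN normr_id distrC.
Unshelve. all: by end_near. Qed.

(** Multiplies the bounds exp(- x / (1 - x)) <= 1 - x <= exp(- x); [dd] is the increment of the
    deterministic clock against which [x] is compared. *)
Lemma prod_clock (x dd : nat -> R) (lam ep : R) n k :
  (forall i, (n <= i < k)%N -> [/\ 0 <= x i, x i < 1, (lam - ep) * dd i <= x i &
     x i / (1 - x i) <= (lam + ep) * dd i]) ->
  expR (- ((lam + ep) * \sum_(n <= i < k) dd i)) <= \prod_(n <= i < k) (1 - x i) <=
  expR (- ((lam - ep) * \sum_(n <= i < k) dd i)).
Proof.
have [nk|kn] := leqP n k; last first.
  by move=> _; rewrite !big_geq ?(ltnW kn)// !mulr0 oppr0 expR0 lexx.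
move: nk => /subnKC; move: (k - n)%N => j <- {k}.
elim: j => [|j IH] h.
  by rewrite addn0 !big_geq// !mulr0 oppr0 expR0 lexx.
have /IH/andP[l1 l2] : forall i, (n <= i < n + j)%N -> [/\ 0 <= x i, x i < 1,
    (lam - ep) * dd i <= x i & x i / (1 - x i) <= (lam + ep) * dd i].
  by move=> i /andP[ni ij]; apply: h; rewrite ni/= addnS ltnS ltnW.
rewrite addnS !big_nat_recr ?leq_addr//=.
rewrite (mulrDr (lam + ep)) (mulrDr (lam - ep)) !opprD !expRD.
have nj : (n <= n + j < n + j.+1)%N by rewrite leq_addr addnS ltnS leqnn.
have [x0 x1 h1 h2] := h (n + j)%N nj.
apply/andP; split; apply: ler_pM; rewrite ?expR_ge0//.
- apply: (@le_trans _ _ (expR (- (x (n + j)%N / (1 - x (n + j)%N))))); first by rewrite ler_expR lerN2.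
  rewrite expRN -[leRHS]invrK lef_pV2 ?posrE ?expR_gt0 ?invr_gt0 ?subr_gt0//.
  apply: le_trans (expR_ge1Dx _); rewrite le_eqVlt; apply/orP; left; apply/eqP.
  by field; rewrite gt_eqF// subr_gt0.
- by apply: le_trans l1; exact: expR_ge0.
- by rewrite subr_ge0 ltW.
- apply: (@le_trans _ _ (expR (- x (n + j)%N))); last by rewrite ler_expR lerN2.
  by have := expR_ge1Dx (- x (n + j)%N); lra.
Qed.

End recursions.

(** * Rescaled sums of powers of the martingale coefficients *)

Section step_sizes.
Context {R : realType}.
Variables (gamma c b : R) (r : nat -> R).
Hypothesis g01 : 0 < gamma <= 1.
Hypothesis c0 : 0 < c.
Hypothesis b01 : 0 < b <= 1.
Hypothesis hr : forall n, 0 <= r n < 1.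
Hypothesis hc : n%:R `^ gamma * r n @[n --> \oo] --> c.

(* [cf] and [hf] are c_n / rho and the scaling of the martingale, and [kp] is the
   rescaled time kappa_n. *)
Definition Pi n : R := \prod_(k < n) (1 - b * r k).
Definition Gf n : R := n%:R `^ gamma * Pi n ^+ 2.
Definition hf n : R := n%:R `^ (gamma / 2) * Pi n.
Definition kp n (t : R) : nat := Num.truncn (n%:R + n%:R `^ gamma * t).
Definition cf k : R := r k / Pi k.+1.

Let r0 n : 0 <= r n. Proof. by case/andP: (hr n). Qed.

Lemma br_lt1 n : 0 <= b * r n < 1.
Proof.
have /andP[h1 h2] := hr n; have /andP[b0 b1] := b01.
by rewrite mulr_ge0 ?(ltW b0)//= (le_lt_trans (ler_piMl h1 b1)).
Qed.

Lemma Pi_gt0 n : 0 < Pi n.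
Proof. by apply: prodr_gt0 => k _; rewrite subr_gt0; case/andP: (br_lt1 k). Qed.

Lemma PiS n : Pi n.+1 = Pi n * (1 - b * r n).
Proof. by rewrite /Pi big_ord_recr. Qed.

Lemma npow_gt0 n (p : R) : (0 < n)%N -> 0 < n%:R `^ p.
Proof. by move=> n0; rewrite powR_gt0// ltr0n. Qed.

Lemma npow_le n (p : R) : (0 < n)%N -> p <= 1 -> n%:R `^ p <= n%:R.
Proof.
move=> n0 p1; rewrite -[leRHS]powRr1 ?ler0n//; apply: ler_powR => //.
by rewrite ler1n.
Qed.

Lemma npow_large (p A : R) : 0 < p -> \forall n \near \oo, A <= n%:R `^ p.
Proof.
move=> p0; near=> n.
have n1 : (Num.max A 1) `^ p^-1 <= n%:R by near: n; exact: nbhs_infty_ger.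
have m0 : 0 <= Num.max A 1 by rewrite le_max ler01 orbT.
apply: (@le_trans _ _ (Num.max A 1)); first by rewrite le_max lexx.
have -> : Num.max A 1 = (Num.max A 1 `^ p^-1) `^ p by rewrite -powRrM mulVf ?gt_eqF// powRr1.
by apply: ge0_ler_powR; rewrite ?nnegrE ?powR_ge0 ?(ltW p0)//.
Unshelve. all: by end_near. Qed.

Lemma npowV_cvg0 (p : R) : 0 < p -> (n%:R `^ p)^-1 @[n --> \oo] --> (0 : R).
Proof.
move=> p0; apply/cvgrPdist_le => e e0; have := npow_large e^-1 p0.
apply: filterS => n h; rewrite sub0r normrN ger0_norm ?invr_ge0 ?powR_ge0//.
have h0 : 0 < n%:R `^ p by apply: lt_le_trans h; rewrite invr_gt0.
by rewrite -[leRHS]invrK lef_pV2 ?posrE ?invr_gt0.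
Qed.

Lemma near_npow (Q : nat -> Prop) : (\forall n \near \oo, (0 < n)%N -> Q n) -> \forall n \near \oo, Q n.
Proof.
move=> h; near=> n; have : (0 < n)%N -> Q n by near: n.
by apply; near: n; exact: nbhs_infty_gt.
Unshelve. all: by end_near. Qed.

Lemma r_cvg0 : r n @[n --> \oo] --> (0 : R).
Proof.
case/andP: g01 => g0 _.
have : (n%:R `^ gamma * r n) * (n%:R `^ gamma)^-1 @[n --> \oo] --> c * 0.
  by apply: cvgM => //; exact: npowV_cvg0.
rewrite mulr0; apply: cvg_trans; apply: near_eq_cvg; apply: near_npow; apply: nearW => n n0.
by rewrite mulrAC divff ?mul1r// gt_eqF// npow_gt0.
Qed.

Lemma r_lower : \forall n \near \oo, c / 2 / n%:R <= r n.
Proof.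
have c2 : 0 < c / 2 by rewrite divr_gt0.
have /cvgrPdist_le/(_ _ c2) := hc; move=> h; apply: near_npow; apply: filterS h => n h n0.
move: h; rewrite ler_norml => /andP[_ h].
rewrite ler_pdivrMr ?ltr0n//; apply: (@le_trans _ _ (n%:R `^ gamma * r n)); first by lra.
by rewrite mulrC; apply: ler_wpM2l => //; apply: npow_le => //; case/andP: g01.
Qed.

(** As for the harmonic series: eventually r_k >= c / (2k), so each block from n to 2n contributes
    at least c/4. *)
Lemma r_sum (A : R) : exists n, A <= \sum_(k < n) r k.
Proof.
have [N _ hN] := r_lower.
pose S n := \sum_(k < n) r k.
have dbl n : (N < n)%N -> S n + c / 4 <= S (2 * n)%N.
  move=> Nn; have n0 : (0 < n)%N by exact: leq_ltn_trans Nn.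
  have nR : (0 : R) < n%:R by rewrite ltr0n.
  have nn : (n <= 2 * n)%N by rewrite mul2n -addnn leq_addr.
  rewrite -lerBrDl -(block_sum r nn).
  have -> : c / 4 = \sum_(i < 2 * n - n) c / 2 / (2 * n%:R).
    by rewrite sumr_const card_ord mul2n -addnn addnK -[RHS]mulr_natr; field; rewrite gt_eqF.
  apply: ler_sum => i _; apply: le_trans (hN _ _) => /=; last first.
    by apply: leq_trans (ltnW Nn) _; rewrite leq_addr.
  apply: ler_wpM2l; first by rewrite divr_ge0// ltW.
  rewrite lef_pV2 ?posrE ?mulr_gt0 ?ltr0n ?addn_gt0 ?n0// -natrM ler_nat.
  have := ltn_ord i; lia.
have it j : S N.+1 + j%:R * (c / 4) <= S (2 ^ j * N.+1)%N.
  elim: j => [|j IH]; first by rewrite mul0r addr0 mul1n.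
  rewrite -natr1 mulrDl mul1r addrA expnS -mulnA.
  apply: le_trans (dbl _ _); first by rewrite lerD2r.
  by rewrite (leq_trans (ltnSn N))// leq_pmull// expn_gt0.
pose j := (Num.truncn (`|A| / (c / 4))).+1.
exists (2 ^ j * N.+1)%N; apply: le_trans (it j).
have c4 : 0 < c / 4 by rewrite divr_gt0.
have S0 : 0 <= S N.+1 by apply: sumr_ge0.
have : `|A| <= j%:R * (c / 4) by rewrite -ler_pdivrMr// ltW// truncnS_gt.
have := ler_norm A; lra.
Qed.

Definition qn n : R := n.+1%:R `^ gamma / n%:R `^ gamma.

Lemma qn_itv n : (0 < n)%N -> 1 <= qn n <= 1 + n%:R^-1.
Proof.
case/andP: g01 => gam0 gam1 n0; have nR : (0 : R) < n%:R by rewrite ltr0n.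
rewrite ler_pdivlMr ?npow_gt0// mul1r; apply/andP; split.
  by apply: ge0_ler_powR; rewrite ?nnegrE ?(ltW gam0) ?ler_nat//.
rewrite ler_pdivrMr ?npow_gt0//.
have e : n.+1%:R = (1 + n%:R^-1) * n%:R :> R by rewrite -natr1; field; rewrite gt_eqF.
have i0 : (0 : R) <= n%:R^-1 by rewrite invr_ge0 ltW.
rewrite e powRM ?addr_ge0 ?(ltW nR)//; apply: ler_wpM2r; first exact: powR_ge0.
rewrite -[leRHS]powRr1 ?addr_ge0//; apply: ler_powR => //.
by rewrite lerDl.
Qed.

Lemma qn_cvg : qn n @[n --> \oo] --> (1 : R).
Proof.
apply/cvgrPdist_le => e e0; near=> n.
have n0 : (0 < n)%N by near: n; exact: nbhs_infty_gt.
have /andP[h1 h2] := qn_itv n0.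
have h3 : n%:R^-1 <= e.
  rewrite -[leRHS]invrK lef_pV2 ?posrE ?invr_gt0 ?ltr0n//.
  by near: n; exact: nbhs_infty_ger.
rewrite ler0_norm; lra.
Unshelve. all: by end_near. Qed.

Lemma n1r_cvg : n.+1%:R `^ gamma * r n @[n --> \oo] --> c.
Proof.
have : qn n * (n%:R `^ gamma * r n) @[n --> \oo] --> 1 * c by apply: cvgM => //; exact: qn_cvg.
rewrite mul1r; apply: cvg_trans; apply: near_eq_cvg; apply: near_npow; apply: nearW => n n0.
by rewrite /qn mulrA divfK// gt_eqF// npow_gt0.
Qed.

Lemma r_gt0 : \forall n \near \oo, 0 < r n.
Proof.
apply: near_npow; apply: filterS r_lower => n h n0; apply: lt_le_trans h.
by rewrite !divr_gt0// ltr0n.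
Qed.

Variable z : R.
Hypothesis hz : (qn n - 1) / r n @[n --> \oo] --> z.
Hypothesis th0 : 0 < 2 * b - z.

(* Chosen so that Gf_{n+1} = (1 - tn_n r_n) Gf_n: the rescaled sums of squares then
   obey an affine recursion with fixed point c / (2 b - z). *)
Definition tn n : R := qn n * (2 * b - b ^+ 2 * r n) - (qn n - 1) / r n.

Lemma tn_cvg : tn n @[n --> \oo] --> 2 * b - z.
Proof.
rewrite (_ : 2 * b - z = 1 * (2 * b - b ^+ 2 * 0) - z); last by ring.
apply: cvgB => //; apply: cvgM; first exact: qn_cvg.
by apply: cvgB; [exact: cvg_cst|apply: cvgM; [exact: cvg_cst|exact: r_cvg0]].
Qed.

Lemma GfS : \forall n \near \oo, Gf n.+1 = (1 - tn n * r n) * Gf n.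
Proof.
apply: near_npow; apply: filterS r_gt0 => n rn0 n0.
have np := npow_gt0 gamma n0.
rewrite /Gf PiS /tn (_ : n.+1%:R `^ gamma = qn n * n%:R `^ gamma); last by rewrite /qn divfK// gt_eqF.
by field; rewrite gt_eqF.
Qed.

Lemma Gf_cvg0 : Gf n @[n --> \oo] --> (0 : R).
Proof.
rewrite -[X in _ --> X](mul0r (2 * b - z)^-1).
apply: (@recursion_cvg _ _ r tn (fun=> 0)) => //.
- exact: r_sum.
- exact: r_cvg0.
- exact: tn_cvg.
- exact: cvg_cst.
- by apply: filterS GfS => n ->; rewrite mul0r addr0.
Qed.

(** The new term contributes (m + 1)^gamma r_m^2 e_m, that is r_m times a forcing tending to
    [c * el]. Here [z] measures the growth of n^gamma per unit of r: 0 for gamma < 1 and 1/c for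
    gamma = 1. The weight [e] covers both the variance, [e = 1], and its error, [e] tending to 0. *)
Lemma wsum2_cvg (e : nat -> R) (el : R) : e n @[n --> \oo] --> el ->
  Gf m * \sum_(k < m) cf k ^+ 2 * e k @[m --> \oo] --> c * el / (2 * b - z).
Proof.
move=> he.
apply: (@recursion_cvg _ _ r tn (fun n => n.+1%:R `^ gamma * r n * e n)) => //.
- exact: r_sum.
- exact: r_cvg0.
- exact: tn_cvg.
- by apply: cvgM => //; exact: n1r_cvg.
- apply: filterS GfS => n h; rewrite big_ord_recr/= mulrDr {1}h; congr (_ + _); first by rewrite [RHS]mulrA.
  rewrite /Gf /cf; field.
  by rewrite gt_eqF// Pi_gt0.
Qed.

(** The squared recursion contracts at the doubled rate, while the forcing keeps an additional
    factor r_m and so vanishes. *)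
Lemma wsum4_cvg : Gf m ^+ 2 * \sum_(k < m) cf k ^+ 4 @[m --> \oo] --> (0 : R).
Proof.
rewrite -[X in _ --> X](mul0r (2 * (2 * b - z))^-1).
apply: (@recursion_cvg _ _ r (fun n => 2 * tn n - tn n ^+ 2 * r n)
  (fun n => (n.+1%:R `^ gamma * r n) ^+ 2 * r n)) => //.
- by rewrite mulr_gt0.
- exact: r_sum.
- exact: r_cvg0.
- rewrite -[X in _ --> X]subr0 -[X in _ - X](mulr0 ((2 * b - z) ^+ 2)).
  apply: cvgB; first by apply: cvgM; [exact: cvg_cst|exact: tn_cvg].
  apply: cvgM; last exact: r_cvg0.
  by rewrite expr2; under eq_fun do rewrite expr2; apply: cvgM; exact: tn_cvg.
- rewrite -[X in _ --> X](mulr0 (c * c)); apply: cvgM; last exact: r_cvg0.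
  by under eq_fun do rewrite expr2; apply: cvgM; exact: n1r_cvg.
- apply: filterS GfS => n h; rewrite /= big_ord_recr/= mulrDr.
  have -> : Gf n.+1 ^+ 2 * \sum_(i < n) cf i ^+ 4 =
      (1 - (2 * tn n - tn n ^+ 2 * r n) * r n) * (Gf n ^+ 2 * \sum_(i < n) cf i ^+ 4).
    by rewrite h; ring.
  congr (_ + _); rewrite /Gf /cf; field.
  by rewrite gt_eqF// Pi_gt0.
Qed.

Lemma kp_ge n t : 0 <= t -> (n <= kp n t)%N.
Proof.
move=> t0; rewrite /kp truncn_ge_nat; first by rewrite lerDl mulr_ge0// powR_ge0.
by rewrite addr_ge0// mulr_ge0// powR_ge0.
Qed.

Lemma kp_itv n t : 0 <= t -> (kp n t)%:R <= n%:R + n%:R `^ gamma * t < (kp n t).+1%:R.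
Proof. by move=> t0; apply: truncn_itv; rewrite addr_ge0// mulr_ge0// powR_ge0. Qed.

Lemma kp_mono n s t : 0 <= s -> s <= t -> (kp n s <= kp n t)%N.
Proof.
by move=> s0 st; apply: le_truncn; rewrite lerD2l ler_wpM2l// powR_ge0.
Qed.

Lemma cvg_kp (u : nat -> R) (l t : R) : 0 <= t -> u n @[n --> \oo] --> l ->
  u (kp n t) @[n --> \oo] --> l.
Proof.
move=> t0 /cvgrPdist_le hu; apply/cvgrPdist_le => e e0.
have [N _ hN] := hu e e0; exists N => // n Nn; apply: hN => /=.
exact: leq_trans Nn (kp_ge n t0).
Qed.

Lemma hf2 n : hf n ^+ 2 = Gf n.
Proof.
rewrite /hf /Gf exprMn; congr (_ * _).
by rewrite -powR_mulrn ?powR_ge0// -powRrM; congr (_ `^ _); field.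
Qed.

Lemma hf_ge0 n : 0 <= hf n. Proof. by rewrite mulr_ge0 ?powR_ge0// ltW// Pi_gt0. Qed.

Lemma hf_cvg0 : hf n @[n --> \oo] --> (0 : R).
Proof.
apply/cvgrPdist_le => e e0; have e2 : 0 < e ^+ 2 by rewrite exprn_gt0.
have /cvgrPdist_le/(_ _ e2) := Gf_cvg0; apply: filterS => n.
rewrite !sub0r !normrN -hf2 normrX ler_pXn2r// ?nnegrE// ltW//.
Qed.

Variables (T : R -> R) (dd : nat -> nat -> R) (nu : R -> R).
Hypothesis T_mono : forall s t, 0 <= s -> s <= t -> 0 <= T s <= T t.
Hypothesis dd_ge0 : forall n k, 0 <= dd n k.
Hypothesis C1 : forall (m e : R), 0 <= m -> 0 < e -> \forall n \near \oo, forall k,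
  (n <= k)%N -> k%:R <= n%:R + n%:R `^ gamma * m -> `|r k - c * dd n k| <= e * dd n k.
Hypothesis C2 : forall (m e : R), 0 <= m -> 0 < e -> \forall n \near \oo, forall t,
  0 <= t <= m -> T t - e <= \sum_(n <= i < kp n t) dd n i <= T t.
Hypothesis C3 : forall t, 0 <= t -> n%:R `^ gamma / (kp n t)%:R `^ gamma @[n --> \oo] --> nu t.

(** The factor [b] of the abstract theorem: the quotient of the exponential in the statement by the
    exact normalisation Pi_n / Pi_k at k = [kp n t]. *)
Definition bf n t : R := expR (c * b * T t) * Pi (kp n t) / Pi n.

Lemma Pi_ratio n k : (n <= k)%N -> Pi k / Pi n = \prod_(n <= i < k) (1 - b * r i).
Proof.
move=> nk; rewrite /Pi -!(big_mkord xpredT (fun i => 1 - b * r i)) (big_cat_nat (leq0n n) nk)/=.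
rewrite mulrAC divff ?mul1r// (big_mkord xpredT (fun i => 1 - b * r i)).
by rewrite gt_eqF// Pi_gt0.
Qed.

Lemma bf_cvg (m e : R) : 0 < e -> \forall n \near \oo, forall t, 0 <= t <= m -> `|bf n t - 1| <= e.
Proof.
(* Needed for exp(e/2) <= 1 / (1 - e/2) <= 1 + e at the end. *)
wlog e1 : e / e <= 1.
  move=> H e0; have m1 : 0 < Num.min e 1 by rewrite lt_min e0 ltr01.
  have := H _ _ m1; rewrite ge_min lexx orbT => /(_ isT); apply: filterS => n h t tm.
  by rewrite (le_trans (h t tm))// ge_min lexx.
move=> e0; have [m0|m0] := leP 0 m; last first.
  by apply: nearW => n t /andP[t0 tm]; move: m0; rewrite ltNge (le_trans t0 tm).
case/andP: b01 => b0 b1.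
pose lam := c * b; have lam0 : 0 < lam by rewrite mulr_gt0.
have Tm : 0 <= T m by have /andP[] := T_mono m0 (lexx m).
pose ep := Num.min (e / 4 / (T m + 1)) lam.
have ep0 : 0 < ep by rewrite lt_min lam0 andbT !divr_gt0// ltr_wpDl.
have epT : ep * T m <= e / 4.
  apply: (@le_trans _ _ (e / 4 / (T m + 1) * T m)).
    by apply: ler_wpM2r => //; rewrite ge_min lexx.
  rewrite mulrAC ler_pdivrMr; last by rewrite ltr_wpDl.
  by apply: ler_wpM2l; [rewrite divr_ge0// ltW|rewrite lerDl].
have epl : ep <= lam by rewrite ge_min lexx orbT.
pose e' := e / 4 / (lam + 1); have e'0 : 0 < e' by rewrite !divr_gt0// ltr_wpDl// ltW.
have le' : lam * e' <= e / 4.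
  rewrite /e' mulrC mulrAC ler_pdivrMr; last by rewrite ltr_wpDl// ltW.
  by apply: ler_wpM2l; [rewrite divr_ge0// ltW|rewrite lerDl].
(* [et] pays for comparing r with the clock, [et'] for the denominator 1 - x in [prod_clock]; each
   uses a quarter of [ep]. *)
pose et := ep / 4; have et0 : 0 < et by rewrite divr_gt0.
pose et' := ep / 4 / (lam + ep); have et'0 : 0 < et' by rewrite !divr_gt0// addr_gt0.
have hC1 := C1 m0 et0; have hC2 := C2 m0 e'0.
have hrk : \forall n \near \oo, forall k, (n <= k)%N -> r k <= et'.
  have /cvgrPdist_le/(_ _ et'0)[N _ hN] := r_cvg0; exists N => // n Nn k nk.
  have /= := hN k (leq_trans Nn nk); rewrite sub0r normrN; apply: le_trans; exact: ler_norm.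
near=> n => t tm; have /andP[t0 t1] := tm.
have H1 : forall k, (n <= k)%N -> k%:R <= n%:R + n%:R `^ gamma * m -> `|r k - c * dd n k| <= et * dd n k.
  by near: n.
have /andP[H2 H2'] : T t - e' <= \sum_(n <= i < kp n t) dd n i <= T t.
  by move: t tm {t0 t1}; near: n.
have H3 : forall k, (n <= k)%N -> r k <= et' by near: n.
have /andP[P1 P2] : expR (- ((lam + ep) * \sum_(n <= i < kp n t) dd n i)) <=
   \prod_(n <= i < kp n t) (1 - b * r i) <= expR (- ((lam - ep) * \sum_(n <= i < kp n t) dd n i)).
  apply: prod_clock => k /andP[nk kk].
  have kb : k%:R <= n%:R + n%:R `^ gamma * m.
    have /andP[q1 _] := kp_itv n t0.
    apply: (@le_trans _ _ (kp n t)%:R); first by rewrite ler_nat ltnW.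
    by rewrite (le_trans q1)// lerD2l ler_wpM2l// powR_ge0.
  have /andP[x0 x1] := br_lt1 k.
  have := H1 k nk kb; rewrite ler_norml => /andP[g1 g2].
  have d0 := dd_ge0 n k.
  have ed : 0 <= ep * dd n k by rewrite mulr_ge0// ltW.
  have be : b * (et * dd n k) <= et * dd n k by apply: ler_piMl => //; rewrite mulr_ge0// ltW.
  have low : (lam - ep) * dd n k <= b * r k.
    have := ler_wpM2l (ltW b0) g1; rewrite /lam /et in be *; lra.
  have up : b * r k <= (lam + ep / 4) * dd n k.
    have := ler_wpM2l (ltW b0) g2; rewrite /lam /et in be *; lra.
  split => //.
  rewrite ler_pdivrMr ?subr_gt0//.
  have x2 : b * r k <= et'.
    by apply: le_trans (H3 k nk); apply: ler_piMl.
  have lep : 0 < lam + ep by rewrite addr_gt0.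
  have x3 : (lam + ep) * (b * r k) <= ep / 4.
    by rewrite mulrC -ler_pdivlMr.
  have := ler_wpM2r d0 x3; have := up; have := ed; move: (b * r k) (dd n k) => x y; lra.
rewrite /bf -/lam -mulrA Pi_ratio; last exact: kp_ge.
set S := \sum_(n <= i < _) _ in H2 H2' P1 P2; set Q := \prod_(n <= i < _) _ in P1 P2 *.
have TT := T_mono t0 t1; have /andP[Tt0 Ttm] := TT.
have S0 : 0 <= S by apply: sumr_ge0.
have epS : ep * S <= e / 4.
  by apply: le_trans epT; apply: ler_wpM2l; [exact: ltW|exact: le_trans H2' Ttm].
have eT0 := expR_ge0 (lam * T t).
have low : expR (- (e / 2)) <= expR (lam * T t) * Q.
  apply: le_trans (ler_wpM2l eT0 P1); rewrite -expRD ler_expR.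
  have := ler_wpM2l (ltW lam0) H2'; lra.
have up : expR (lam * T t) * Q <= expR (e / 2).
  apply: le_trans (ler_wpM2l eT0 P2) _; rewrite -expRD ler_expR.
  have := ler_wpM2l (ltW lam0) H2; lra.
have up2 : expR (e / 2) <= 1 + e.
  have := expR_ge1Dx (- (e / 2)); rewrite expRN => h.
  have := ler_wpM2r (expR_ge0 (e / 2)) h; rewrite mulVf ?gt_eqF ?expR_gt0// => h'.
  have E0 := expR_ge0 (e / 2 : R); nra.
have low2 : 1 - e <= expR (- (e / 2)) by have := expR_ge1Dx (- (e / 2)); lra.
rewrite ler_norml; apply/andP; split; lra.
Unshelve. all: by end_near. Qed.

Lemma Gf_ratio_cvg t : 0 <= t ->
  Gf n / Gf (kp n t) @[n --> \oo] --> nu t * expR (c * b * T t) ^+ 2.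
Proof.
move=> t0.
have cb1 : bf n t @[n --> \oo] --> (1 : R).
  apply/cvgrPdist_le => e e0; apply: filterS (bf_cvg t e0) => n h.
  by rewrite distrC; apply: h; rewrite t0 lexx.
have cb2 : expR (c * b * T t) ^+ 2 * (bf n t ^+ 2)^-1 @[n --> \oo] --> expR (c * b * T t) ^+ 2 * (1 ^+ 2)^-1.
  apply: cvgM; first exact: cvg_cst.
  apply: cvgV; first by rewrite expr1n oner_eq0.
  by under eq_fun do rewrite expr2; rewrite expr2; apply: cvgM.
rewrite expr1n invr1 mulr1 in cb2.
apply: (@cvg_trans _ (n%:R `^ gamma / (kp n t)%:R `^ gamma *
   (expR (c * b * T t) ^+ 2 * (bf n t ^+ 2)^-1) @[n --> \oo])); last first.
  by apply: cvgM => //; exact: C3.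
apply: near_eq_cvg; apply: near_npow; apply: nearW => n n0.
have k0 : (0 < kp n t)%N by exact: leq_trans (kp_ge n t0).
have := npow_gt0 gamma k0; have := Pi_gt0 n; have := Pi_gt0 (kp n t); have := expR_gt0 (c * b * T t).
rewrite /Gf /bf => q1 q2 q3 q4; field.
by rewrite !gt_eqF.
Qed.

Lemma hsum2_cvg (e : nat -> R) (el t : R) : 0 <= t -> e n @[n --> \oo] --> el ->
  hf n ^+ 2 * \sum_(k < kp n t) cf k ^+ 2 * e k @[n --> \oo] -->
  nu t * expR (c * b * T t) ^+ 2 * (c * el / (2 * b - z)).
Proof.
move=> t0 he; have h1 := Gf_ratio_cvg t0; have h2 := cvg_kp t0 (wsum2_cvg he).
apply: (@cvg_trans _ (Gf n / Gf (kp n t) * (Gf (kp n t) * \sum_(k < kp n t) cf k ^+ 2 * e k)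
  @[n --> \oo])); last exact: cvgM h1 h2.
apply: near_eq_cvg; apply: near_npow; apply: nearW => n n0 /=.
have k0 : (0 < kp n t)%N by exact: leq_trans (kp_ge n t0).
rewrite hf2 mulrA divfK// gt_eqF// /Gf mulr_gt0 ?npow_gt0// exprn_gt0// Pi_gt0//.
Qed.

Lemma hsum4_cvg (t : R) : 0 <= t ->
  hf n ^+ 4 * \sum_(k < kp n t) cf k ^+ 4 @[n --> \oo] --> (0 : R).
Proof.
move=> t0; have h1 := Gf_ratio_cvg t0; have h2 := cvg_kp t0 wsum4_cvg.
have h3 := cvgM (cvgM h1 h1) h2; rewrite mulr0 in h3.
apply: (@cvg_trans _ (Gf n / Gf (kp n t) * (Gf n / Gf (kp n t)) *
  (Gf (kp n t) ^+ 2 * \sum_(k < kp n t) cf k ^+ 4) @[n --> \oo])); last exact: h3.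
apply: near_eq_cvg; apply: near_npow; apply: nearW => n n0 /=.
have k0 : (0 < kp n t)%N by exact: leq_trans (kp_ge n t0).
rewrite -[4%N]/(2 * 2)%N [hf n ^+ _]exprM hf2; field.
by rewrite gt_eqF// /Gf mulr_gt0 ?npow_gt0// exprn_gt0// Pi_gt0.
Qed.

Lemma cf_ge0 k : 0 <= cf k. Proof. by rewrite divr_ge0// ltW// Pi_gt0. Qed.

(** Cubes are interpolated between squares, whose sum stays bounded, and fourth powers, whose sum
    vanishes. Fourth powers obey a recursion polynomial in [Gf], whereas cubes would involve its
    square root. *)
Lemma hsum3_cvg (t : R) : 0 <= t ->
  \sum_(k < kp n t) (hf n * cf k) ^+ 3 @[n --> \oo] --> (0 : R).
Proof.
move=> t0.
pose l := nu t * expR (c * b * T t) ^+ 2 * (c * 1 / (2 * b - z)).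
have h2 : hf n ^+ 2 * \sum_(k < kp n t) cf k ^+ 2 * 1 @[n --> \oo] --> l.
  by apply: (@hsum2_cvg (fun=> 1) 1 t t0); exact: cvg_cst.
have h4 := hsum4_cvg t0.
apply/cvgrPdist_le => e e0.
pose d := e / 2 / (`|l| + 1); have d0 : 0 < d by rewrite !divr_gt0// ltr_wpDl.
near=> n.
have H2 : hf n ^+ 2 * \sum_(k < kp n t) cf k ^+ 2 * 1 <= `|l| + 1.
  have : `|l - hf n ^+ 2 * \sum_(k < kp n t) cf k ^+ 2 * 1| <= 1.
    by near: n; move/cvgrPdist_le: h2; exact.
  rewrite ler_norml => /andP[g1 _]; have := ler_norm l; lra.
have H4 : hf n ^+ 4 * \sum_(k < kp n t) cf k ^+ 4 <= d * (e / 2).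
  have : `|0 - hf n ^+ 4 * \sum_(k < kp n t) cf k ^+ 4| <= d * (e / 2).
    by near: n; move/cvgrPdist_le: h4; apply; rewrite mulr_gt0// divr_gt0.
  by rewrite sub0r normrN; apply: le_trans; exact: ler_norm.
have a0 k : 0 <= hf n * cf k by rewrite mulr_ge0 ?hf_ge0 ?cf_ge0.
rewrite sub0r normrN ger0_norm; last by rewrite sumr_ge0// => k _; rewrite exprn_ge0.
apply: (@le_trans _ _ (d * (hf n ^+ 2 * \sum_(k < kp n t) cf k ^+ 2 * 1) +
   d^-1 * (hf n ^+ 4 * \sum_(k < kp n t) cf k ^+ 4))).
  rewrite !mulr_sumr -big_split/=; apply: ler_sum => k _.
  rewrite mulr1 -!exprMn; move: (hf n * cf k) (a0 k) => a a0'.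
  (* AM-GM: a <= d + a^2 / d *)
  have : a <= d + d^-1 * a ^+ 2.
    rewrite -(ler_pM2l d0) mulrDr [X in _ + X]mulrA divff ?gt_eqF// mul1r.
    have := sqr_ge0 (a - d); have := sqr_ge0 a; have := sqr_ge0 d; have := mulr_ge0 (ltW d0) a0'; lra.
  move/(ler_wpM2l (sqr_ge0 a)); rewrite mulrDr -exprSr => /le_trans; apply.
  rewrite le_eqVlt; apply/orP; left; apply/eqP; ring.
rewrite (splitr e); apply: lerD.
  by move/(ler_wpM2l (ltW d0)): H2 => /le_trans; apply; rewrite /d divfK// gt_eqF// ltr_wpDl.
by rewrite ler_pdivrMl.
Unshelve. all: by end_near. Qed.

End step_sizes.

(** * The clock for gamma < 1 *)

Section slow_clock.
Context {R : realType}.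
Variables (gamma c b : R) (r : nat -> R).
Hypothesis g01 : 0 < gamma < 1.
Hypothesis c0 : 0 < c.
Hypothesis hr : forall n, 0 <= r n < 1.
Hypothesis hc : n%:R `^ gamma * r n @[n --> \oo] --> c.

Lemma npow_ratio_cvg0 : n%:R `^ gamma / n%:R @[n --> \oo] --> (0 : R).
Proof.
case/andP: g01 => gam0 gam1.
have h : (n%:R `^ (1 - gamma))^-1 @[n --> \oo] --> (0 : R).
  by apply: npowV_cvg0; rewrite subr_gt0.
apply: cvg_trans h; apply: near_eq_cvg; apply: near_npow; apply: nearW => n n0.
have nR : (0 : R) < n%:R by rewrite ltr0n.
rewrite powRB ?gt_eqF ?implybT// powRr1 ?ltW// invf_div//.
Qed.

Lemma slow_z : (qn gamma n - 1) / r n @[n --> \oo] --> (0 : R).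
Proof.
case/andP: (g01) => gam0 gam1; have g01' : 0 < gamma <= 1 by rewrite gam0 ltW.
have h : (n%:R `^ gamma / n%:R) * (n%:R `^ gamma * r n)^-1 @[n --> \oo] --> 0 * c^-1.
  by apply: cvgM; [exact: npow_ratio_cvg0|apply: cvgV => //; rewrite gt_eqF].
rewrite mul0r in h.
apply: (@squeeze_cvgr _ _ _ _ (fun=> 0) (fun n => (n%:R `^ gamma / n%:R) * (n%:R `^ gamma * r n)^-1)) => //.
  apply: near_npow; apply: filterS (r_gt0 g01' c0 hr hc) => n rn n0.
  have /andP[h1 h2] := qn_itv g01' n0; have np := npow_gt0 gamma n0.
  have nR : (0 : R) < n%:R by rewrite ltr0n.
  apply/andP; split; first by apply: divr_ge0; [rewrite subr_ge0|exact: ltW].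
  rewrite [leRHS](_ : _ = n%:R^-1 / r n); last by field; rewrite !gt_eqF.
  by rewrite ler_pM2r ?invr_gt0//; lra.
exact: cvg_cst.
Qed.

Lemma slow_C2 (m e : R) : 0 <= m -> 0 < e -> \forall n \near \oo, forall t,
  0 <= t <= m -> t - e <= \sum_(n <= i < kp gamma n t) (n%:R `^ gamma)^-1 <= t.
Proof.
case/andP: (g01) => gam0 gam1 m0 e0.
have := npowV_cvg0 gam0 => /cvgrPdist_le/(_ _ e0) h; apply: near_npow; apply: filterS h => n h n0.
move: h; rewrite sub0r normrN => h t /andP[t0 _].
have np := npow_gt0 gamma n0; rewrite ger0_norm ?invr_ge0 ?(ltW np)// in h.
rewrite sumr_const_nat -[_ *+ _]mulr_natr natrB; last exact: kp_ge.
have /andP[k1 k2] := @kp_itv _ gamma n t t0.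
rewrite -natr1 in k2.
rewrite mulrC ler_pdivlMr// ler_pdivrMr//; apply/andP; split; last by lra.
have : 1 <= e * n%:R `^ gamma by rewrite -ler_pdivrMr// div1r.
lra.
Qed.

Lemma slow_window (m : R) : 0 <= m -> \forall n \near \oo, forall k, (n <= k)%N ->
  k%:R <= n%:R + n%:R `^ gamma * m ->
  (1 + n%:R `^ gamma / n%:R * m)^-1 <= n%:R `^ gamma / k%:R `^ gamma <= 1.
Proof.
case/andP: (g01) => gam0 gam1 m0; apply: near_npow; apply: nearW => n n0 k nk kb.
have nR : (0 : R) < n%:R by rewrite ltr0n.
have k0 : (0 < k)%N by exact: leq_trans nk.
have kR : (0 : R) < k%:R by rewrite ltr0n.
have np := npow_gt0 gamma n0; have kp0 := npow_gt0 gamma k0.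
apply/andP; split; last first.
  rewrite ler_pdivrMr// mul1r; apply: ge0_ler_powR; rewrite ?nnegrE ?ler_nat// ltW//.
have d1 : 0 <= n%:R `^ gamma / n%:R * m by rewrite mulr_ge0 ?divr_ge0// ltW.
have D0 : 0 < 1 + n%:R `^ gamma / n%:R * m by rewrite ltr_wpDr.
rewrite -[leRHS]invf_div lef_pV2 ?posrE ?divr_gt0//.
have kn : k%:R / n%:R <= 1 + n%:R `^ gamma / n%:R * m.
  rewrite ler_pdivrMr//; apply: (le_trans kb); rewrite le_eqVlt; apply/orP; left; apply/eqP.
  by field; rewrite gt_eqF.
have k1 : 1 <= k%:R / n%:R :> R by rewrite ler_pdivlMr// mul1r ler_nat.
apply: le_trans kn.
have -> : k%:R `^ gamma / n%:R `^ gamma = (k%:R / n%:R) `^ gamma.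
  have {1}-> : k%:R = k%:R / n%:R * n%:R :> R by rewrite divfK// gt_eqF.
  by rewrite powRM ?divr_ge0 ?ler0n// mulfK// gt_eqF.
by rewrite -[leRHS]powRr1 ?divr_ge0 ?(ltW kR) ?(ltW nR)//; apply: ler_powR => //; rewrite ltW.
Qed.

(** On this window r_k is k^gamma r_k times k^(-gamma): the first factor is close to c, and the
    second to n^(-gamma) because the window length n^gamma is negligible against n. *)
Lemma slow_C1 (m e : R) : 0 <= m -> 0 < e -> \forall n \near \oo, forall k,
  (n <= k)%N -> k%:R <= n%:R + n%:R `^ gamma * m ->
  `|r k - c * (n%:R `^ gamma)^-1| <= e * (n%:R `^ gamma)^-1.
Proof.
move=> m0 e0.
have e2 : 0 < e / 2 by rewrite divr_gt0.
have /cvgrPdist_le/(_ _ e2)[N _ hN] := hc.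
have hw := slow_window m0.
have hd : \forall n \near \oo, c * (n%:R `^ gamma / n%:R * m) <= e / 2.
  have h : c * (n%:R `^ gamma / n%:R * m) @[n --> \oo] --> c * (0 * m).
    by apply: cvgM; [exact: cvg_cst|apply: cvgM; [exact: npow_ratio_cvg0|exact: cvg_cst]].
  rewrite mul0r mulr0 in h; have /cvgrPdist_le/(_ _ e2) := h.
  by apply: filterS => n; rewrite sub0r normrN; apply: le_trans; exact: ler_norm.
apply: near_npow; near=> n => n0 k nk kb.
have np := npow_gt0 gamma n0.
have k0 : (0 < k)%N by exact: leq_trans nk.
have kp0 := npow_gt0 gamma k0.
have /andP[w1 w2] : (1 + n%:R `^ gamma / n%:R * m)^-1 <= n%:R `^ gamma / k%:R `^ gamma <= 1.
  by move: k nk kb {k0 kp0}; near: n.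
have hd' : c * (n%:R `^ gamma / n%:R * m) <= e / 2 by near: n.
have Nn : (N <= n)%N by near: n; exact: nbhs_infty_ge.
have /= := hN k (leq_trans Nn nk); set a := _ * r k => ha.
have -> : r k - c * (n%:R `^ gamma)^-1 = (a * (n%:R `^ gamma / k%:R `^ gamma) - c) * (n%:R `^ gamma)^-1.
  by rewrite /a; field; rewrite !gt_eqF.
have np' : 0 <= (n%:R `^ gamma)^-1 by rewrite invr_ge0 ltW.
rewrite normrM [X in _ * X](ger0_norm np'); apply: ler_wpM2r => //.
set d := n%:R `^ gamma / n%:R * m in w1 hd'; set y := n%:R `^ gamma / k%:R `^ gamma in w1 w2 *.
have d0 : 0 <= d by rewrite mulr_ge0// divr_ge0// ltW.
have y1 : 1 - d <= y.
  apply: le_trans w1; rewrite -[leRHS]mul1r ler_pdivlMr ?ltr_wpDr//.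
  have := sqr_ge0 d; lra.
have a0 : 0 <= a by apply: mulr_ge0; [exact: ltW|case/andP: (hr k)].
have y0 : 0 <= y by rewrite divr_ge0// ltW.
move: ha; rewrite !ler_norml => /andP[g1 g2]; apply/andP; split.
  have : c * (1 - y) <= c * d by apply: ler_wpM2l; [exact: ltW|lra].
  have : y * (c - a) <= e / 2.
    have [ca|ca] := leP 0 (c - a).
      by apply: le_trans (ler_piMl ca w2) _.
    by apply: (@le_trans _ _ 0); [rewrite mulr_ge0_le0// ltW|exact: ltW].
  lra.
have : a * y <= a by apply: ler_piMr.
lra.
Unshelve. all: by end_near. Qed.

Lemma slow_C3 (t : R) : 0 <= t -> n%:R `^ gamma / (kp gamma n t)%:R `^ gamma @[n --> \oo] --> (1 : R).
Proof.
move=> t0.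
have h : (1 + n%:R `^ gamma / n%:R * t)^-1 @[n --> \oo] --> (1 + 0 * t)^-1.
  apply: cvgV; first by rewrite mul0r addr0 oner_eq0.
  apply: cvgD; first exact: cvg_cst.
  by apply: cvgM; [exact: npow_ratio_cvg0|exact: cvg_cst].
rewrite mul0r addr0 invr1 in h.
apply: (@squeeze_cvgr _ _ _ _ (fun n => (1 + n%:R `^ gamma / n%:R * t)^-1) (fun=> 1)) => //.
  apply: filterS (slow_window t0) => n; apply; first exact: kp_ge.
  by have /andP[] := @kp_itv _ gamma n t t0.
exact: cvg_cst.
Qed.

End slow_clock.

(** * The clock for gamma = 1 *)

Section fast_clock.
Context {R : realType}.
Variables (c : R) (r : nat -> R).
Hypothesis c0 : 0 < c.
Hypothesis hr : forall n, 0 <= r n < 1.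
Hypothesis hc : n%:R `^ 1 * r n @[n --> \oo] --> c.

Let np1 n : n%:R `^ 1 = n%:R :> R. Proof. by rewrite powRr1. Qed.
Let g1 : (0 : R) < 1 <= (1 : R). Proof. by rewrite ltr01 lexx. Qed.

Lemma fast_z : (qn 1 n - 1) / r n @[n --> \oo] --> c^-1.
Proof.
have h : (n%:R `^ 1 * r n)^-1 @[n --> \oo] --> c^-1 by apply: cvgV => //; rewrite gt_eqF.
apply: cvg_trans h; apply: near_eq_cvg; apply: near_npow; apply: filterS (r_gt0 g1 c0 hr hc) => n rn n0.
have nR : (0 : R) < n%:R by rewrite ltr0n.
by rewrite /qn !np1 -natr1; field; rewrite !gt_eqF.
Qed.

(** Preferred to 1/k because it telescopes exactly to [ln (k / n)]. At [k = 0] the conventions for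
    division by zero and [ln 0] make it 0. *)
Definition lnd (k : nat) : R := ln (k.+1%:R / k%:R).

Lemma lnd_itv k : (0 < k)%N -> (k%:R + 1)^-1 <= lnd k <= k%:R^-1.
Proof.
move=> k0; have kR : (0 : R) < k%:R by rewrite ltr0n.
have k1 : (0 : R) < k%:R + 1 by rewrite ltr_wpDr.
rewrite /lnd -natr1; apply/andP; split.
  rewrite -[X in ln X]invrK lnV ?posrE ?invr_gt0 ?divr_gt0// lerNr invf_div.
  have -> : k%:R / (k%:R + 1) = 1 + (- (k%:R + 1)^-1) :> R by field; rewrite gt_eqF.
  by apply: le_ln1Dx; rewrite ltrN2 invf_lt1// ltrDr.
have -> : (k%:R + 1) / k%:R = 1 + k%:R^-1 :> R by field; rewrite gt_eqF.
by apply: le_ln1Dx; rewrite (@lt_trans _ _ 0) ?ltrN10// invr_gt0.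
Qed.

Lemma lnd_ge0 k : 0 <= lnd k.
Proof.
case: k => [|k]; first by rewrite /lnd invr0 mulr0 ln0.
have /andP[h _] := @lnd_itv k.+1 isT; apply: le_trans h.
by rewrite invr_ge0 addr_ge0.
Qed.

Lemma sum_lnd n k : (0 < n)%N -> (n <= k)%N -> \sum_(n <= i < k) lnd i = ln (k%:R / n%:R).
Proof.
move=> n0 /subnKC; move: (k - n)%N => j <- {k}.
have nR : (0 : R) < n%:R by rewrite ltr0n.
elim: j => [|j IH]; first by rewrite addn0 big_geq// divff ?ln1// gt_eqF.
have jR : (0 : R) < (n + j)%:R by rewrite ltr0n addn_gt0 n0.
have jR1 : (0 : R) < (n + j).+1%:R by rewrite ltr0n.
rewrite addnS big_nat_recr ?leq_addr//= IH /lnd -lnM ?posrE ?divr_gt0//.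
congr ln; move: jR jR1 nR; move: (n + j)%:R (n + j).+1%:R n%:R => x y z x0 y0 z0.
by field; rewrite !gt_eqF.
Qed.

Lemma fast_C1 (m e : R) : 0 <= m -> 0 < e -> \forall n \near \oo, forall k,
  (n <= k)%N -> k%:R <= n%:R + n%:R `^ 1 * m -> `|r k - c * lnd k| <= e * lnd k.
Proof.
move=> m0 e0; have e4 : 0 < e / 4 by rewrite divr_gt0.
have /cvgrPdist_le/(_ _ e4)[N _ hN] := hc.
near=> n => k nk _.
have Nn : (N <= n)%N by near: n; exact: nbhs_infty_ge.
have n0 : (0 < n)%N by near: n; exact: nbhs_infty_gt.
have k0 : (0 < k)%N by exact: leq_trans nk.
have kR : (1 : R) <= k%:R by rewrite ler1n.
have kc : 2 * c / e <= k%:R.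
  by apply: (@le_trans _ _ n%:R); [near: n; exact: nbhs_infty_ger|rewrite ler_nat].
have /= := hN k (leq_trans Nn nk); rewrite np1 ler_norml => /andP[h1 h2].
have /andP[l1 l2] := lnd_itv k0; have l0 := lnd_ge0 k.
have kl1 : k%:R * lnd k <= 1 by rewrite mulrC -ler_pdivlMr ?div1r// (lt_le_trans ltr01).
have kl2 : 1 <= (k%:R + 1) * lnd k by rewrite mulrC -ler_pdivrMr ?div1r// ltr_wpDr.
have k0' : (0 : R) < k%:R by exact: lt_le_trans kR.
have kl3 : 1 <= 2 * (k%:R * lnd k).
  apply: le_trans kl2 _; rewrite mulrA; apply: ler_wpM2r => //; lra.
rewrite ler_pdivrMr// in kc.
have cl : 2 * c * lnd k <= k%:R * e * lnd k by apply: ler_wpM2r.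
have el := mulr_ge0 (ltW e0) l0.
have ekl := ler_wpM2l (ltW e0) kl3.
have ckl1 := ler_wpM2l (ltW c0) kl1; have ckl2 := ler_wpM2l (ltW c0) kl2.
rewrite ler_norml; apply/andP; split; rewrite -(ler_pM2l k0') mulrBr; lra.
Unshelve. all: by end_near. Qed.

Lemma fast_kp n (t : R) : (0 < n)%N -> 0 <= t ->
  [/\ (0 : R) < (kp 1 n t)%:R, (kp 1 n t)%:R <= n%:R * (1 + t) & n%:R * (1 + t) < (kp 1 n t)%:R + 1].
Proof.
move=> n0 t0; have /andP[k1 k2] := @kp_itv _ 1 n t t0.
rewrite np1 -natr1 in k1 k2; split; [|lra|lra].
by rewrite ltr0n (leq_trans n0)// kp_ge.
Qed.

Lemma fast_C2 (m e : R) : 0 <= m -> 0 < e -> \forall n \near \oo, forall t,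
  0 <= t <= m -> ln (1 + t) - e <= \sum_(n <= i < kp 1 n t) lnd i <= ln (1 + t).
Proof.
move=> m0 e0; near=> n => t /andP[t0 _].
have n0 : (0 < n)%N by near: n; exact: nbhs_infty_gt.
have nR : (0 : R) < n%:R by rewrite ltr0n.
have [k0 k1 k2] := fast_kp n0 t0.
have t1 : 0 < 1 + t by rewrite ltr_wpDr.
have nk := @kp_ge _ 1 n t t0.
rewrite sum_lnd//; apply/andP; split; last first.
  by rewrite ler_ln ?posrE ?divr_gt0// ler_pdivrMr// mulrC.
rewrite lerBlDr -lerBlDl -ln_div ?posrE ?divr_gt0//.
set y := (1 + t) / _; have -> : y = 1 + (y - 1) by ring.
have yE : y = n%:R * (1 + t) / (kp 1 n t)%:R by rewrite /y invf_div mulrA [(1 + t) * _]mulrC.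
have y1 : 1 <= y by rewrite yE ler_pdivlMr// mul1r.
apply: le_trans (le_ln1Dx _) _; first by lra.
apply: (@le_trans _ _ ((kp 1 n t)%:R^-1)).
  rewrite lerBlDr yE ler_pdivrMr// mulrDl mulVf ?gt_eqF// mul1r; lra.
apply: (@le_trans _ _ n%:R^-1); first by rewrite lef_pV2 ?posrE// ler_nat.
rewrite -[leRHS]invrK lef_pV2 ?posrE ?invr_gt0//.
by near: n; exact: nbhs_infty_ger.
Unshelve. all: by end_near. Qed.

Lemma fast_C3 (t : R) : 0 <= t -> n%:R `^ 1 / (kp 1 n t)%:R `^ 1 @[n --> \oo] --> (1 + t)^-1.
Proof.
move=> t0; have t1 : 0 < 1 + t by rewrite ltr_wpDr.
have t1' : 1 <= 1 + t by rewrite lerDl.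
apply/cvgrPdist_le => e e0; near=> n.
have n0 : (0 < n)%N by near: n; exact: nbhs_infty_gt.
have nR : (0 : R) < n%:R by rewrite ltr0n.
have ne : n%:R^-1 <= e.
  rewrite -[leRHS]invrK lef_pV2 ?posrE ?invr_gt0//.
  by near: n; exact: nbhs_infty_ger.
have [k0 k1 k2] := fast_kp n0 t0.
have nk : n%:R <= (kp 1 n t)%:R :> R by rewrite ler_nat kp_ge.
rewrite !np1; set k := (kp 1 n t)%:R in k0 k1 k2 nk *.
apply: le_trans ne.
have -> : (1 + t)^-1 - n%:R / k = - ((n%:R * (1 + t) - k) / (k * (1 + t))).
  by field; rewrite !gt_eqF.
rewrite normrN ger0_norm; last by rewrite divr_ge0 ?subr_ge0// mulr_ge0// ltW.
rewrite ler_pdivrMr ?mulr_gt0// -ler_pdivrMl ?invr_gt0// invrK.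
have : n%:R * (n%:R * (1 + t) - k) <= n%:R * 1 by rewrite ler_pM2l//; lra.
have : k * 1 <= k * (1 + t) by rewrite ler_pM2l.
lra.
Unshelve. all: by end_near. Qed.

End fast_clock.

(** * The interacting system *)

Section urn_model.
Context {R : realType} d {T : measurableType d} (P : probability T R).
Variables (N : nat) (rho alpha q : R) (r : nat -> R) (Z I : nat -> 'I_N -> T -> R).
Hypothesis N0 : (0 < N)%N.
Hypothesis rho01 : 0 <= rho < 1.
Hypothesis al01 : 0 <= alpha <= 1.
Hypothesis q01 : 0 < q < 1.
Hypothesis hr : forall n, 0 <= r n < 1.
Hypothesis mZ : forall n i, measurable_fun setT (Z n i).
Hypothesis mI : forall n i, measurable_fun setT (I n i).
Hypothesis Z01 : forall n i w, 0 <= Z n i w <= 1.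
Hypothesis I01 : forall n i w, I n i w = 0 \/ I n i w = 1.
Hypothesis ZS : forall n i w, Z n.+1 i w =
  (1 - r n) * Z n i w + r n * (rho * I n.+1 i w + (1 - rho) * q).
Hypothesis hI : forall (n : nat) (S : {set 'I_N}) (B : set T), filtr Z n B ->
  P (B `&` [set w | forall i, i \in S -> I n.+1 i w = 1]) =
  (\int[P]_(w in B)
     (\prod_(i in S) ((1 - alpha) * Z n i w + alpha * zbar Z n w))%:E)%E.
Local Notation E := (Ex P).

Definition gens (n : nat) : set (set T) :=
  [set A | exists k i (B : set R), [/\ (k <= n)%N, measurable B & A = Z k i @^-1` B]].

Lemma gens_sub n A : gens n A -> measurable A.
Proof. by move=> [k [i [B [_ mB ->]]]]; rewrite -[X in measurable X]setTI; exact: mZ. Qed.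

Lemma gens_mono n : gens n `<=` gens n.+1.
Proof. by move=> A [k [i [B [kn mB ->]]]]; exists k, i, B; split => //; exact: leqW. Qed.

Lemma adZ n i : adp gens n (Z n i).
Proof.
move=> _ B mB; rewrite setTI; apply: sub_gen_smallest.
by exists n, i, B.
Qed.

Lemma ad_zbar n : adp gens n (zbar Z n).
Proof.
apply: (@adpM _ _ _ gens n (fun=> N%:R^-1)); first exact: adp_cst.
by apply: measurable_sum => i; exact: adZ.
Qed.

Definition pr n i w : R := (1 - alpha) * Z n i w + alpha * zbar Z n w.

Lemma ad_pr n i : adp gens n (pr n i).
Proof.
by apply: adpD; apply: adpM; try exact: adp_cst; [exact: adZ|exact: ad_zbar].
Qed.

Let NR : (0 : R) < N%:R. Proof. by rewrite ltr0n. Qed.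

Lemma zbar01 n w : 0 <= zbar Z n w <= 1.
Proof.
rewrite /zbar; apply/andP; split.
  apply: mulr_ge0; first by rewrite invr_ge0 ltW.
  by apply: sumr_ge0 => i _; case/andP: (Z01 n i w).
rewrite ler_pdivrMl// mulr1 -[in leRHS](card_ord N) -sum1_card natr_sum.
by apply: ler_sum => i _; case/andP: (Z01 n i w).
Qed.

Lemma pr01 n i w : 0 <= pr n i w <= 1.
Proof.
have /andP[a0 a1] := al01; have /andP[z0 z1] := Z01 n i w; have /andP[y0 y1] := zbar01 n w.
apply/andP; split; first by rewrite addr_ge0// mulr_ge0// subr_ge0.
have -> : 1 = (1 - alpha) * 1 + alpha * 1 :> R by ring.
by apply: lerD; apply: ler_wpM2l; rewrite ?subr_ge0.
Qed.

Let norm01 (x : R) : 0 <= x <= 1 -> `|x| <= 1.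
Proof. by move=> /andP[x0 x1]; rewrite ger0_norm. Qed.

Lemma bmf_Z n i : bmf (Z n i).
Proof. by split => //; exists 1 => w; apply: norm01. Qed.

Lemma bmf_pr n i : bmf (pr n i).
Proof.
split; first exact: (adp_meas gens_sub (@ad_pr n i)).
by exists 1 => w; apply: norm01; exact: pr01.
Qed.

Lemma bmf_I n i : bmf (I n i).
Proof.
by split => //; exists 1 => w; case: (I01 n i w) => ->; rewrite ?normr0 ?normr1.
Qed.

Lemma prod_I n (S : {set 'I_N}) w :
  \prod_(i in S) I n i w = \1_[set w | forall i, i \in S -> I n i w = 1] w.
Proof.
rewrite indicE; case: (pselect (forall i, i \in S -> I n i w = 1)) => h.
  by rewrite mem_set// big1.
rewrite memNset//; move/existsNP: h => [i /not_implyP[iS iI]].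
by rewrite (bigD1 i)//=; case: (I01 n i w) => // ->; rewrite mul0r.
Qed.

(** [hI] is this identity for indicators of events of the filtration; [Ex_ext] extends it to bounded
    adapted functions. Products over subsets encode the joint conditional law of variables with
    values 0 and 1. *)
Lemma cond_prod n (S : {set 'I_N}) f : adp gens n f -> bmf f ->
  E (fun w => f w * \prod_(i in S) I n.+1 i w) = E (fun w => f w * \prod_(i in S) pr n i w).
Proof.
move=> af bf.
have bI : bmf (fun w => \prod_(i in S) I n.+1 i w) by apply: bmf_prod => i _; exact: bmf_I.
have bP : bmf (fun w => \prod_(i in S) pr n i w) by apply: bmf_prod => i _; exact: bmf_pr.
apply/eqP; rewrite -subr_eq0 -ExB; [|exact: bmfM..].
under eq_Ex do rewrite -mulrBr.
apply/eqP; apply: Ex_ext => //; first exact: bmfB.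
move=> B mB; have FA := adp_pre af mB.
have mA : measurable (f @^-1` B) by exact: (sigma_meas gens_sub FA).
have bA : bmf (fun w => \1_B (f w) : R).
  rewrite (_ : (fun w => _) = \1_(f @^-1` B)); first exact: bmf_indic.
  by apply/funext => w; rewrite !indicE.
under eq_Ex do rewrite mulrBr.
rewrite ExB; [|exact: bmfM..].
apply/eqP; rewrite subr_eq0; apply/eqP.
have mS : measurable [set w | forall i, i \in S -> I n.+1 i w = 1].
  have -> : [set w | forall i, i \in S -> I n.+1 i w = 1] =
     (fun w => \prod_(i in S) I n.+1 i w) @^-1` [set 1].
    apply/seteqP; split => w /= h; first by rewrite big1.
    move=> i iS; case: (I01 n.+1 i w) => // Ii.
    by move: h; rewrite (bigD1 i)//= Ii mul0r => /eqP; rewrite eq_sym oner_eq0.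
  by rewrite -[X in measurable X]setTI; apply: (bmf_meas bI).
transitivity (fine (P ((f @^-1` B) `&` [set w | forall i, i \in S -> I n.+1 i w = 1]))).
  rewrite -Ex_indic; last exact: measurableI.
  by apply: eq_Ex => w; rewrite prod_I indicI /= !indicE.
rewrite (hI S FA) /Ex; congr fine.
rewrite integral_mkcond; apply: eq_integral => w _.
rewrite patchE /= indicE; case: ifPn => h.
  by rewrite mem_set ?mul1r//; move: h; rewrite inE.
by rewrite memNset ?mul0r// => h'; move/negP: h; apply; rewrite inE.
Qed.

Definition inno n i w : R := I n.+1 i w - pr n i w.

Lemma bmf_inno n i : bmf (inno n i).
Proof. by apply: bmfB; [exact: bmf_I|exact: bmf_pr]. Qed.

Lemma inno_le1 n i w : `|inno n i w| <= 1.
Proof.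
have /andP[p0 p1] := pr01 n i w; rewrite /inno ler_norml.
by case: (I01 n.+1 i w) => ->; apply/andP; split; lra.
Qed.

Lemma cond_I n i f : adp gens n f -> bmf f ->
  E (fun w => f w * I n.+1 i w) = E (fun w => f w * pr n i w).
Proof.
move=> af bf; have := cond_prod [set i]%SET af bf.
by under eq_Ex do rewrite big_set1; under [RHS]eq_Ex do rewrite big_set1.
Qed.

Lemma cond_inno n i f : adp gens n f -> bmf f -> E (fun w => f w * inno n i w) = 0.
Proof.
move=> af bf; under eq_Ex do rewrite mulrBr.
rewrite ExB ?cond_I ?subrr//; apply: bmfM => //; [exact: bmf_I|exact: bmf_pr].
Qed.

Lemma cond_inno2 n i j f : adp gens n f -> bmf f ->
  E (fun w => f w * (inno n i w * inno n j w)) =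
  E (fun w => f w * ((i == j)%:R * (pr n i w * (1 - pr n i w)))).
Proof.
move=> af bf; have bi := bmf_pr n i; have bj := bmf_pr n j.
have bIi := bmf_I n.+1 i; have bIj := bmf_I n.+1 j.
have api := @ad_pr n i.
have afp : adp gens n (fun w => f w * pr n i w) by exact: adpM.
have bfp : bmf (fun w => f w * pr n i w) by exact: bmfM.
have [<-{j bj bIj}|ij] := eqVneq i j.
  (* As I^2 = I, the square (I - p)^2 equals (1 - p) I - p (I - p), which is affine in I and so
     within reach of [cond_I]. *)
  have -> : E (fun w => f w * (inno n i w * inno n i w)) =
      E (fun w => (f w * (1 - pr n i w)) * I n.+1 i w - (f w * pr n i w) * inno n i w).
    by apply: eq_Ex => w; rewrite /inno; case: (I01 n.+1 i w) => ->; ring.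
  have bg : bmf (fun w => f w * (1 - pr n i w)).
    by apply: bmfM => //; apply: bmfB => //; exact: bmf_cst.
  rewrite ExB ?cond_inno ?subr0 ?cond_I//.
  - by apply: eq_Ex => w; rewrite mul1r; ring.
  - by apply: adpM => //; apply: adpB => //; exact: adp_cst.
  - exact: bmfM.
  - by apply: bmfM => //; exact: bmf_inno.
have := cond_prod [set i; j]%SET af bf.
under eq_Ex do rewrite big_setU1 ?inE//= big_set1.
under [X in _ = X -> _]eq_Ex do rewrite big_setU1 ?inE//= big_set1.
move=> h.
have afj : adp gens n (fun w => f w * pr n j w) by apply: adpM => //; exact: ad_pr.
have bfj : bmf (fun w => f w * pr n j w) by exact: bmfM.
have -> : E (fun w => f w * (inno n i w * inno n j w)) =
    E (fun w => (f w * (I n.+1 i w * I n.+1 j w) - f w * (pr n i w * pr n j w))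
       - ((f w * pr n j w) * inno n i w + (f w * pr n i w) * inno n j w)).
  by apply: eq_Ex => w; rewrite /inno; ring.
have bII : bmf (fun w => f w * (I n.+1 i w * I n.+1 j w)) by apply: bmfM => //; exact: bmfM.
have bpp : bmf (fun w => f w * (pr n i w * pr n j w)) by apply: bmfM => //; exact: bmfM.
have b1 : bmf (fun w => (f w * pr n j w) * inno n i w) by apply: bmfM => //; exact: bmf_inno.
have b2 : bmf (fun w => (f w * pr n i w) * inno n j w) by apply: bmfM => //; exact: bmf_inno.
rewrite ExB; [|exact: bmfB|exact: bmfD].
rewrite ExB// ExD// !cond_inno// h.
by under [RHS]eq_Ex do rewrite mul0r mulr0; rewrite Ex_cst; ring.
Qed.

Definition noise n w : R := N%:R^-1 * \sum_(i < N) inno n i w.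
Definition cvar n w : R := (N%:R^-1) ^+ 2 * \sum_(i < N) pr n i w * (1 - pr n i w).
Definition mart n w : R := (zbar Z n w - q) / Pi (1 - rho) r n.

Let pp01 n i w : 0 <= pr n i w * (1 - pr n i w) <= 1.
Proof.
have /andP[p0 p1] := pr01 n i w.
have : 0 <= pr n i w * (1 - pr n i w) by rewrite mulr_ge0// subr_ge0.
by move=> h; rewrite h; have := sqr_ge0 (pr n i w); lra.
Qed.

Lemma mean_le1 (F : 'I_N -> R) : (forall i, `|F i| <= 1) -> `|N%:R^-1 * \sum_(i < N) F i| <= 1.
Proof.
move=> h; rewrite normrM ger0_norm ?invr_ge0 ?(ltW NR)// ler_pdivrMl// mulr1.
apply: (le_trans (ler_norm_sum _ _ _)).
rewrite -[in leRHS](card_ord N) -sum1_card natr_sum.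
by apply: ler_sum => i _.
Qed.

Lemma noise_mdiff : mdiff P gens noise cvar.
Proof.
have Ninv : `|N%:R^-1 : R| <= 1 by rewrite ger0_norm ?invr_ge0 ?(ltW NR)// invf_le1// ler1n.
split.
- move=> k; split; last by move=> w; apply: mean_le1 => i; exact: inno_le1.
  apply: measurable_funM; first exact: measurable_cst.
  by apply: measurable_sum => i; exact: (bmf_meas (bmf_inno k i)).
- move=> k; split.
    apply: measurable_funM; first exact: measurable_cst.
    apply: measurable_sum => i; apply: (@bmf_meas R d T).
    apply: bmfM; first exact: bmf_pr.
    by apply: bmfB; [exact: bmf_cst|exact: bmf_pr].
  move=> w; rewrite /cvar expr2 -mulrA normrM -[leRHS]mulr1 ler_pM//.
  by apply: mean_le1 => i; apply: norm01.
- move=> k f af bf.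
  have -> : E (fun w => f w * noise k w) = E (fun w => N%:R^-1 * \sum_(i < N) (f w * inno k i w)).
    by apply: eq_Ex => w; rewrite /noise mulrCA mulr_sumr.
  have b1 i : bmf (fun w => f w * inno k i w) by apply: bmfM => //; exact: bmf_inno.
  rewrite ExZ ?Ex_sum//; last exact: bmf_sum.
  by rewrite big1 ?mulr0// => i _; exact: cond_inno.
- move=> k f af bf.
  have b1 i j : bmf (fun w => f w * (inno k i w * inno k j w)).
    by apply: bmfM => //; apply: bmfM; exact: bmf_inno.
  have b2 i j : bmf (fun w => f w * ((i == j)%:R * (pr k i w * (1 - pr k i w)))).
    have bp := bmf_pr k i.
    apply: bmfM => //; apply: bmfZ; apply: bmfM => //; apply: bmfB => //; exact: bmf_cst.
  transitivity (E (fun w => N%:R^-1 ^+ 2 * \sum_(i < N) \sum_(j < N) f w * (inno k i w * inno k j w))).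
    apply: eq_Ex => w; rewrite /noise exprMn mulrCA; congr (_ * _).
    rewrite expr2 mulr_suml mulr_sumr; apply: eq_bigr => i _.
    by rewrite mulr_sumr mulr_sumr.
  transitivity (E (fun w => N%:R^-1 ^+ 2 * \sum_(i < N) \sum_(j < N)
      f w * ((i == j)%:R * (pr k i w * (1 - pr k i w))))); last first.
    apply: eq_Ex => w; rewrite /cvar mulrCA; congr (_ * _).
    rewrite mulr_sumr; apply: eq_bigr => i _.
    rewrite (bigD1 i)//= eqxx mul1r big1 ?addr0// => j ji.
    by rewrite eq_sym (negbTE ji) mul0r mulr0.
  rewrite !ExZ ?Ex_sum//; try by (apply: bmf_sum => i _; exact: bmf_sum).
  + congr (_ * _); apply: eq_bigr => i _; rewrite !Ex_sum//.
    by apply: eq_bigr => j _; exact: cond_inno2.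
  + by move=> i _; exact: bmf_sum.
  + by move=> i _; exact: bmf_sum.
Qed.

Lemma ad_mart n : adp gens n (mart n).
Proof.
by apply: adpM; [apply: adpB; [exact: ad_zbar|exact: adp_cst]|exact: adp_cst].
Qed.

(** The interaction preserves the mean: averaging [pr n i] over [i] gives [zbar Z n] whatever
    [alpha] is. *)
Lemma noiseE n w : noise n w = N%:R^-1 * (\sum_(i < N) I n.+1 i w) - zbar Z n w.
Proof.
have Nz : N%:R != 0 :> R by rewrite gt_eqF.
have SZ : \sum_(i < N) Z n i w = N%:R * zbar Z n w by rewrite /zbar mulrA divff ?mul1r.
rewrite /noise sumrB mulrBr; congr (_ - _).
rewrite big_split/= -mulr_sumr SZ sumr_const card_ord -[_ *+ _]mulr_natl.
by field.
Qed.

Lemma zbarS n w : zbar Z n.+1 w - q =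
  (1 - (1 - rho) * r n) * (zbar Z n w - q) + r n * rho * noise n w.
Proof.
have Nz : N%:R != 0 :> R by rewrite gt_eqF.
have -> : zbar Z n.+1 w = (1 - r n) * zbar Z n w
    + r n * (rho * (N%:R^-1 * (\sum_(i < N) I n.+1 i w)) + (1 - rho) * q).
  rewrite {1}/zbar; under eq_bigr do rewrite ZS.
  rewrite big_split/= -!mulr_sumr big_split/= -!mulr_sumr sumr_const card_ord -[_ *+ _]mulr_natl.
  by rewrite /zbar; field.
by rewrite noiseE; ring.
Qed.

Let b01 : 0 < 1 - rho <= 1.
Proof. by case/andP: rho01 => ? ?; rewrite subr_gt0 gerBl; apply/andP. Qed.

Lemma martS n w : mart n.+1 w = mart n w + rho * cf (1 - rho) r n * noise n w.
Proof.
have Pn := Pi_gt0 b01 hr n; have Pn1 := Pi_gt0 b01 hr n.+1.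
rewrite /mart zbarS /cf; rewrite PiS in Pn1 *.
have b0 : 1 - (1 - rho) * r n != 0 by apply: contraTneq Pn1 => ->; rewrite mulr0 ltxx.
by field; rewrite b0 gt_eqF.
Qed.

Lemma mart0 w : `|mart 0 w| <= 1.
Proof.
rewrite /mart /Pi big_ord0 divr1 ler_norml.
have /andP[? ?] := zbar01 0 w; have /andP[? ?] := q01; apply/andP; split; lra.
Qed.

Definition dev n w : R := \sum_(i < N) (Z n i w - q) ^+ 2.

Lemma bmf_dev n : bmf (dev n).
Proof.
by apply: bmf_sum => i _; apply: bmfX; apply: bmfB; [exact: bmf_Z|exact: bmf_cst].
Qed.

Lemma conv2 (a x y : R) : 0 <= a <= 1 -> ((1 - a) * x + a * y) ^+ 2 <= (1 - a) * x ^+ 2 + a * y ^+ 2.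
Proof.
move=> /andP[a0 a1]; rewrite -subr_ge0.
have -> : (1 - a) * x ^+ 2 + a * y ^+ 2 - ((1 - a) * x + a * y) ^+ 2 = a * (1 - a) * (x - y) ^+ 2 by ring.
by apply: mulr_ge0; [apply: mulr_ge0 => //; rewrite subr_ge0|exact: sqr_ge0].
Qed.

(** [pr n i w - q] is a convex combination of the own deviation and the mean deviation [m];
    convexity of the square and the inequality between the square of a mean and the mean of squares
    conclude. *)
Lemma pr_dev n w : \sum_(i < N) (pr n i w - q) ^+ 2 <= dev n w.
Proof.
have Nz : N%:R != 0 :> R by rewrite gt_eqF.
have /andP[a0 a1] := al01.
set m := zbar Z n w - q.
have hm : N%:R * m ^+ 2 <= dev n w.
  have : 0 <= \sum_(i < N) (Z n i w - q - m) ^+ 2 by apply: sumr_ge0 => i _; exact: sqr_ge0.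
  under eq_bigr do rewrite sqrrB.
  rewrite big_split/= sumrB sumr_const card_ord -[_ *+ N]mulr_natl.
  have -> : \sum_(i < N) (Z n i w - q) * m *+ 2 = 2 * (N%:R * m ^+ 2).
    transitivity ((\sum_(i < N) (Z n i w - q)) * (2 * m)).
      by rewrite mulr_suml; apply: eq_bigr => i _; rewrite -[_ *+ 2]mulr_natl; ring.
    have SZ : \sum_(i < N) Z n i w = N%:R * zbar Z n w by rewrite /zbar mulrA divff ?mul1r.
    rewrite sumrB SZ sumr_const card_ord -[_ *+ N]mulr_natl /m; ring.
  rewrite -/(dev n w); lra.
apply: (@le_trans _ _ (\sum_(i < N) ((1 - alpha) * (Z n i w - q) ^+ 2 + alpha * m ^+ 2))).
  apply: ler_sum => i _; apply: (le_trans _ (conv2 _ _ al01)).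
  by rewrite /pr /m le_eqVlt; apply/orP; left; apply/eqP; congr (_ ^+ 2); ring.
rewrite big_split/= -mulr_sumr -/(dev n w) sumr_const card_ord -[_ *+ N]mulr_natl.
have := ler_wpM2l a0 hm; lra.
Qed.

(** The noise is orthogonal to the predictable part [A], whose square is bounded by convexity with
    weights 1 - r and r. With [pr_dev] and rho^2 <= rho the factor becomes 1 - r + r rho; the noise
    adds at most r^2 per coordinate. *)
Lemma devS n : E (dev n.+1) <= (1 - (1 - rho) * r n) * E (dev n) + N%:R * r n * r n.
Proof.
have /andP[r0 r1] := hr n; have /andP[h0 h1] := rho01.
have bZ i : bmf (fun w => Z n i w - q) by apply: bmfB; [exact: bmf_Z|exact: bmf_cst].
have bp i : bmf (fun w => pr n i w - q) by apply: bmfB; [exact: bmf_pr|exact: bmf_cst].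
pose A i w := (1 - r n) * (Z n i w - q) + r n * rho * (pr n i w - q).
have bA i : bmf (A i) by apply: bmfD; exact: bmfZ.
have aA i : adp gens n (A i).
  apply: adpD; apply: adpM; try exact: adp_cst.
    by apply: adpB; [exact: adZ|exact: adp_cst].
  by apply: adpB; [exact: ad_pr|exact: adp_cst].
have bx i : bmf (fun w => A i w * inno n i w) by apply: bmfM => //; exact: bmf_inno.
have bS : bmf (fun w => \sum_(i < N) A i w * inno n i w) by exact: bmf_sum.
have hE : E (fun w => \sum_(i < N) A i w * inno n i w) = 0.
  by rewrite Ex_sum// big1// => i _; exact: cond_inno.
have bd := bmf_dev n.
have b3 : bmf (fun w => (1 - (1 - rho) * r n) * dev n w + N%:R * r n * r n).
  by apply: bmfD; [exact: bmfZ|exact: bmf_cst].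
apply: (@le_trans _ _ (E (fun w => ((1 - (1 - rho) * r n) * dev n w + N%:R * r n * r n)
   + 2 * r n * rho * \sum_(i < N) A i w * inno n i w))); last first.
  rewrite ExD//; last exact: bmfZ.
  rewrite [X in _ + X]ExZ// hE mulr0 addr0 ExD; [|exact: bmfZ|exact: bmf_cst].
  by rewrite Ex_cst ExZ.
apply: le_Ex; first exact: bmf_dev.
  by apply: bmfD => //; exact: bmfZ.
move=> w.
have hi i : (Z n.+1 i w - q) ^+ 2 <= (1 - r n) * (Z n i w - q) ^+ 2
    + r n * rho * (pr n i w - q) ^+ 2 + r n * r n + 2 * r n * rho * (A i w * inno n i w).
  have -> : Z n.+1 i w - q = A i w + r n * rho * inno n i w by rewrite ZS /A /inno; ring.
  have h2 : A i w ^+ 2 <= (1 - r n) * (Z n i w - q) ^+ 2 + r n * rho * (pr n i w - q) ^+ 2.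
    have -> : A i w = (1 - r n) * (Z n i w - q) + r n * (rho * (pr n i w - q)) by rewrite /A; ring.
    have r01 : 0 <= r n <= 1 by rewrite r0 ltW.
    apply: le_trans (conv2 _ _ r01) _; rewrite lerD2l -mulrA; apply: ler_wpM2l => //.
    rewrite exprMn; apply: ler_wpM2r; first exact: sqr_ge0.
    by rewrite expr2 -[leRHS]mulr1; apply: ler_wpM2l => //; exact: ltW.
  have h3 : (r n * rho * inno n i w) ^+ 2 <= r n * r n.
    rewrite -expr2 -[leLHS]real_normK ?num_real// ler_pXn2r ?nnegrE//.
    rewrite !normrM (ger0_norm r0) (ger0_norm h0) -[leRHS]mulr1 -mulrA; apply: ler_wpM2l => //.
    by rewrite -[leRHS]mulr1; apply: ler_pM => //; [exact: ltW|exact: inno_le1].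
  rewrite sqrrD -[_ *+ 2]mulr_natl; lra.
apply: (le_trans (ler_sum _ (fun i _ => hi i))).
rewrite !big_split/= -!mulr_sumr -/(dev n w) sumr_const card_ord -[_ *+ N]mulr_natl.
rewrite lerD2r.
have := ler_wpM2l (mulr_ge0 r0 h0) (pr_dev n w); lra.
Qed.

Lemma dev_cvg0 : (forall A : R, exists n, A <= \sum_(k < n) r k) ->
  r n @[n --> \oo] --> (0 : R) -> E (dev n) @[n --> \oo] --> (0 : R).
Proof.
move=> rS cr; case/andP: b01 => b0 _.
apply: (@contraction_cvg0 _ _ r (fun n => N%:R * r n) (1 - rho)) => //.
- by move=> n; apply: Ex_ge0 => w; apply: sumr_ge0 => i _; exact: sqr_ge0.
- by move=> n; case/andP: (hr n).
- by rewrite -[X in _ --> X](mulr0 (N%:R : R)); apply: cvgM => //; exact: cvg_cst.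
- by apply: nearW => n; exact: devS.
Qed.

Let sg : R := q * (1 - q) / N%:R.

(** p(1 - p) - q(1 - q) = (p - q)(1 - p - q), whose last factor is at most 1 in absolute value; |x|
    <= e + x^2 / e then passes to squared deviations, the quantity known to vanish. *)
Lemma cvar_dev n w (e : R) : 0 < e -> `|cvar n w - sg| <= N%:R * e + e^-1 * dev n w.
Proof.
move=> e0; have Nz : N%:R != 0 :> R by rewrite gt_eqF.
have -> : cvar n w - sg = N%:R^-1 ^+ 2 *
    \sum_(i < N) (pr n i w * (1 - pr n i w) - q * (1 - q)).
  rewrite sumrB mulrBr; congr (_ - _).
  by rewrite sumr_const card_ord -[_ *+ N]mulr_natl /sg; field.
have N1 : `|N%:R^-1 ^+ 2 : R| <= 1.
  by rewrite ger0_norm ?sqr_ge0// exprn_ile1// ?invr_ge0 ?(ltW NR)// invf_le1// ler1n.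
rewrite normrM; apply: (@le_trans _ _ (1 * `|\sum_(i < N) (pr n i w * (1 - pr n i w) - q * (1 - q))|)).
  exact: ler_wpM2r.
rewrite mul1r; apply: (le_trans (ler_norm_sum _ _ _)).
apply: (@le_trans _ _ (\sum_(i < N) (e + e^-1 * (pr n i w - q) ^+ 2))); last first.
  rewrite big_split/= -mulr_sumr sumr_const card_ord -[_ *+ N]mulr_natl lerD2l.
  by apply: ler_wpM2l; [rewrite invr_ge0 ltW|exact: pr_dev].
apply: ler_sum => i _.
have /andP[p0 p1] := pr01 n i w; have /andP[q0 q1] := q01.
have -> : pr n i w * (1 - pr n i w) - q * (1 - q) = (pr n i w - q) * (1 - pr n i w - q) by ring.
set x := pr n i w - q.
apply: (@le_trans _ _ `|x|).
  rewrite normrM -[leRHS]mulr1; apply: ler_wpM2l => //.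
  by rewrite ler_norml; apply/andP; split; lra.
rewrite -(ler_pM2l e0) mulrDr mulrA divff ?gt_eqF// mul1r -[x ^+ 2]real_normK ?num_real//.
have := sqr_ge0 (`|x| - e); rewrite sqrrB -[_ *+ 2]mulr_natl; have := mulr_ge0 (ltW e0) (normr_ge0 x).
lra.
Qed.

Lemma cvar_cvg : (forall A : R, exists n, A <= \sum_(k < n) r k) ->
  r n @[n --> \oo] --> (0 : R) ->
  E (fun w => `|cvar n w - sg|) @[n --> \oo] --> (0 : R).
Proof.
move=> rS cr; apply/cvgrPdist_le => e e0.
have N2 : (0 : R) < N%:R * 2 by rewrite mulr_gt0.
pose dl := e / (N%:R * 2); have dl0 : 0 < dl by rewrite divr_gt0.
have ed : 0 < dl * (e / 2) by rewrite mulr_gt0// divr_gt0.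
have /cvgrPdist_le/(_ _ ed) := dev_cvg0 rS cr; apply: filterS => n.
rewrite !sub0r !normrN => h.
have [_ /(_ n)[mv v1] _ _] := noise_mdiff.
have bv : bmf (cvar n) by split => //; exists 1.
have bvs : bmf (fun w => `|cvar n w - sg|) by apply: bmf_norm; apply: bmfB => //; exact: bmf_cst.
have bd := bmf_dev n.
rewrite ger0_norm; last by apply: Ex_ge0 => w.
apply: (@le_trans _ _ (E (fun w => N%:R * dl + dl^-1 * dev n w))).
  apply: le_Ex => //; first by apply: bmfD; [exact: bmf_cst|exact: bmfZ].
  by move=> w; exact: cvar_dev.
rewrite ExD; [|exact: bmf_cst|exact: bmfZ].
rewrite Ex_cst ExZ//.
have h2 : dl^-1 * E (dev n) <= e / 2.
  by rewrite ler_pdivrMl//; apply: le_trans h; exact: ler_norm.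
have -> : N%:R * dl = e / 2 by rewrite /dl; field; rewrite gt_eqF.
lra.
Qed.

End urn_model.

(** * Both regimes along a common clock *)

Section urn_fclt.
Context {R : realType} d {T : measurableType d} (P : probability T R).
Variables (N : nat) (rho alpha q : R) (r : nat -> R) (Z I : nat -> 'I_N -> T -> R).
Hypothesis N0 : (0 < N)%N.
Hypothesis rho01 : 0 <= rho < 1.
Hypothesis al01 : 0 <= alpha <= 1.
Hypothesis q01 : 0 < q < 1.
Hypothesis hr : forall n, 0 <= r n < 1.
Hypothesis mZ : forall n i, measurable_fun setT (Z n i).
Hypothesis mI : forall n i, measurable_fun setT (I n i).
Hypothesis Z01 : forall n i w, 0 <= Z n i w <= 1.
Hypothesis I01 : forall n i w, I n i w = 0 \/ I n i w = 1.
Hypothesis ZS : forall n i w, Z n.+1 i w =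
  (1 - r n) * Z n i w + r n * (rho * I n.+1 i w + (1 - rho) * q).
Hypothesis hI : forall (n : nat) (S : {set 'I_N}) (B : set T), filtr Z n B ->
  P (B `&` [set w | forall i, i \in S -> I n.+1 i w = 1]) =
  (\int[P]_(w in B)
     (\prod_(i in S) ((1 - alpha) * Z n i w + alpha * zbar Z n w))%:E)%E.
Context d' {T' : measurableType d'} (P' : probability T' R) (W : R -> T' -> R).
Hypothesis hW : std_brownian P' W.

Variables (gamma c : R).
Hypothesis g01 : 0 < gamma <= 1.
Hypothesis c0 : 0 < c.
Hypothesis hc : n%:R `^ gamma * r n @[n --> \oo] --> c.
Local Notation b := (1 - rho).
Variable z : R.
Hypothesis hz : (qn gamma n - 1) / r n @[n --> \oo] --> z.
Hypothesis th0 : 0 < 2 * b - z.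
Variables (tau : R -> R) (dd : nat -> nat -> R) (nu : R -> R).
Hypothesis tau0 : tau 0 = 0.
Hypothesis tau_lip : forall s t : R, 0 <= s -> s < t -> 0 < tau t - tau s <= t - s.
Hypothesis dd_ge0 : forall n k, 0 <= dd n k.
Hypothesis C1 : forall m e : R, 0 <= m -> 0 < e -> \forall n \near \oo, forall k,
  (n <= k)%N -> k%:R <= n%:R + n%:R `^ gamma * m -> `|r k - c * dd n k| <= e * dd n k.
Hypothesis C2 : forall m e : R, 0 <= m -> 0 < e -> \forall n \near \oo, forall t : R,
  0 <= t <= m -> tau t - e <= \sum_(n <= i < kp gamma n t) dd n i <= tau t.
Hypothesis C3 : forall t : R, 0 <= t ->
  n%:R `^ gamma / (kp gamma n t)%:R `^ gamma @[n --> \oo] --> nu t.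
Variables (kk K : R) (et Lam : R -> R).
Hypothesis kk0 : 0 < kk.
Hypothesis KE : K = q * (1 - q) / N%:R * rho ^+ 2 * (c / (2 * b - z)).
Hypothesis etE : forall t : R, 0 <= t -> et t = expR (c * b * tau t).
Hypothesis LamE : forall t : R, 0 <= t -> Lam t = expR (kk * tau t).
Hypothesis nuE : forall t : R, 0 <= t -> nu t * expR (c * b * tau t) ^+ 2 = expR (kk * tau t).

Let sg : R := q * (1 - q) / N%:R.
Let NR : (0 : R) < N%:R. Proof. by rewrite ltr0n. Qed.
Let b01 : 0 < b <= 1.
Proof. by case/andP: rho01 => ? ?; rewrite subr_gt0 gerBl; apply/andP. Qed.

Lemma tau_mono (s t : R) : 0 <= s -> s <= t -> 0 <= tau s <= tau t.
Proof.
move=> s0 st; apply/andP; split.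
  move: s0; rewrite le_eqVlt => /orP[/eqP <-|s0]; first by rewrite tau0.
  by have := tau_lip (lexx _) s0; rewrite tau0 subr0 => /andP[/ltW].
move: st; rewrite le_eqVlt => /orP[/eqP ->//|st].
by have := tau_lip s0 st; rewrite subr_gt0 => /andP[/ltW].
Qed.

Lemma expR_tau_lip (k m : R) : 0 <= k -> exists2 Lp, 0 <= Lp & forall s t : R,
  0 <= s <= m -> 0 <= t <= m -> `|expR (k * tau s) - expR (k * tau t)| <= Lp * `|s - t|.
Proof.
move=> k0; exists (expR (k * tau m) * k); first by rewrite mulr_ge0// expR_ge0.
move=> s t; wlog st : s t / s <= t.
  move=> H hs ht; have [st|/ltW ts] := leP s t; first exact: H.
  by rewrite distrC [`|s - t|]distrC; exact: H.
move=> /andP[s0 sm] /andP[t0 tm]; rewrite distrC [`|s - t|]distrC.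
have /andP[h0 h1] := tau_mono s0 st; have /andP[_ h2] := tau_mono t0 tm.
have h3 : tau t - tau s <= t - s.
  move: st; rewrite le_eqVlt => /orP[/eqP ->|st]; first by rewrite !subrr.
  by case/andP: (tau_lip s0 st).
have e1 : expR (k * tau s) <= expR (k * tau t) by rewrite ler_expR ler_wpM2l.
rewrite !ger0_norm ?subr_ge0//.
have -> : expR (k * tau t) - expR (k * tau s) =
    expR (k * tau t) * (1 - expR (- (k * (tau t - tau s)))).
  rewrite mulrBr mulr1 -expRD; congr (_ - expR _); ring.
have h4 : 1 - expR (- (k * (tau t - tau s))) <= k * (tau t - tau s).
  by have := expR_ge1Dx (- (k * (tau t - tau s))); lra.
rewrite -mulrA; apply: ler_pM; rewrite ?expR_ge0 ?ler_expR ?ler_wpM2l//.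
  by rewrite subr_ge0 -expR0 ler_expR oppr_le0 mulr_ge0// subr_ge0.
by apply: (le_trans h4); apply: ler_wpM2l.
Qed.

Lemma et_econt : econt et.
Proof.
move=> t e t0 e0; case/andP: b01 => b0 _.
have [Lp Lp0 hL] := @expR_tau_lip (c * b) (t + 1) (mulr_ge0 (ltW c0) (ltW b0)).
have Lp1 : 0 < Lp + 1 by rewrite ltr_wpDl.
exists (Num.min 1 (e / (Lp + 1))); first by rewrite lt_min ltr01 divr_gt0.
move=> s s0; rewrite lt_min ltr_pdivlMr// => /andP[h1 h2].
rewrite !etE//; apply: le_trans (hL _ _ _ _) _.
- by rewrite t0 lerDl ler01.
- by rewrite s0; move: h1; rewrite ltr_norml => /andP[? ?]; lra.
apply: ltW; apply: le_lt_trans h2; rewrite mulrC; apply: ler_wpM2l => //; lra.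
Qed.

(** [K] is the limiting noise variance q(1 - q)/N times rho^2 times the fixed point c/(2b - z).
    [Lam] arises because variance is accumulated up to [kp gamma n t] but normalised at n: it is the
    ratio [nu] of the powers times the square of the exponential factor. *)
Theorem urn_fclt : cvg_dist_skorohod P P'
  (fun n w t => n%:R `^ (gamma / 2) * et t *
     (zbar Z (Num.truncn (n%:R + n%:R `^ gamma * t)) w - q))
  (fun w t => W (K * Lam t) w).
Proof.
case/andP: (b01) => b0 b1; case/andP: (rho01) => rho0 rho1; case/andP: (q01) => q0 q1.
have sg01 : 0 < sg <= 1.
  rewrite /sg divr_gt0 ?mulr_gt0 ?subr_gt0//= ler_pdivrMr// mul1r.
  apply: (@le_trans _ _ 1); last by rewrite ler1n.
  by have := sqr_ge0 q; lra.
have cz : 0 < c / (2 * b - z) by rewrite divr_gt0.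
have hmd := noise_mdiff N0 al01 mZ mI Z01 I01 hI.
have cS2 (e : nat -> R) (el t : R) : 0 <= t -> e n @[n --> \oo] --> el ->
    \sum_(k < kp gamma n t) (hf gamma b r n * (rho * cf b r k)) ^+ 2 * e k @[n --> \oo] -->
    rho ^+ 2 * (expR (kk * tau t) * (c / (2 * b - z) * el)).
  move=> t0 ce; have := hsum2_cvg g01 c0 b01 hr hc hz th0 tau_mono dd_ge0 C1 C2 C3 t0 ce.
  rewrite nuE// => h.
  apply: (@cvg_trans _ ((rho ^+ 2 * (hf gamma b r n ^+ 2 *
      \sum_(k < kp gamma n t) cf b r k ^+ 2 * e k)) @[n --> \oo])).
    apply: near_eq_cvg; apply: nearW => n.
    rewrite !mulr_sumr; apply: eq_bigr => k _; ring.
  rewrite (_ : c / _ * el = c * el / (2 * b - z)); last by rewrite mulrAC.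
  by apply: cvgM => //; exact: cvg_cst.
have bE n (t : R) w : (0 < n)%N -> 0 <= t -> n%:R `^ (gamma / 2) * et t * (zbar Z (kp gamma n t) w - q) =
    bf gamma c b r tau n t * (hf gamma b r n * mart rho q r Z (kp gamma n t) w).
  move=> n0 t0; rewrite etE// /bf /hf /mart.
  have p1 := Pi_gt0 b01 hr n; have p2 := Pi_gt0 b01 hr (kp gamma n t).
  by field; rewrite !gt_eqF.
refine (@fclt R d T P (gens Z) (gens_sub mZ) (@gens_mono R d T N Z) _ _ _ _ hmd
  (@ad_mart _ _ _ _ _ _ _ _) (martS alpha N0 rho01 hr ZS) sg sg01 _ _ _ _ hW (hf gamma b r) (kp gamma)
  (fun t => K * Lam t) 1 _ (mart0 rho r N0 q01 Z01) (hf_cvg0 g01 c0 b01 hr hc hz th0) _ _ _ _ _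
  (fun n t => n%:R `^ (gamma / 2) * et t) (bf gamma c b r tau) (fun k w => zbar Z k w - q)
  _ _ _ bE (bf_cvg g01 c0 b01 hr hc tau_mono dd_ge0 C1 C2)).
- by move=> n s t; exact: kp_mono.
- move=> t t0; have h : (1 : R) @[n --> \oo] --> (1 : R) by exact: cvg_cst.
  have := cS2 (fun=> 1) 1 t t0 h => {}h.
  apply: (@cvg_trans _ ((sg * \sum_(k < kp gamma n t) (hf gamma b r n * (rho * cf b r k)) ^+ 2 * 1) @[n --> \oo])).
    by apply: near_eq_cvg; apply: nearW => n; congr (_ * _); apply: eq_bigr => k _; rewrite mulr1.
  rewrite (_ : K * Lam t = sg * (rho ^+ 2 * (expR (kk * tau t) * (c / (2 * b - z) * 1)))).
    by apply: cvgM => //; exact: cvg_cst.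
  by rewrite KE LamE// /sg; ring.
- move=> t t0; have := cS2 _ _ _ t0 (cvar_cvg N0 rho01 al01 q01 hr mZ mI Z01 I01 ZS hI
    (r_sum g01 c0 b01 hr hc) (r_cvg0 g01 hc)).
  by rewrite !mulr0.
- move=> t t0; have h := hsum3_cvg g01 c0 b01 hr hc hz th0 tau_mono dd_ge0 C1 C2 C3 t0.
  apply: (@cvg_trans _ ((rho ^+ 3 * \sum_(k < kp gamma n t) (hf gamma b r n * cf b r k) ^+ 3) @[n --> \oo])).
    apply: near_eq_cvg; apply: nearW => n.
    rewrite mulr_sumr; apply: eq_bigr => k _; rewrite ger0_norm; first by ring.
    by apply: mulr_ge0; [exact: hf_ge0|apply: mulr_ge0 => //; exact: cf_ge0].
  have : rho ^+ 3 * (\sum_(k < kp gamma n t) (hf gamma b r n * cf b r k) ^+ 3) @[n --> \oo] --> rho ^+ 3 * 0.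
    by apply: cvgM; [exact: cvg_cst|exact: h].
  by rewrite mulr0.
(* For rho = 0 the recursion has no noise, [K] vanishes and the limit is the path constantly 0. *)
- have [rhoE|rho_neq0] := eqVneq rho 0; last left.
    by right => t t0; rewrite KE rhoE; ring.
  have rp : 0 < rho by rewrite lt_def rho_neq0.
  have K0 : 0 < K by rewrite KE mulr_gt0// mulr_gt0 ?exprn_gt0//; case/andP: sg01.
  split; first by rewrite LamE// mulr_gt0 ?expR_gt0.
  move=> s t s0 st; rewrite !LamE ?(le_trans s0 (ltW st))// ltr_pM2l// ltr_expR ltr_pM2l//.
  by have := tau_lip s0 st; rewrite subr_gt0 => /andP[].
- move=> m; have [Lp Lp0 hL] := @expR_tau_lip kk m (ltW kk0).
  exists (`|K| * Lp); first by rewrite mulr_ge0.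
  move=> s t hs ht; case/andP: (hs) => s0 _; case/andP: (ht) => t0 _.
  by rewrite !LamE// -mulrBr normrM -mulrA; apply: ler_wpM2l => //; exact: hL.
- move=> k; apply: measurable_funB; last exact: measurable_cst.
  exact: (adp_meas (gens_sub mZ) (@ad_zbar _ _ _ _ _ k)).
- move=> n n0; split; last by apply: stepidx_truncn => //; exact: npow_gt0.
  move=> t e t0 e0; have np := npow_gt0 (gamma / 2) n0.
  have [x x0 hx] := @et_econt t (e / n%:R `^ (gamma / 2)) t0 (divr_gt0 e0 np).
  exists x => // s s0 ts; rewrite -mulrBr normrM gtr0_norm// mulrC -ler_pdivlMr//.
  exact: hx.
- move=> n m; exists (n%:R `^ (gamma / 2) * expR (c * b * tau m%:R)).
    by rewrite mulr_ge0 ?powR_ge0 ?expR_ge0.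
  move=> t /andP[t0 tm]; rewrite etE// normrM !ger0_norm ?powR_ge0 ?expR_ge0//.
  apply: ler_wpM2l; first exact: powR_ge0.
  rewrite ler_expR; apply: ler_wpM2l; first by rewrite mulr_ge0 ?ltW.
  by case/andP: (tau_mono t0 tm).
Qed.

End urn_fclt.

From mathcomp Require Import perm.

Theorem theorem2p8 (R : realType) (d : measure_display) (T : measurableType d)
  (P : probability T R) (N : nat) (rho alpha q gamma c : R) (r : nat -> R)
  (Z : nat -> 'I_N -> T -> R) (I : nat -> 'I_N -> T -> R) :
  (0 < N)%N ->
  0 <= rho < 1 -> 0 <= alpha <= 1 -> 0 < q < 1 ->
  (forall n, 0 <= r n < 1) ->
  2^-1 < gamma <= 1 -> 0 < c ->
  (fun n : nat => n%:R `^ gamma * r n) @ \oo --> c ->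
  (forall n i, measurable_fun setT (Z n i)) ->
  (forall n i, measurable_fun setT (I n i)) ->
  (forall n i w, 0 <= Z n i w <= 1) ->
  (forall n i w, I n i w = 0 \/ I n i w = 1) ->
  (forall n i w, Z n.+1 i w =
     (1 - r n) * Z n i w + r n * (rho * I n.+1 i w + (1 - rho) * q)) ->
  (* given F_n, I_{n+1}(1..N) are conditionally independent with
     P(I_{n+1}(i) = 1 | F_n) = (1 - alpha) Z_n(i) + alpha Z_n *)
  (forall (n : nat) (S : {set 'I_N}) (B : set T), filtr Z n B ->
     P (B `&` [set w | forall i, i \in S -> I n.+1 i w = 1]) =
     (\int[P]_(w in B)
        (\prod_(i in S) ((1 - alpha) * Z n i w + alpha * zbar Z n w))%:E)%E) ->
  (* the law of (Z_0(1), ..., Z_0(N)) is permutation invariant *)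
  (forall (s : {perm 'I_N}) (A : set (N.-tuple R)), measurable A ->
     P [set w | A [tuple Z 0%N (s i) w | i < N]] =
     P [set w | A [tuple Z 0%N i w | i < N]]) ->
  (forall i, (\int[P]_w (Z 0%N i w)%:E)%E = (2^-1 : R)%:E) ->
  (0 < \int[P]_w (zbar Z 0%N w * (1 - zbar Z 0%N w))%:E)%E ->
  forall (d' : measure_display) (T' : measurableType d') (P' : probability T' R)
         (W : R -> T' -> R),
  std_brownian P' W ->
  (* (i) *)
  (gamma < 1 ->
    cvg_dist_skorohod P P'
      (fun n w t => n%:R `^ (gamma / 2) * expR (c * (1 - rho) * t) *
         (zbar Z (Num.truncn (n%:R + n%:R `^ gamma * t)) w - q))
      (fun w t => W (c * q * (1 - q) * rho ^+ 2 / (2 * N%:R * (1 - rho))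
                      * expR (2 * c * (1 - rho) * t)) w)) /\
  (* (ii) *)
  (gamma = 1 -> 1 < 2 * c * (1 - rho) ->
    cvg_dist_skorohod P P'
      (fun n w t => n%:R `^ (2^-1) * (1 + t) `^ (c * (1 - rho)) *
         (zbar Z (Num.truncn (n%:R + n%:R * t)) w - q))
      (fun w t => W (c ^+ 2 * q * (1 - q) * rho ^+ 2
                      / (N%:R * (2 * c * (1 - rho) - 1))
                      * (1 + t) `^ (2 * c * (1 - rho) - 1)) w)).
Proof.
move=> N0 rho01 al01 q01 hr g01 c0 hc mZ mI Z01 I01 ZS hI _ _ _ d' T' P' W hW.
have /andP[rho0 rho1] := rho01; have b0 : 0 < 1 - rho by rewrite subr_gt0.
have /andP[g2 g1] := g01; have gam0 : 0 < gamma by apply: lt_trans g2; rewrite invr_gt0.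
have NR : (0 : R) < N%:R by rewrite ltr0n.
split => [gam1|gE].
  have gg : 0 < gamma < 1 by rewrite gam0.
  (* Here z = 0 and nu = 1, with the identity as clock. *)
  apply: (urn_fclt N0 rho01 al01 q01 hr mZ mI Z01 I01 ZS hI hW _ c0 hc (slow_z gg c0 hr hc)
    _ _ _ _ (slow_C1 gg c0 hr hc) (slow_C2 gg) (slow_C3 gg) (kk := 2 * c * (1 - rho)) (tau := id)) => //.
  - by rewrite gam0.
  - by rewrite subr0 mulr_gt0.
  - by move=> s t s0 st; rewrite subr_gt0 st lexx.
  - by apply: mulr_gt0 => //; apply: mulr_gt0.
  - by field; rewrite !gt_eqF.
  - by move=> t t0; rewrite mul1r expr2 -expRD; congr expR; ring.
subst gamma => c1.
have kk0 : 0 < 2 * c * (1 - rho) - 1 by rewrite subr_gt0.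
have pos (t : R) : 0 <= t -> 0 < 1 + t by move=> t0; rewrite ltr_wpDr.
have powE (t p : R) : 0 <= t -> (1 + t) `^ p = expR (p * ln (1 + t)).
  by move=> /pos t0; rewrite /powR gt_eqF.
rewrite (_ : (fun n w t => _) = fun n w t => n%:R `^ (1 / 2) * (1 + t) `^ (c * (1 - rho)) *
    (zbar Z (Num.truncn (n%:R + n%:R `^ 1 * t)) w - q)); last first.
  by apply/funext => n; apply/funext => w; apply/funext => t; rewrite div1r powRr1.
have th0 : 0 < 2 * (1 - rho) - c^-1.
  rewrite (_ : _ - _ = (2 * c * (1 - rho) - 1) / c) ?divr_gt0//.
  by field; rewrite gt_eqF.
(* Here z = 1/c and the clock is ln (1 + t); nu t = 1 / (1 + t) lowers the exponent 2c(1 - rho) by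
   one. *)
apply: (urn_fclt N0 rho01 al01 q01 hr mZ mI Z01 I01 ZS hI hW _ c0 hc (fast_z c0 hr hc)
  th0 _ _ _ (fast_C1 c0 hc) (fast_C2 (R := R)) (fast_C3 (R := R))
  (kk := 2 * c * (1 - rho) - 1) (tau := fun t => ln (1 + t))) => //.
- by rewrite ltr01 lexx.
- by rewrite addr0 ln1.
- move=> s t s0 st; have t0 : 0 <= t by rewrite ltW// (le_lt_trans s0).
  have s1 := pos _ s0; have t1 := pos _ t0.
  rewrite subr_gt0 ltr_ln ?posrE// ltrD2l st/= -ln_div ?posrE//.
  have -> : (1 + t) / (1 + s) = 1 + (t - s) / (1 + s) by field; rewrite gt_eqF.
  have h0 : 0 <= (t - s) / (1 + s) by rewrite divr_ge0 ?subr_ge0 ?ltW.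
  apply: (le_trans (le_ln1Dx _)); first by rewrite (lt_le_trans _ h0)// ltrN10.
  by rewrite ler_pdivrMr// ler_peMr ?subr_ge0 ?(ltW st)// lerDl.
- by move=> n k; exact: lnd_ge0.
- have kk1 : 0 < 2 * (1 - rho) * c - 1 by lra.
  by field; rewrite !gt_eqF.
- by move=> t t0; exact: powE.
- by move=> t t0; exact: powE.
- move=> t t0; have t1 := pos _ t0.
  rewrite -{1}(lnK t1) -expRN expr2 -!expRD; congr expR; ring.
Qed.
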